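(* Let $\mathcal{J}$ be a JBW$^*$-algebra and $F$ a JB$^*$-triple. Then every (not necessarily linear) 2-local triple homomorphism $T:\mathcal{J}\to F$ is linear and a triple homomorphism.
   Context: A JB$^*$-triple is a complex Banach space $E$ with a continuous triple product $\{.,.,.\}:E\times E\times E\to E$, conjugate-linear in the middle variable and symmetric and bilinear in the outer variables, such that, writing $L(a,b)x=\{a,b,x\}$, for all $a,b,x,y\in E$: (1) $L(a,b)L(x,y)-L(x,y)L(a,b)=L(L(a,b)x,y)-L(x,L(b,a)y)$; (2) $L(a,a)$ is a hermitian operator with non-negative spectrum; (3) $\|\{a,a,a\}\|=\|a\|^3$. A JB$^*$-algebra is a complex Jordan algebra $(\mathcal{J},\circ)$ with a complete norm satisfying $\|a\circ b\|\le\|a\|\|b\|$ and an algebra involution $*$ such that $\|\{a,a,a\}\|=\|a\|^3$, where $\{a,b,c\}:=(a\circ b^* )\circ c+(c\circ b^* )\circ a-(a\circ c)\circ b^*$; with this triple product it is a JB$^*$-triple. A JBW$^*$-algebra is a JB$^*$-algebra which is also a dual Banach space (it is automatically unital). A triple homomorphism between JB$^*$-triples is a linear map $\Phi:E\to F$ with $\Phi(\{a,b,c\})=\{\Phi(a),\Phi(b),\Phi(c)\}$ for all $a,b,c\in E$. A mapping $T:E\to F$ (not assumed linear or continuous) is a 2-local triple homomorphism if for every $a,b\in E$ there is a bounded (linear) triple homomorphism $\Phi_{a,b}:E\to F$, depending on $a,b$, with $\Phi_{a,b}(a)=T(a)$ and $\Phi_{a,b}(b)=T(b)$. *)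

(* Defs.v *)
From mathcomp Require Import all_boot all_order all_algebra.
From mathcomp Require Export complex.
From mathcomp Require Export all_classical all_reals all_analysis.
Export Order.TTheory GRing.Theory Num.Theory.
Export numFieldNormedType.Exports.

Set Implicit Arguments.
Unset Strict Implicit.
Unset Printing Implicit Defensive.

Local Open Scope classical_set_scope.
Local Open Scope ring_scope.

(* Complex Banach spaces are completeNormedModType R[i]; their norm takes its
   values in R[i], where 0 <= z means that z is real and non-negative. *)

Definition bounded_linear (R : realType) (E F : normedModType R[i])
    (f : E -> F) : Prop :=
  linear f /\ continuous f.

Definition conjugate_linear (R : realType) (E F : lmodType R[i])
    (f : E -> F) : Prop :=
  forall (k : R[i]) (x y : E), f (k *: x + y) = conjc k *: f x + f y.

(* exp(T) x; for bounded T on a Banach space the exponential series converges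
   in operator norm, so its sum is computed pointwise. *)
Definition op_exp (R : realType) (E : completeNormedModType R[i])
    (T : E -> E) (x : E) : E :=
  limn (series (fun n => (n`!%:R)^-1 *: iter n T x)).

(* Every exp(itT) is an isometry. As exp(-itT) is its inverse, this says
   ||exp(itT)|| = 1 for all real t when E is nonzero, without excluding
   the zero space. *)
Definition hermitian (R : realType) (E : completeNormedModType R[i])
    (T : E -> E) : Prop :=
  bounded_linear T /\
  forall (t : R) (x : E), `|op_exp (fun y => (0 +i* t)%C *: T y) x| = `|x|.

(* Spectrum in the Banach algebra of bounded operators on E. *)
Definition spectrum (R : realType) (E : completeNormedModType R[i])
    (T : E -> E) : set R[i] :=
  [set l | ~ exists S : E -> E,
    [/\ bounded_linear S,
        forall x, S (T x - l *: x) = x &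
        forall x, T (S x) - l *: S x = x]].

Record JBstar_triple (R : realType) (E : completeNormedModType R[i])
    (tp : E -> E -> E -> E) : Prop := {
  JBt_continuous : continuous (fun p : E * E * E => tp p.1.1 p.1.2 p.2);
  JBt_linear : forall b c, linear (fun a => tp a b c);
  JBt_conjugate_linear : forall a c, conjugate_linear (fun b => tp a b c);
  JBt_symmetric : forall a b c, tp a b c = tp c b a;
  JBt_Jordan : forall a b x y z,
    tp a b (tp x y z) - tp x y (tp a b z) =
    tp (tp a b x) y z - tp x (tp b a y) z;
  JBt_hermitian : forall a, hermitian (tp a a);
  JBt_spectrum_ge0 : forall a, spectrum (tp a a) `<=` [set l | 0 <= l];
  JBt_norm : forall a, `|tp a a a| = `|a| ^+ 3
}.

Definition algebra_triple (R : realType) (J : completeNormedModType R[i])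
    (jp : J -> J -> J) (star : J -> J) (a b c : J) : J :=
  jp (jp a (star b)) c + jp (jp c (star b)) a - jp (jp a c) (star b).

Record JBstar_algebra (R : realType) (J : completeNormedModType R[i])
    (jp : J -> J -> J) (star : J -> J) : Prop := {
  JBa_commutative : commutative jp;
  JBa_linear : forall b, linear (fun a => jp a b);
  JBa_Jordan : forall a b, jp (jp a b) (jp a a) = jp a (jp b (jp a a));
  JBa_norm_le : forall a b, `|jp a b| <= `|a| * `|b|;
  JBa_star_conjugate_linear : conjugate_linear star;
  JBa_star_involutive : involutive star;
  JBa_star_mul : forall a b, star (jp a b) = jp (star b) (star a);
  JBa_norm : forall a, `|algebra_triple jp star a a a| = `|a| ^+ 3
}.

(* Norm of a bounded functional; the norms on R[i]^o and V are R[i]-valued,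
   whence the real part. *)
Definition dual_norm (R : realType) (V : normedModType R[i])
    (f : V -> R[i]^o) : R :=
  sup [set complex.Re `|f v| | v in [set v : V | `|v| <= 1]].

(* x |-> pairing x is an isometric linear isomorphism of E onto the dual
   of V. *)
Definition dual_Banach_space (R : realType) (E : completeNormedModType R[i])
    : Prop :=
  exists (V : completeNormedModType R[i]) (pairing : E -> V -> R[i]^o),
    [/\ forall x, bounded_linear (pairing x),
        forall v, linear (fun x => pairing x v),
        forall f : V -> R[i]^o, bounded_linear f ->
          exists x, pairing x = f &
        forall x, `|x| = (dual_norm (pairing x))%:C%C].

Definition JBWstar_algebra (R : realType) (J : completeNormedModType R[i])
    (jp : J -> J -> J) (star : J -> J) : Prop :=
  JBstar_algebra jp star /\ dual_Banach_space J.

Definition triple_homomorphism (R : realType)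
    (E F : completeNormedModType R[i]) (tpE : E -> E -> E -> E)
    (tpF : F -> F -> F -> F) (f : E -> F) : Prop :=
  linear f /\ forall a b c, f (tpE a b c) = tpF (f a) (f b) (f c).

Definition two_local_triple_homomorphism (R : realType)
    (E F : completeNormedModType R[i]) (tpE : E -> E -> E -> E)
    (tpF : F -> F -> F -> F) (T : E -> F) : Prop :=
  forall a b : E, exists Phi : E -> F,
    [/\ bounded_linear Phi, triple_homomorphism tpE tpF Phi,
        Phi a = T a & Phi b = T b].

(* Main.v *)
Require Import Defs.
From Stdlib Require BinNat QArith.
From Stdlib.micromega Require EnvRing RingMicromega Tauto QMicromega.
From HB Require Import structures.
From mathcomp Require Import all_boot all_order all_algebra ring lra.
From mathcomp Require Import complex all_classical all_reals all_analysis.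

Set Implicit Arguments.
Unset Strict Implicit.
Unset Printing Implicit Defensive.

Local Open Scope ring_scope.

(** Duality enters only through the existence of a unit [e] in the algebra [J].

    Given the unit, the map [s |-> (3 s - {s,s,s}) / 2] is respected by every
    triple homomorphism and, started at [e + y] with [y] self-adjoint and
    small, it converges to [e]. So the value of a bounded triple homomorphism
    at [e + y] determines its values at [e] and [y] ([hom_unit], [unit_test]).
    It also knows the adjoint of [c + i d], which is [{e, c + i d, e}], hence
    [c] and [d] separately. Testing [T] on the pair [e + k a], [c + i d]
    therefore gives one homomorphism that agrees with [T] at three
    self-adjoint elements [a], [c], [d] ([three_local]). For the triples
    [a, b, a + b] and [a, b, {a,b,a}] this makes [T] additive and compatible
    with [{a,b,a}] on self-adjoint elements; the rest is polarization and
    complex linearity ([two_local_linear], [two_local_triple]).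

    The unit is constructed inside the self-adjoint part [V], as a common point
    of balls; the weak* compactness of balls of a dual space provides the
    finite intersection property ([dual_balls]). The balls come from the order
    of the unitization [W] of [V], which is built from the norm alone.

    For one element [a], the C*-identity and the inequality
    [|u^2| <= |u^2 + v^2|] give a calculus of norms and positivity for real
    polynomials in [a], with approximate square roots; the notions are [pbnd]
    and [ppos]. To compare elements that do not generate an associative
    algebra, positivity of [h] is related to the contractivity of the flow of
    the multiplication by [- h] on the whole of [V] ([ppos_dissipative],
    [dissipative_ppos]), so that positive elements form a closed convex cone.
    This rests on multiplications by self-adjoint elements being hermitian
    ([hermitian_cos]), which is proved without spectra: a map that almost
    commutes with [x |-> {x,x,x}], which cubes norms, is almost isometric
    ([almost_isometry]). The quadratic operators [U_c] of positive [c] preserve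
    the cone ([quadU_pos]), because this holds up to second order near the unit
    and [U_(y^2) = U_y U_y] allows to take square roots.

    Consequently [(1 + k)^-1] decreases as [k >= 0] increases
    ([inverse_antitone]), its derivative being [- U_y d]. This shows that the
    balls of radius 1 around [2 (1 - (1 + k)^-1)] meet finitely many at a time,
    so they have a common point [x] ([approximate_unit_limit]), and
    [0 <= 1 - x <= 2 (1 + t k)^-1] for all [t]. Letting [t] grow yields
    [U_k (1 - x) = 0], that is [U_k x = k^2], for all [k >= 0]. After
    polarization, and by density of products,
    [b (c x) + c (b x) - (b c) x = b c] for all [b] and [c]; this makes [x]
    idempotent with trivial Peirce spaces for 0 and 1/2, so [x] is a unit
    ([defect0_unit]). *)

(** * Linear arithmetic over a real field *)

(** The reflection theorem for linear arithmetic relates a formula over the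
    field to one with rational coefficients. Both syntax trees are read off
    here from the order hypotheses and the goal alone, so that the cost does
    not depend on the rest of the context, which below contains long lists of
    facts about norms. Scalars that are not sums, products, powers or numerals
    become atoms. *)
Ltac closed_positive p := lazymatch p with
  | BinNums.xI ?q => closed_positive q | BinNums.xO ?q => closed_positive q
  | BinNums.xH => constr:(true) | _ => constr:(false) end.
Ltac literal k := let n := eval vm_compute in (BinNat.N.of_nat k) in
  lazymatch n with
  | BinNums.N0 => constr:(Some n)
  | BinNums.Npos ?p => lazymatch closed_positive p with
     | true => constr:(Some n) | _ => constr:(@None BinNums.N) end
  | _ => constr:(@None BinNums.N) end.
Ltac head t := lazymatch t with ?f _ => head f | _ => t end.
(** Two atoms are the same when they are convertible: a norm may be built over
    different paths through the structures that the field carries. Comparing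
    the heads first keeps the conversion tests short. *)
Ltac same_scalar x y := lazymatch x with y => constr:(true)
  | _ _ => let f := head x in let g := head y in
    lazymatch f with g => match constr:(true) with
      | _ => let e := constr:(erefl x : x = y) in constr:(true)
      | _ => constr:(false) end
    | _ => constr:(false) end
  | _ => constr:(false) end.
Ltac mem_atom x l := lazymatch l with
  | nil => constr:(false)
  | cons ?y ?l => lazymatch same_scalar x y with true => constr:(true) | _ => mem_atom x l end end.
Ltac add_atom x l := lazymatch mem_atom x l with true => l | _ => constr:(cons x l) end.
Ltac scalar_atoms env t := lazymatch t with
  | GRing.zero => env | GRing.one _ => env
  | GRing.add ?a ?b => let env := scalar_atoms env a in scalar_atoms env b
  | GRing.mul ?a ?b => let env := scalar_atoms env a in scalar_atoms env b
  | GRing.opp ?a => scalar_atoms env a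
  | GRing.natmul ?a ?k => lazymatch literal k with
     | Some _ => scalar_atoms env a | _ => add_atom t env end
  | GRing.exp ?a ?k => lazymatch literal k with
     | Some _ => scalar_atoms env a | _ => add_atom t env end
  | GRing.inv (GRing.natmul (GRing.one _) ?k) => lazymatch literal k with
     | Some _ => env | _ => add_atom t env end
  | _ => add_atom t env end.
Ltac atom_index x l := lazymatch l with
  | cons ?y ?l => lazymatch same_scalar x y with true => constr:(BinNums.xH)
     | _ => let n := atom_index x l in eval vm_compute in (BinPos.Pos.succ n) end end.

(** Returns the pair of the two trees, built in parallel so that they have the
    same shape. *)
Ltac scalar_reify F env t :=
  let atom x := let i := atom_index x env in
    constr:((algebra_tactics.common.RX (x : F), EnvRing.PEX i : EnvRing.PExpr QArith_base.Q)) in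
  let num n := constr:(EnvRing.PEc (QArith_base.Qmake (BinInt.Z.of_N n) BinNums.xH)) in
  lazymatch t with
  | GRing.zero => constr:((algebra_tactics.common.R0 F, EnvRing.PEc (QArith_base.Qmake BinNums.Z0 BinNums.xH)))
  | GRing.one _ => constr:((algebra_tactics.common.R1 F, EnvRing.PEc (QArith_base.Qmake (BinNums.Zpos BinNums.xH) BinNums.xH)))
  | GRing.add ?a ?b =>
    lazymatch scalar_reify F env a with (?a1, ?a2) =>
    lazymatch scalar_reify F env b with (?b1, ?b2) =>
      constr:((algebra_tactics.common.RAdd a1 b1, EnvRing.PEadd a2 b2)) end end
  | GRing.mul ?a ?b =>
    lazymatch scalar_reify F env a with (?a1, ?a2) =>
    lazymatch scalar_reify F env b with (?b1, ?b2) =>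
      constr:((algebra_tactics.common.RMul a1 b1, EnvRing.PEmul a2 b2)) end end
  | GRing.opp ?a => lazymatch scalar_reify F env a with (?a1, ?a2) =>
      constr:((@algebra_tactics.common.ROpp F a1, EnvRing.PEopp a2)) end
  | GRing.natmul ?a ?k => lazymatch literal k with
     | Some ?n => lazymatch scalar_reify F env a with (?a1, ?a2) => let c := num n in
         constr:((algebra_tactics.common.RMuln a1 (common.RnatC (algebra_tactics.common.large_nat_N n)), EnvRing.PEmul a2 c)) end
     | _ => atom t end
  | GRing.exp ?a ?k => lazymatch literal k with
     | Some ?n => lazymatch scalar_reify F env a with (?a1, ?a2) =>
         constr:((algebra_tactics.common.RExpn a1 (algebra_tactics.common.large_nat_N n), EnvRing.PEpow a2 n)) end
     | _ => atom t end
  | GRing.inv (GRing.natmul (GRing.one _) ?k) => lazymatch literal k with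
     | Some ?n =>
         constr:((@algebra_tactics.common.RInv F (algebra_tactics.common.RMuln (algebra_tactics.common.R1 F) (common.RnatC (algebra_tactics.common.large_nat_N n))),
           EnvRing.PEmul (EnvRing.PEc (QArith_base.Qmake (BinNums.Zpos BinNums.xH) BinNums.xH))
             (EnvRing.PEc (QArith_base.Qinv (QArith_base.Qmake (BinInt.Z.of_N n) BinNums.xH)))))
     | _ => atom t end
  | _ => atom t end.

Ltac formula_atoms F env T := lazymatch T with
  | is_true (Order.le ?a ?b) => let env := scalar_atoms env a in scalar_atoms env b
  | is_true (Order.lt ?a ?b) => let env := scalar_atoms env a in scalar_atoms env b
  | @eq _ ?a ?b => let env := scalar_atoms env a in scalar_atoms env b
  | ?P -> ?Q => let env := formula_atoms F env P in formula_atoms F env Q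
  | _ => env end.
Ltac formula_reify F env T :=
  let atomic op a b :=
    lazymatch scalar_reify F env a with (?a1, ?a2) =>
    lazymatch scalar_reify F env b with (?b1, ?b2) =>
      constr:((Tauto.A Tauto.isProp (algebra_tactics.lra.Internals.Build_RFormula a1 op b1) tt
                 : Tauto.BFormula (algebra_tactics.lra.Internals.RFormula F) Tauto.isProp,
               Tauto.A Tauto.isProp (RingMicromega.Build_Formula a2 op b2) tt
                 : Tauto.BFormula (RingMicromega.Formula QArith_base.Q) Tauto.isProp)) end end in
  lazymatch T with
  | is_true (Order.le ?a ?b) => atomic RingMicromega.OpLe a b
  | is_true (Order.lt ?a ?b) => atomic RingMicromega.OpLt a b
  | @eq _ ?a ?b => atomic RingMicromega.OpEq a b
  | False => constr:((Tauto.FF Tauto.isProp : Tauto.BFormula (algebra_tactics.lra.Internals.RFormula F) Tauto.isProp,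
      Tauto.FF Tauto.isProp : Tauto.BFormula (RingMicromega.Formula QArith_base.Q) Tauto.isProp))
  | ?P -> ?Q =>
    lazymatch formula_reify F env P with (?p1, ?p2) =>
    lazymatch formula_reify F env Q with (?q1, ?q2) =>
      constr:((Tauto.IMPL p1 None q1, Tauto.IMPL p2 None q2)) end end end.

Ltac scalar_field := match goal with
  | R : realType |- _ => constr:(R : realFieldType)
  | R : realFieldType |- _ => constr:(R : realFieldType) end.
Ltac revert_order F := repeat match goal with
  | H : is_true (andb _ _) |- _ => case/andP: H => ? ?
  | H : is_true (Order.le ?a _) |- _ => let c := constr:(a : F) in revert H
  | H : is_true (Order.lt ?a _) |- _ => let c := constr:(a : F) in revert H
  | H : @eq _ ?a _ |- _ => let c := constr:(a : F) in revert H end.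
Ltac reflect_arith F :=
  lazymatch goal with |- ?T =>
    let env := formula_atoms F (@nil F) T in
    lazymatch formula_reify F env T with (?rff, ?ff) =>
      let ff := eval vm_compute in ff in
      algebra_tactics.lra.Internals.lra_witness ff ff;
      lazymatch goal with w := ?cert : _ |- _ => clear w;
        refine (@algebra_tactics.lra.Internals.FTautoChecker_sound F rff ff cert
          (VarMap.find (0 : F) (algebra_tactics.lra.Internals.vm_of_list env))
          (fun _ _ _ _ _ _ _ _ _ _ => erefl) _); vm_compute; reflexivity end
    end end.
Ltac arith_goal F := lazymatch goal with
  | |- is_true (Order.le ?a _) => let c := constr:(a : F) in idtac
  | |- is_true (Order.lt ?a _) => let c := constr:(a : F) in idtac
  | |- @eq _ ?a _ => let c := constr:(a : F) in idtac
  | |- _ => exfalso end.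
Ltac lin_arith := first [ intros; let F := scalar_field in arith_goal F;
  revert_order F; reflect_arith F | lra ].
(** An identity between scalars, which may be quadratic, checked as it stands,
    with no hypothesis of the context. *)
Ltac scalar_identity := let F := scalar_field in lazymatch goal with
  |- @eq _ ?a _ => let c := constr:(a : F) in reflect_arith F end.

(** * Linear identities in a module *)

Section LinearExpressions.
Variables (K : pzRingType) (A : lmodType K).

(** Syntax of the linear combinations, so that comparing two of them becomes
    a comparison of their coefficients at each variable. *)
Inductive lexp := LVar of nat | LZero | LAdd of lexp & lexp | LOpp of lexp
  | LScale of K & lexp | LNat of lexp & nat.

Fixpoint leval (env : seq A) e : A := match e with
  | LVar n => env`_n | LZero => 0 | LAdd e f => leval env e + leval env f
  | LOpp e => - leval env e | LScale k e => k *: leval env e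
  | LNat e n => leval env e *+ n end.

Fixpoint lcoef e i : K := match e with
  | LVar n => if n == i then 1 else 0 | LZero => 0
  | LAdd e f => lcoef e i + lcoef f i
  | LOpp e => - lcoef e i | LScale k e => k * lcoef e i
  | LNat e n => n%:R * lcoef e i end.

Fixpoint lbound n e : bool := match e with
  | LVar m => (m < n)%N | LZero => true | LAdd e f => lbound n e && lbound n f
  | LOpp e => lbound n e | LScale _ e => lbound n e | LNat e _ => lbound n e end.

Lemma leval_sum env e : lbound (size env) e ->
  leval env e = \sum_(i < size env) lcoef e i *: env`_i.
Proof.
elim: e => [m|_|e IHe f IHf|e IHe|k e IHe|e IHe n] /=.
- move=> lt_m; rewrite (bigD1 (Ordinal lt_m)) //= eqxx scale1r big1 ?addr0 //.
  move=> i /negbTE ne; case: eqP => [mi|]; last by rewrite scale0r.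
  by move: ne; rewrite -val_eqE /= mi eqxx.
- by rewrite big1 // => i _; rewrite scale0r.
- move=> /andP[/IHe -> /IHf ->]; rewrite -big_split /=.
  by apply: eq_bigr => i _; rewrite scalerDl.
- by move=> /IHe ->; rewrite -sumrN; apply: eq_bigr => i _; rewrite scaleNr.
- move=> /IHe ->; rewrite scaler_sumr.
  by apply: eq_bigr => i _; rewrite scalerA.
- move=> /IHe ->; rewrite -sumrMnl; apply: eq_bigr => i _.
  by rewrite -scalerA scaler_nat.
Qed.

Fixpoint all_below (P : nat -> Prop) n : Prop :=
  if n is m.+1 then P m /\ all_below P m else True.

Lemma leval_eq env e f : lbound (size env) e && lbound (size env) f ->
  all_below (fun i => lcoef e i = lcoef f i) (size env) ->
  leval env e = leval env f.
Proof.
move=> /andP[be bf] H; rewrite !leval_sum //; apply: eq_bigr => i _.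
congr (_ *: _); have := ltn_ord i; move: (nat_of_ord i) H => j.
elim: (size env) => // n IH /= [Hn /IH H]; rewrite ltnS leq_eqVlt.
by case/orP=> [/eqP->|].
Qed.

End LinearExpressions.

(** Over the integers the coefficients are computed by evaluation, which is
    much faster than proving an identity of scalars for each variable. *)
Section IntegralExpressions.
Variable A : zmodType.

Inductive zexp := ZVar of nat | ZZero | ZAdd of zexp & zexp | ZOpp of zexp
  | ZNat of zexp & nat.

Fixpoint zeval (env : seq A) e : A := match e with
  | ZVar n => env`_n | ZZero => 0 | ZAdd e f => zeval env e + zeval env f
  | ZOpp e => - zeval env e | ZNat e n => zeval env e *+ n end.

(* The accumulator lists the coefficients of the positive and of the negative
   occurrences of each variable; [k] is the multiplicity of the subterm. *)
Fixpoint zcoef e (pos : bool) k (c : seq nat * seq nat) : seq nat * seq nat :=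
  match e with
  | ZVar n => if pos then (set_nth 0%N c.1 n (k + nth 0%N c.1 n)%N, c.2)
              else (c.1, set_nth 0%N c.2 n (k + nth 0%N c.2 n)%N)
  | ZZero => c
  | ZAdd e f => zcoef e pos k (zcoef f pos k c)
  | ZOpp e => zcoef e (~~ pos) k c
  | ZNat e n => zcoef e pos (n * k)%N c end.

Definition zsum (env : seq A) (c : seq nat) := \sum_(i < size env) env`_i *+ nth 0%N c i.

Lemma zsum_set env c n k :
  zsum env (set_nth 0%N c n (k + nth 0%N c n)%N) = env`_n *+ k + zsum env c.
Proof.
have [lt_n|le_n] := ltnP n (size env); last first.
  rewrite (nth_default 0 le_n) mul0rn add0r; apply: eq_bigr => i _.
  by rewrite nth_set_nth /= ltn_eqF // (leq_trans (ltn_ord i)).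
rewrite /zsum (bigD1 (Ordinal lt_n)) //= [in RHS](bigD1 (Ordinal lt_n)) //=.
rewrite nth_set_nth /= eqxx mulrnDr -addrA; congr (_ + (_ + _)).
apply: eq_bigr => i /negbTE ne; rewrite nth_set_nth /=.
by move: ne; rewrite -val_eqE /= => ->.
Qed.

Lemma zcoefP env e pos k c :
  zsum env (zcoef e pos k c).1 - zsum env (zcoef e pos k c).2 =
  (if pos then zeval env e *+ k else - (zeval env e *+ k))
    + (zsum env c.1 - zsum env c.2).
Proof.
elim: e pos k c => [n|| e IHe f IHf|e IHe|e IHe n] pos k c /=.
- by case: pos; rewrite /= zsum_set; [rewrite addrA|rewrite opprD addrCA].
- by case: pos; rewrite mul0rn ?oppr0 add0r.
- by rewrite IHe IHf addrA; case: pos; rewrite mulrnDl ?opprD.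
- by rewrite IHe; case: pos; rewrite /= mulNrn ?opprK.
- by rewrite IHe mulrnA.
Qed.

Lemma zeval_eq env e f :
  (let c := zcoef (ZAdd e (ZOpp f)) true 1 ([::], [::]) in
   all (fun i => nth 0%N c.1 i == nth 0%N c.2 i) (iota 0 (size env))) ->
  zeval env e = zeval env f.
Proof.
move=> /= /allP H; apply/eqP; rewrite -subr_eq0; apply/eqP.
have := zcoefP env (ZAdd e (ZOpp f)) true 1 ([::], [::]).
rewrite /= mulr1n => E; rewrite -[LHS]addr0 -{1}(subrr (zsum env [::])) -E.
apply/eqP; rewrite subr_eq0; apply/eqP; apply: eq_bigr => i _.
by rewrite (eqP (H (nat_of_ord i) _)) // mem_iota /= add0n.
Qed.

End IntegralExpressions.

(* Two atoms are the same when they are syntactically equal. Ring units and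
   pairs are compared up to conversion, because unification may have elaborated
   them through different paths of the hierarchy. *)
Ltac same_atom x y := lazymatch x with y => constr:(true)
  | GRing.one _ => lazymatch y with
     | GRing.one _ => let e := constr:(erefl x : x = y) in constr:(true)
     | _ => constr:(false) end
  | (_, _) => lazymatch y with
     | (_, _) => match constr:(true) with
        | _ => let e := constr:(erefl x : x = y) in constr:(true)
        | _ => constr:(false) end
     | _ => constr:(false) end
  | _ => constr:(false) end.
Ltac mem_tac x l := lazymatch l with
  | nil => constr:(false) | cons ?y ?l' =>
    lazymatch same_atom x y with true => constr:(true) | _ => mem_tac x l' end
  end.
Ltac idx_tac x l := lazymatch l with
  | cons ?y ?l' => lazymatch same_atom x y with true => constr:(O)
    | _ => let n := idx_tac x l' in constr:(S n) end end.
Ltac vatoms env t := lazymatch t with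
  | GRing.zero => env
  | GRing.add ?a ?b => let env := vatoms env a in vatoms env b
  | GRing.opp ?a => vatoms env a
  | GRing.scale _ ?a => vatoms env a
  | GRing.natmul ?a _ => vatoms env a
  | _ => lazymatch mem_tac t env with true => env | false => constr:(cons t env) end
  end.
Ltac vreify K env t := lazymatch t with
  | GRing.zero => constr:(LZero K)
  | GRing.add ?a ?b => let a := vreify K env a in let b := vreify K env b in
     constr:(LAdd a b)
  | GRing.opp ?a => let a := vreify K env a in constr:(LOpp a)
  | GRing.scale ?k ?a => let a := vreify K env a in constr:(LScale k a)
  | GRing.natmul ?a ?n => let a := vreify K env a in constr:(LNat a n)
  | _ => let n := idx_tac t env in constr:(LVar K n)
  end.
Ltac zatoms env t := lazymatch t with
  | GRing.zero => env
  | GRing.add ?a ?b => let env := zatoms env a in zatoms env b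
  | GRing.opp ?a => zatoms env a
  | GRing.natmul ?a _ => zatoms env a
  | _ => lazymatch mem_tac t env with true => env | false => constr:(cons t env) end
  end.
Ltac zreify env t := lazymatch t with
  | GRing.zero => constr:(ZZero)
  | GRing.add ?a ?b => let a := zreify env a in let b := zreify env b in
     constr:(ZAdd a b)
  | GRing.opp ?a => let a := zreify env a in constr:(ZOpp a)
  | GRing.natmul ?a ?n => let a := zreify env a in constr:(ZNat a n)
  | _ => let n := idx_tac t env in constr:(ZVar n)
  end.
(** [vlin K] closes an equality between two linear combinations of the same
    vectors by comparing coefficients in the scalars [K]; [zlin] does the same
    for integral combinations. *)
Ltac vlin K :=
  lazymatch goal with |- @eq ?A ?l ?r =>
    let env := vatoms (@nil A) l in let env := vatoms env r in
    let e := vreify K env l in let f := vreify K env r in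
    refine (@leval_eq K _ env e f (erefl true) _);
    cbn [lcoef all_below size eqn];
    rewrite ?eqE /=; repeat split; try (by []); try scalar_identity; try ring; try field; try (by []) end.
Ltac zlin :=
  lazymatch goal with |- @eq ?A ?l ?r =>
    let env := zatoms (@nil A) l in let env := zatoms env r in
    let e := zreify env l in let f := zreify env r in
    refine (@zeval_eq _ env e f _); vm_compute; reflexivity end.

(** * Jordan algebras *)

Record jordan_algebra (K : realFieldType) (A : lmodType K) (jp : A -> A -> A)
    : Prop := {
  jordan_comm : commutative jp;
  jordan_linear : forall b, linear (fun a => jp a b);
  jordan_identity : forall a b, jp (jp a b) (jp a a) = jp a (jp b (jp a a))
}.

Section Jordan.
Variables (K : realFieldType) (A : lmodType K) (jp : A -> A -> A).
Hypothesis hA : jordan_algebra jp.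
Local Infix "**" := jp (at level 40, left associativity).

Lemma jpC x y : x ** y = y ** x. Proof. exact: jordan_comm. Qed.
Lemma jpDl x y z : (x + y) ** z = x ** z + y ** z.
Proof. by have := jordan_linear hA z 1 x y; rewrite !scale1r. Qed.
Lemma jp0l z : 0 ** z = 0.
Proof. by apply: (addIr (0 ** z)); rewrite -jpDl !add0r. Qed.
Lemma jpZl k x z : (k *: x) ** z = k *: (x ** z).
Proof. by have := jordan_linear hA z k x 0; rewrite !addr0 jp0l addr0. Qed.
Lemma jpNl x z : (- x) ** z = - (x ** z).
Proof. by rewrite -scaleN1r jpZl scaleN1r. Qed.
Lemma jpBl x y z : (x - y) ** z = x ** z - y ** z.
Proof. by rewrite jpDl jpNl. Qed.
Lemma jpMnl x n z : (x *+ n) ** z = (x ** z) *+ n.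
Proof. by rewrite -scaler_nat jpZl scaler_nat. Qed.
Lemma jpDr x y z : z ** (x + y) = z ** x + z ** y.
Proof. by rewrite jpC jpDl !(jpC z). Qed.
Lemma jp0r z : z ** 0 = 0. Proof. by rewrite jpC jp0l. Qed.
Lemma jpZr k x z : z ** (k *: x) = k *: (z ** x).
Proof. by rewrite jpC jpZl (jpC z). Qed.
Lemma jpNr x z : z ** (- x) = - (z ** x).
Proof. by rewrite jpC jpNl (jpC z). Qed.
Lemma jpBr x y z : z ** (x - y) = z ** x - z ** y.
Proof. by rewrite jpDr jpNr. Qed.
Lemma jpMnr x n z : z ** (x *+ n) = (z ** x) *+ n.
Proof. by rewrite jpC jpMnl (jpC z). Qed.

Definition jpE := (jpDl, jpDr, jpBl, jpBr, jpZl, jpZr, jpNl, jpNr, jpMnl, jpMnr,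
  jp0l, jp0r).

End Jordan.

(** A product that occurs in both orders would be seen as two atoms, so one of
    the orders is eliminated before comparing linear combinations. *)
Ltac jcomm hA := lazymatch type of hA with jordan_algebra ?jp =>
  repeat match goal with |- context [jp ?x ?y] =>
    lazymatch x with y => fail | _ =>
      lazymatch goal with |- context [jp y x] => rewrite (jpC hA y x) end end end end.
Ltac jlin hA K := rewrite ?(jpE hA); jcomm hA; first [zlin | vlin K].
(** To derive an equation from another one, it suffices that their differences
    of sides agree, which is a linear identity. *)
Lemma eq_modulo (V : zmodType) (x y l r : V) : l = r -> x - y = l - r -> x = y.
Proof. by move=> -> /eqP; rewrite subrr subr_eq0 => /eqP. Qed.
Ltac jlinc hA K E := apply: (eq_modulo E); jlin hA K.

Section JordanIdentities.
Variables (K : realFieldType) (A : lmodType K) (jp : A -> A -> A).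
Hypothesis hA : jordan_algebra jp.
Local Infix "**" := jp (at level 40, left associativity).
Local Notation jpE := (jpE hA).

(** The Jordan identity is cubic in its first variable; its full polarization
    is twice the sum below, and it is the polarized form that can be
    specialized and combined linearly. *)
Lemma jordan_polarized x y z b :
  (x ** b) ** (y ** z) + (y ** b) ** (z ** x) + (z ** b) ** (x ** y) =
  x ** (b ** (y ** z)) + y ** (b ** (z ** x)) + z ** (b ** (x ** y)).
Proof.
pose S t := (t ** b) ** (t ** t) - t ** (b ** (t ** t)).
have S0 t : S t = 0 by rewrite /S (jordan_identity hA) subrr.
have E : S (x + y + z) - S (x + y) - S (z + y) - S (x + z) + S x + S y + S z = 0.
  by rewrite !S0 !subr0 !addr0.
have two_inj (u v : A) : u *+ 2 = v *+ 2 -> u = v.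
  move=> E2; have E3 := f_equal (fun z => 2^-1 *: z) E2.
  by apply: (eq_modulo E3); vlin K.
by apply: two_inj; move: E; rewrite /S => E; jlinc hA K E.
Qed.

Lemma jordan_square a b : a ** (a ** a ** b) = a ** a ** (a ** b).
Proof. by rewrite (jpC hA _ b) -(jordan_identity hA) (jpC hA). Qed.

(** The linearized quadratic representation: in an associative algebra
    [bilU x y z] is [(x z y + y z x) / 2]. *)
Definition bilU x y z := x ** (y ** z) + y ** (x ** z) - x ** y ** z.
Definition quadU x z := bilU x x z.

Lemma bilUE x y z : bilU x y z = x ** (y ** z) + y ** (x ** z) - x ** y ** z.
Proof. by []. Qed.
Lemma bilUC x y z : bilU x y z = bilU y x z.
Proof. by rewrite /bilU; jlin hA K. Qed.
Lemma bilUDl x x' y z : bilU (x + x') y z = bilU x y z + bilU x' y z.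
Proof. by rewrite /bilU; jlin hA K. Qed.
Lemma bilUZl k x y z : bilU (k *: x) y z = k *: bilU x y z.
Proof. by rewrite /bilU; jlin hA K. Qed.
Lemma bilUDm x y y' z : bilU x (y + y') z = bilU x y z + bilU x y' z.
Proof. by rewrite /bilU; jlin hA K. Qed.
Lemma bilUZm k x y z : bilU x (k *: y) z = k *: bilU x y z.
Proof. by rewrite /bilU; jlin hA K. Qed.
Lemma bilUDr x y z z' : bilU x y (z + z') = bilU x y z + bilU x y z'.
Proof. by rewrite /bilU; jlin hA K. Qed.
Lemma bilUZr k x y z : bilU x y (k *: z) = k *: bilU x y z.
Proof. by rewrite /bilU; jlin hA K. Qed.

(** * The subalgebra generated by one element *)

Variable one : A.
Hypothesis one_jp : forall x, one ** x = x.

Variable a : A.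
Definition jpow n := iter n (jp a) one.
Lemma jpowS n : jpow n.+1 = a ** jpow n. Proof. by []. Qed.
Lemma jpow1 : jpow 1 = a. Proof. by rewrite /jpow /= (jpC hA) one_jp. Qed.
Lemma jpow2 : jpow 2 = a ** a. Proof. by rewrite jpowS jpow1. Qed.

Local Notation X := (jp a).
Local Notation Y := (quadU a).

Lemma jpow_op0 z : jpow 0 ** z = z. Proof. exact: one_jp. Qed.

(* [X] and [Y] commute; everything about powers of [a] follows from this and
   from the polarized identity. *)
Lemma X_Y z : X (Y z) = Y (X z).
Proof. by rewrite /quadU /bilU !jpE jordan_square. Qed.

(** Multiplications by the powers of [a] satisfy a recursion of order two, as
    if [a^n] acted on [z] by [(s^n + t^n)/2] with commuting [s + t = 2 X] and
    [s t = Y]; they all commute since they are polynomials in [X] and [Y]. *)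
Lemma jpow_op_rec_commute n :
  [/\ forall z, X (jpow n ** z) = jpow n ** X z,
      forall z, X (jpow n.+1 ** z) = jpow n.+1 ** X z,
      forall z, a ** a ** (jpow n ** z) = jpow n ** (a ** a ** z),
      forall z, a ** a ** (jpow n.+1 ** z) = jpow n.+1 ** (a ** a ** z) &
      forall z, jpow n.+2 ** z = X (jpow n.+1 ** z) *+ 2 - Y (jpow n ** z)].
Proof.
have rec m : (forall z, X (jpow m ** z) = jpow m ** X z) ->
    (forall z, X (jpow m.+1 ** z) = jpow m.+1 ** X z) ->
    forall z, jpow m.+2 ** z = X (jpow m.+1 ** z) *+ 2 - Y (jpow m ** z).
  move=> C0 C1 z; have := jordan_polarized a (jpow m) z a.
  rewrite (jpC hA _ a) -jpowS (jpC hA z a) -C1 (jpC hA _ (jpow m.+1)) -C1.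
  rewrite -C0 -C0 -jpowS => E; rewrite /quadU /bilU; jlinc hA K (esym E).
elim: n => [|m [C0 C1 D0 D1 R]].
  have C0 z : X (jpow 0 ** z) = jpow 0 ** X z by rewrite !jpow_op0.
  have C1 z : X (jpow 1 ** z) = jpow 1 ** X z by rewrite !jpow1.
  split=> // [z|z|]; [by rewrite !jpow_op0|by rewrite jpow1 jordan_square|].
  exact: rec.
have C2 z : X (jpow m.+2 ** z) = jpow m.+2 ** X z.
  by rewrite !R -C0 -C1 (jpBr hA) (jpMnr hA) X_Y.
have D2 z : a ** a ** (jpow m.+2 ** z) = jpow m.+2 ** (a ** a ** z).
  by rewrite !R -D0 -D1 /quadU /bilU !jpE -!jordan_square.
by split=> //; exact: rec.
Qed.

Lemma X_jpow n z : X (jpow n ** z) = jpow n ** X z.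
Proof. by have [] := jpow_op_rec_commute n. Qed.
Lemma Y_jpow n z : Y (jpow n ** z) = jpow n ** Y z.
Proof.
have [_ _ D _ _] := jpow_op_rec_commute n.
by rewrite /quadU /bilU !jpE !X_jpow D.
Qed.
Lemma jpow_rec n z : jpow n.+2 ** z = X (jpow n.+1 ** z) *+ 2 - Y (jpow n ** z).
Proof. by have [] := jpow_op_rec_commute n. Qed.

Lemma nat_ind2 (P : nat -> Prop) : P 0 -> P 1 ->
  (forall n, P n -> P n.+1 -> P n.+2) -> forall n, P n.
Proof. by move=> P0 P1 IH n; suff [] : P n /\ P n.+1; elim: n => // n [? ?]; split=> //; exact: IH. Qed.

Lemma jpow_jpow m n z : jpow m ** (jpow n ** z) = jpow n ** (jpow m ** z).
Proof.
elim/nat_ind2: m z => [z|z|m IH0 IH1 z]; first by rewrite !jpow_op0.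
  by rewrite jpow1 X_jpow.
by rewrite !jpow_rec IH0 IH1 X_jpow Y_jpow !jpE.
Qed.

Lemma quadU_jp n : Y (jpow n) = jpow n.+2.
Proof.
rewrite /quadU /bilU -!jpowS (_ : a ** a ** jpow n = jpow n.+2) ?addrK //.
elim: n => [|n IH]; first by rewrite (jpC hA) jpow_op0 jpow2.
by rewrite [jpow n.+1]jpowS -jordan_square IH.
Qed.

(** Power associativity: the recursion for the operators turns the claim for
    [m + 2] into the claims for [m] and [m + 1]. *)
Lemma jpowD m n : jpow m ** jpow n = jpow (m + n).
Proof.
elim/nat_ind2: m n => [n|n|m IH0 IH1 n]; first by rewrite jpow_op0.
  by rewrite jpow1.
by rewrite jpow_rec IH0 IH1 quadU_jp !addSn -jpowS mulr2n addrK.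
Qed.

(* In the model where [a^n] acts as [(s^n + t^n)/2], this is
   [(s^m t^n + t^m s^n)/2]; the next two lemmas multiply it by [s + t] and
   by [s t]. *)
Lemma bilU_jpowE m n z :
  bilU (jpow m) (jpow n) z = (jpow m ** (jpow n ** z)) *+ 2 - jpow (m + n) ** z.
Proof. by rewrite /bilU (jpow_jpow n m) jpowD -mulr2n. Qed.

Lemma bilU_jpow_S0 m n z :
  bilU (jpow m.+1) (jpow n) z + bilU (jpow m) (jpow n.+1) z =
  X (bilU (jpow m) (jpow n) z) *+ 2.
Proof.
rewrite !bilU_jpowE addSn addnS.
elim/nat_ind2: m n z => [n z|n z|m IH0 IH1 n z].
- by rewrite !jpow_op0 jpow1 add0n; jlin hA K.
- rewrite jpow1 !add1n jpow2 (jpow_rec n) /quadU /bilU; jlin hA K.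
pose S k := jpow k.+1 ** (jpow n ** z) *+ 2 - jpow (k + n).+1 ** z
  + (jpow k ** (jpow n.+1 ** z) *+ 2 - jpow (k + n).+1 ** z)
  - X (jpow k ** (jpow n ** z) *+ 2 - jpow (k + n) ** z) *+ 2.
have E0 : S m = 0 by rewrite /S IH0 subrr.
have E1 : S m.+1 = 0 by rewrite /S IH1 subrr.
have E : X (S m.+1) *+ 2 - Y (S m) = 0.
  by rewrite E0 E1 /quadU /bilU (jp0r hA) mul0rn !(jp0r hA) !addr0 !subr0.
apply: (eq_modulo E); rewrite /S !addSn !(jpow_rec m.+1) !(jpow_rec m).
rewrite !(jpow_rec (m + n)) !(jpow_rec (m + n).+1) (jpow_rec (m + n)).
by rewrite /quadU /bilU !jpE -?jordan_square; vlin K.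
Qed.

Lemma bilU_jpow_SS m n z : bilU (jpow m.+1) (jpow n.+1) z = Y (bilU (jpow m) (jpow n) z).
Proof.
have E := bilU_jpow_S0 m n.+1 z; apply: (eq_modulo E).
rewrite !bilU_jpowE !addnS !(jpow_rec n) (jpow_rec (m + n)).
by rewrite (jpBr hA) (jpMnr hA) -Y_jpow -X_jpow /quadU /bilU; jlin hA K.
Qed.

(** In the model this says [(s t)^n = s^n t^n]. *)
Lemma quadU_jpow n z : quadU (jpow n) z = iter n Y z.
Proof.
elim: n z => [|n IH] z; last by rewrite /quadU bilU_jpow_SS -/(quadU _ _) IH.
by rewrite /quadU /bilU jpow_op0 !jpow_op0 addrK.
Qed.

Lemma jpow_bilU l m n z : jpow l ** bilU (jpow m) (jpow n) z =
  2^-1 *: (bilU (jpow (l + m)) (jpow n) z + bilU (jpow m) (jpow (l + n)) z).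
Proof.
elim/nat_ind2: l m n z => [m n z|m n z|l IH0 IH1 m n z].
- by rewrite jpow_op0 !add0n; vlin K.
- by rewrite jpow1 !add1n bilU_jpow_S0; vlin K.
rewrite jpow_rec IH0 IH1 !addSn.
set P := bilU (jpow (l + m).+2) _ _; set Q := bilU _ (jpow (l + n).+2) _.
have -> : P = X (bilU (jpow (l + m).+1) (jpow n) z) *+ 2 - Y (bilU (jpow (l + m)) (jpow n) z).
  by rewrite -(bilU_jpow_S0 (l + m).+1) -(bilU_jpow_SS (l + m)) addrK.
have -> : Q = X (bilU (jpow m) (jpow (l + n).+1) z) *+ 2 - Y (bilU (jpow m) (jpow (l + n)) z).
  by rewrite -(bilU_jpow_S0 m) -(bilU_jpow_SS m) addrC addKr.
by rewrite {P Q} /quadU /bilU; jlin hA K.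
Qed.

(** * Polynomials in one element *)

Definition pev (p : {poly K}) : A := \sum_(i < size p) p`_i *: jpow i.

Lemma pev_widen n (p : {poly K}) : (size p <= n)%N ->
  pev p = \sum_(i < n) p`_i *: jpow i.
Proof.
move=> le_pn; rewrite /pev (big_ord_widen n (fun i => p`_i *: jpow i)) // big_mkcond /=.
apply: eq_bigr => i _; case: ltnP => // le_pi.
by rewrite nth_default // scale0r.
Qed.

Lemma pevD p q : pev (p + q) = pev p + pev q.
Proof.
set n := maxn (size p) (size q).
rewrite (@pev_widen n) ?size_polyD // (@pev_widen n p) ?leq_maxl //.
rewrite (@pev_widen n q) ?leq_maxr // -big_split /=.
by apply: eq_bigr => i _; rewrite coefD scalerDl.
Qed.
Lemma pevZ k p : pev (k *: p) = k *: pev p.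
Proof.
rewrite (@pev_widen (size p)) ?size_scale_leq // scaler_sumr.
by apply: eq_bigr => i _; rewrite coefZ scalerA.
Qed.
Lemma pev0 : pev 0 = 0. Proof. by have := pevZ 0 0; rewrite !scale0r. Qed.
Lemma pevN p : pev (- p) = - pev p.
Proof. by have := pevZ (-1) p; rewrite !scaleN1r. Qed.
Lemma pevB p q : pev (p - q) = pev p - pev q.
Proof. by rewrite pevD pevN. Qed.
Lemma pevXn n : pev 'X^n = jpow n.
Proof.
rewrite /pev size_polyXn big_ord_recr /= coefXn eqxx scale1r big1 ?add0r //.
by move=> i _; rewrite coefXn ltn_eqF ?scale0r.
Qed.
Lemma pevX : pev 'X = a. Proof. by rewrite -['X]expr1 pevXn jpow1. Qed.
Lemma pevC k : pev k%:P = k *: one.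
Proof. by rewrite -[k%:P]mulr1 mul_polyC pevZ -(expr0 'X) pevXn. Qed.
Lemma pev1 : pev 1 = one. Proof. by rewrite -(expr0 'X) pevXn. Qed.

Lemma poly_ind_lin (P : {poly K} -> Prop) :
  (forall n, P 'X^n) -> (forall p q, P p -> P q -> P (p + q)) ->
  (forall k p, P p -> P (k *: p)) -> forall p, P p.
Proof.
move=> PX PD PZ p; rewrite -[p]coefK poly_def.
elim/big_ind: _ => [|//|i _]; last by apply: PZ.
by rewrite -[0](scale0r ('X^0 : {poly K})); apply: PZ.
Qed.

Lemma pevM p q : pev (p * q) = pev p ** pev q.
Proof.
elim/poly_ind_lin: p => [m|p p' IH IH'|k p IH].
- elim/poly_ind_lin: q => [n|q q' IH IH'|k q IH].
  + by rewrite -exprD !pevXn jpowD.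
  + by rewrite mulrDr !pevD IH IH' !jpE.
  + by rewrite -scalerAr !pevZ IH !jpE.
- by rewrite mulrDl !pevD IH IH' !jpE.
by rewrite -scalerAl !pevZ IH !jpE.
Qed.

Lemma poly_mulZr (k : K) (p q : {poly K}) : p * (k *: q) = k *: (p * q).
Proof. by rewrite -scalerAr. Qed.
Lemma poly_mulZl (k : K) (p q : {poly K}) : (k *: p) * q = k *: (p * q).
Proof. by rewrite -scalerAl. Qed.

(** In the model, [(p(s) + p(t)) / 2] times [q(s) q(t)]. *)
Lemma pev_quadU p q z : pev p ** quadU (pev q) z = bilU (pev (p * q)) (pev q) z.
Proof.
suff H q' : pev p ** bilU (pev q) (pev q') z =
  2^-1 *: (bilU (pev (p * q)) (pev q') z + bilU (pev q) (pev (p * q')) z).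
  by rewrite /quadU H (bilUC (pev q)); vlin K.
elim/poly_ind_lin: p => [l|p p' IH IH'|k p IH].
- elim/poly_ind_lin: q => [m|q p IH IH'|k q IH].
  + elim/poly_ind_lin: q' => [n|q' p IH IH'|k q' IH].
    * by rewrite -!exprD !pevXn jpow_bilU.
    * by rewrite !mulrDr !pevD !bilUDm (jpDr hA) IH IH'; vlin K.
    * rewrite !poly_mulZr !pevZ !bilUZm (jpZr hA) IH; vlin K.
  + rewrite !mulrDr !pevD !bilUDl (jpDr hA) IH IH'; vlin K.
  + by rewrite !poly_mulZr !pevZ !bilUZl (jpZr hA) IH; vlin K.
- by rewrite !mulrDl !pevD (jpDl hA) IH IH' !bilUDl !bilUDm; vlin K.
- by rewrite !poly_mulZl !pevZ (jpZl hA) IH !bilUZl !bilUZm; vlin K.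
Qed.

End JordanIdentities.

Lemma jordan_one_comm (K : realFieldType) (A : lmodType K) (jp : A -> A -> A) :
  jordan_algebra jp -> forall one, (forall x, jp one x = x) -> forall x, jp x one = x.
Proof. by move=> hA one h x; rewrite (jpC hA) h. Qed.

Section Unitization.
Variables (K : realFieldType) (A : lmodType K) (jp : A -> A -> A).
Hypothesis hA : jordan_algebra jp.
Local Infix "**" := jp (at level 40, left associativity).

(** The algebra with a unit adjoined; the first coordinate is the character
    whose kernel is the original algebra. *)
Definition unitization := (K^o * A)%type.
Definition ujp (x y : unitization) : unitization :=
  (x.1 * y.1, x.1 *: y.2 + y.1 *: x.2 + x.2 ** y.2).
Definition uone : unitization := (1, 0).

Lemma ujp_jordan : jordan_algebra ujp.
Proof.
have scaleD (P Q : unitization) k :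
  k *: P + Q = (k * P.1 + Q.1, k *: P.2 + Q.2) by [].
split=> [[l x] [m y]|[m y] k [l x] [l' x']|[l x] [m y]]; rewrite ?scaleD /ujp /=.
- by rewrite mulrC (jpC hA x) [_ + m *: x]addrC.
- congr (_, _); first by rewrite mulrDl mulrA.
  rewrite !(jpE hA); vlin K.
congr (_, _); first by rewrite -mulrA.
rewrite !(jpE hA) (jordan_identity hA).
jcomm hA; vlin K.
Qed.

Lemma uone_jp x : ujp uone x = x.
Proof. by case: x => l x; rewrite /ujp /= mul1r scale1r scaler0 addr0 (jp0l hA) addr0. Qed.
End Unitization.

Section Peirce.
Variables (K : realFieldType) (A : lmodType K) (jp : A -> A -> A).
Hypothesis hA : jordan_algebra jp.
Local Infix "**" := jp (at level 40, left associativity).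

(** [2 t^3 - 3 t^2 + t = t (2 t - 1) (t - 1)]: the multiplication by an
    idempotent has eigenvalues among 0, 1/2, 1. *)
Lemma Peirce_equation p b : p ** p = p ->
  p ** (p ** (p ** b)) *+ 2 - (p ** (p ** b)) *+ 3 + p ** b = 0.
Proof.
move=> pp; have := jordan_polarized hA p p b p; rewrite !pp => E.
by jlinc hA K (esym E).
Qed.

Lemma Peirce0_square p z : p ** p = p -> p ** z = 0 -> p ** (z ** z) = 0.
Proof.
move=> pp pz; have := jordan_polarized hA p p z z.
by rewrite pp !(jpC hA z p) pz => E; jlinc hA K E.
Qed.
End Peirce.

(** * Norms of polynomials in one element *)

(** What is kept of the self-adjoint part of a JB*-algebra with a predual.
    The two-squares inequality is the C*-identity of [u + i v]. The hermitian
    condition says that [cos (t H)] is a contraction, up to order 3 in [t], for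
    the multiplication [H] by an element of the unitization. The last condition
    is the trace of the weak* compactness of balls. *)
Record jb_algebra (R : realType) (V : lmodType R) (jp : V -> V -> V)
    (nu : V -> R) : Prop := {
  jb_jordan : jordan_algebra jp;
  jb_norm_eq0 : forall x, nu x = 0 -> x = 0;
  jb_normD : forall x y, nu (x + y) <= nu x + nu y;
  jb_normZ : forall k x, nu (k *: x) = `|k| * nu x;
  jb_normM : forall x y, nu (jp x y) <= nu x * nu y;
  jb_norm_sq : forall x, nu (jp x x) = nu x ^+ 2;
  jb_two_squares : forall u v, jp (jp u v) v = jp (jp v v) u ->
    jp (jp u v) u = jp (jp u u) v -> nu (jp u u) <= nu (jp u u + jp v v);
  jb_hermitian : forall l a, exists2 C, 0 <= C & forall t x, 0 < t <= 1 ->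
    let H y := l *: y + jp a y in
    nu (x - (t ^+ 2 / 2) *: H (H x)) <= (1 + C * t ^+ 3) * nu x;
  jb_complete : forall u : nat -> V,
    (forall e, 0 < e -> exists N, forall m n, (N <= m)%N -> (N <= n)%N ->
       nu (u m - u n) <= e) ->
    exists l, forall e, 0 < e -> exists N, forall n, (N <= n)%N -> nu (u n - l) <= e;
  jb_balls : forall (P : V -> Prop) (c : V -> V),
    (forall s : seq V, (forall k, k \in s -> P k) ->
       exists x, forall k, k \in s -> nu (x - c k) <= 1) ->
    exists x, forall k, P k -> nu (x - c k) <= 1
}.

Lemma ler_small (R : realFieldType) (x y c : R) : 0 <= c ->
  (forall e, 0 < e -> e <= 1 -> x <= y + c * e) -> x <= y.
Proof.
move=> c0 H; rewrite leNgt; apply/negP => lt_yx.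
pose e := Num.min 1 ((x - y) / (2 * (c + 1))).
have c1 : 0 < 2 * (c + 1) by lin_arith.
have e0 : 0 < e by rewrite lt_min ltr01 /= divr_gt0 // subr_gt0.
have e1 : e <= 1 by rewrite ge_min lexx.
have e2 : e * (2 * (c + 1)) <= x - y.
  by rewrite -ler_pdivlMr // ge_min lexx orbT.
have := H e e0 e1; nra.
Qed.

Section JB.
Variables (R : realType) (V : lmodType R) (jp : V -> V -> V) (nu : V -> R).
Hypothesis hV : jb_algebra jp nu.
Local Infix "**" := jp (at level 40, left associativity).
Local Notation hj := (jb_jordan hV).
Local Notation nuD := (jb_normD hV).
Local Notation nuZ := (jb_normZ hV).
Local Notation nuM := (jb_normM hV).

Lemma nu0 : nu 0 = 0. Proof. by have := nuZ 0 0; rewrite scale0r normr0 mul0r. Qed.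
Lemma nuN x : nu (- x) = nu x.
Proof. by rewrite -scaleN1r nuZ normrN1 mul1r. Qed.
Lemma nu_ge0 x : 0 <= nu x.
Proof. by have := nuD x (- x); rewrite subrr nu0 nuN; lin_arith. Qed.
Lemma nuB x y : nu (x - y) <= nu x + nu y.
Proof. by rewrite -[nu y]nuN nuD. Qed.
Lemma nuBC x y : nu (x - y) = nu (y - x). Proof. by rewrite -nuN opprB. Qed.

Local Notation W := (unitization V).
Local Notation up := (ujp jp).
Local Notation one := (uone V).
Local Notation hW := (ujp_jordan hj).
Local Notation one_up := (uone_jp hj).

Section OneElement.
Variable a : V.
Local Notation ev := (pev up one ((0, a) : W)).
Definition pval p := (ev p).2.
Local Notation v := pval.

Lemma pvalD p q : v (p + q) = v p + v q. Proof. by rewrite /v pevD. Qed.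
Lemma pvalZ k p : v (k *: p) = k *: v p. Proof. by rewrite /v pevZ. Qed.
Lemma pvalN p : v (- p) = - v p. Proof. by rewrite /v pevN. Qed.
Lemma pvalB p q : v (p - q) = v p - v q. Proof. by rewrite pvalD pvalN. Qed.
Lemma ev1 p : (ev p).1 = p.[0].
Proof.
elim/poly_ind: p => [|p c IH]; first by rewrite pev0 horner0.
rewrite pevD (pevM hW one_up) (pevX hW one_up) pevC /= mulr0 add0r.
by rewrite hornerMXaddC mulr0 add0r /GRing.scale /= mulr1.
Qed.
Lemma evE p : ev p = (p.[0], v p). Proof. by rewrite -ev1 -surjective_pairing. Qed.
Lemma pvalM p q : v (p * q) = p.[0] *: v q + q.[0] *: v p + v p ** v q.
Proof. by rewrite {1}/v (pevM hW one_up) /= !ev1. Qed.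
Lemma pvalM0 p q : p.[0] = 0 -> q.[0] = 0 -> v (p * q) = v p ** v q.
Proof. by move=> p0 q0; rewrite pvalM p0 q0 !scale0r !add0r. Qed.
Lemma pvalX : v 'X = a. Proof. by rewrite /v (pevX hW one_up). Qed.
Lemma pvalC c : v c%:P = 0. Proof. by rewrite /v pevC /= scaler0. Qed.

Lemma nu_pval_sq q : q.[0] = 0 -> nu (v (q ^+ 2)) = nu (v q) ^+ 2.
Proof. by move=> q0; rewrite expr2 pvalM0 // (jb_norm_sq hV). Qed.

Lemma nu_pval_two s t : s.[0] = 0 -> t.[0] = 0 ->
  nu (v (s ^+ 2)) <= nu (v (s ^+ 2 + t ^+ 2)).
Proof.
move=> s0 t0; rewrite pvalD !expr2 !pvalM0 //; apply: (jb_two_squares hV).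
  by rewrite -!pvalM0 ?hornerM ?s0 ?t0 ?mul0r //; congr v; ring.
by rewrite -!pvalM0 ?hornerM ?s0 ?t0 ?mul0r //; congr v; ring.
Qed.

(** The norm of [p], in the C*-norm of the algebra generated by [a] and the
    unit, measured by its action as a multiplier; [p.[0]] is the value of [p]
    at the character that kills [a]. *)
Definition pbnd (p : {poly R}) (M : R) := `|p.[0]| <= M /\
  forall q, q.[0] = 0 -> nu (v (p * q)) <= M * nu (v q).
Local Notation B := pbnd.

Lemma pbnd_ge0 p M : B p M -> 0 <= M. Proof. by case=> + _; apply: le_trans. Qed.
Lemma pbnd_le p M N : B p M -> M <= N -> B p N.
Proof.
case=> p0 pM le; split=> [|q q0]; first exact: le_trans le.
by apply: le_trans (pM q q0) _; rewrite ler_wpM2r ?nu_ge0.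
Qed.
Lemma pbndD p q M N : B p M -> B q N -> B (p + q) (M + N).
Proof.
case=> p0 pM [q0 qN]; split=> [|r r0].
  by rewrite hornerD (le_trans (ler_normD _ _)) // lerD.
by rewrite mulrDl pvalD mulrDl (le_trans (nuD _ _)) // lerD ?pM ?qN.
Qed.
Lemma pbndZ k p M : B p M -> B (k *: p) (`|k| * M).
Proof.
case=> p0 pM; split=> [|r r0]; first by rewrite hornerZ normrM ler_wpM2l.
by rewrite poly_mulZl pvalZ nuZ -mulrA ler_wpM2l // pM.
Qed.
Lemma pbndN p M : B p M -> B (- p) M.
Proof. by move=> /(pbndZ (-1)); rewrite normrN1 mul1r scaleN1r. Qed.
Lemma pbndB p q M N : B p M -> B q N -> B (p - q) (M + N).
Proof. by move=> ? /pbndN; apply: pbndD. Qed.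
Lemma pbndC c : B c%:P `|c|.
Proof. by split=> [|r r0]; rewrite ?hornerC // mul_polyC pvalZ nuZ. Qed.
Lemma pbnd1 : B 1 1. Proof. by have := pbndC 1; rewrite normr1. Qed.
Lemma pbndM p q M N : B p M -> B q N -> B (p * q) (M * N).
Proof.
move=> [p0 pM] [q0 qN]; split=> [|r r0].
  by rewrite hornerM normrM ler_pM.
have qr0 : (q * r).[0] = 0 by rewrite hornerM r0 mulr0.
rewrite -mulrA (le_trans (pM _ qr0)) // -mulrA ler_wpM2l ?qN //.
exact: le_trans p0.
Qed.
Lemma pbndX p M n : B p M -> B (p ^+ n) (M ^+ n).
Proof. by move=> pM; elim: n => [|n IH]; [exact: pbnd1|rewrite !exprS; exact: pbndM]. Qed.
Lemma pbnd_ex p : exists2 M, 0 < M & B p M.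
Proof.
elim/poly_ind: p => [|p c [M M0 IH]].
  by exists 1 => //; apply: pbnd_le (pbndC 0) _; rewrite normr0.
exists (M * nu a + `|c| + 1); first by have := nu_ge0 a; have := normr_ge0 c; nra.
apply: (@pbnd_le _ (M * nu a + `|c|)); last by lin_arith.
apply: pbndD (pbndC c); apply: pbndM IH _; split=> [|q q0].
  by rewrite hornerX normr0 nu_ge0.
by rewrite pvalM0 ?hornerX // pvalX nuM.
Qed.
Lemma pbnd_lim p M c : 0 <= c -> (forall e, 0 < e -> e <= 1 -> B p (M + c * e)) -> B p M.
Proof.
move=> c0 H; split=> [|q q0].
  by apply: (ler_small c0) => e e0 e1; case: (H e e0 e1).
apply: (@ler_small _ _ _ (c * nu (v q))) => [|e e0 e1]; first by rewrite mulr_ge0 ?nu_ge0.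
by case: (H e e0 e1) => _ /(_ q q0); rewrite mulrDl mulrAC.
Qed.

(** Squaring is isometric on values, hence on multipliers. *)
Lemma pbnd_sqr p M : 0 <= M -> B (p ^+ 2) (M ^+ 2) -> B p M.
Proof.
move=> M0 [p0 pM]; split=> [|q q0].
  by move: p0; rewrite horner_exp normrX ler_sqr ?nnegrE.
rewrite -ler_sqr ?nnegrE ?mulr_ge0 ?nu_ge0 //.
have pq0 : (p * q).[0] = 0 by rewrite hornerM q0 mulr0.
rewrite -nu_pval_sq // !exprMn -nu_pval_sq //; apply: pM.
by rewrite horner_exp q0 expr0n.
Qed.

Lemma pbnd_two p r M : B (p ^+ 2 + r ^+ 2) M -> B (p ^+ 2) M.
Proof.
move=> pM; have M0 := pbnd_ge0 pM; case: pM => p0 pM.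
have sM : Num.sqrt M ^+ 2 = M by rewrite sqr_sqrtr.
rewrite -sM; apply: pbndX; split=> [|q q0].
  rewrite -ler_sqr ?nnegrE ?sqrtr_ge0 // sM -normrX -horner_exp.
  apply: le_trans p0; rewrite hornerD !horner_exp !ger0_norm ?addr_ge0 ?sqr_ge0 //.
  by rewrite lerDl sqr_ge0.
rewrite -ler_sqr ?nnegrE ?mulr_ge0 ?nu_ge0 ?sqrtr_ge0 // exprMn sM.
have pq0 : (p * q).[0] = 0 by rewrite hornerM q0 mulr0.
have rq0 : (r * q).[0] = 0 by rewrite hornerM q0 mulr0.
rewrite -!nu_pval_sq //; apply: le_trans (nu_pval_two pq0 rq0) _.
rewrite !exprMn -mulrDl; apply: pM.
by rewrite horner_exp q0 expr0n.
Qed.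

(** * Square roots and positive polynomials *)

(* The iteration [v <- (k + v^2)/2] converges to [1 - sqrt (1 - k)]; its
   increments are dominated by those of the case [k = 1]. *)
Fixpoint root_iter (k : {poly R}) n : {poly R} :=
  if n is m.+1 then 2^-1 *: (k + root_iter k m ^+ 2) else 0.
Fixpoint root_bound n : R := if n is m.+1 then (1 + root_bound m ^+ 2) / 2 else 0.

Lemma root_bound_le1 n : 0 <= root_bound n <= 1.
Proof. by elim: n => [|n /= /andP[? ?]]; rewrite ?lexx ?ler01 //; apply/andP; split; nra. Qed.

Lemma root_iter_bnd k t n : B k (2 * t - t ^+ 2) -> 0 <= t -> B (root_iter k n) t.
Proof.
move=> kt t0; elim: n => [|n IH] /=.
  by apply: pbnd_le (pbndC 0) _; rewrite normr0.
have := pbndZ 2^-1 (pbndD kt (pbndX 2 IH)); rewrite ger0_norm ?invr_ge0 ?ler0n //.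
by move=> /pbnd_le; apply; rewrite subrK mulKf // pnatr_eq0.
Qed.

Lemma root_iter_incr k n : B k 1 -> B (root_iter k n) (root_bound n) /\
  B (root_iter k n.+1 - root_iter k n) (root_bound n.+1 - root_bound n).
Proof.
move=> k1; elim: n => [|n [IH1 IH2]].
  split; first by apply: pbnd_le (pbndC 0) _; rewrite normr0.
  have := pbndZ 2^-1 k1; rewrite /= !expr0n /= !addr0 !subr0 => /pbnd_le; apply.
  by rewrite ger0_norm ?invr_ge0 ?ler0n // mulrC.
have IH : B (root_iter k n.+1) (root_bound n.+1).
  by have := pbndD IH2 IH1; rewrite !subrK.
split=> //.
have -> : root_iter k n.+2 - root_iter k n.+1 = 2^-1 *:
   ((root_iter k n.+1 - root_iter k n) * (root_iter k n.+1 + root_iter k n)).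
  rewrite [root_iter k n.+2]/= [X in _ - X = _]/= -scalerBr; congr (_ *: _).
  by ring.
have := pbndZ 2^-1 (pbndM IH2 (pbndD IH IH1)); rewrite ger0_norm ?invr_ge0 ?ler0n //.
move=> /pbnd_le; apply; have E m : root_bound m.+1 = (1 + root_bound m ^+ 2) / 2 by [].
rewrite [root_bound n.+2]E [X in _ <= _ - X]E.
move: (root_bound n) (root_bound n.+1) => x y; lin_arith.
Qed.

Lemma root_bound_small e : 0 < e -> exists n, root_bound n.+1 - root_bound n <= e.
Proof.
move=> e0; apply/not_existsP => H.
have grow n : n%:R * e <= root_bound n.
  elim: n => [|n IH]; first by rewrite mul0r.
  have /negP := H n; rewrite -ltNge => h.
  by rewrite -natr1 mulrDl mul1r; lin_arith.
have [n ltn] : exists n : nat, e^-1 < n%:R.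
  by exists (Num.truncn e^-1).+1; rewrite truncnS_gt.
have := grow n; have /andP[_ le1] := root_bound_le1 n.
have : 1 < n%:R * e by rewrite -ltr_pdivrMr // div1r.
lin_arith.
Qed.

Lemma root_defect k n : (1 - root_iter k n) ^+ 2 =
  2 *: (root_iter k n.+1 - root_iter k n) + (1 - k).
Proof.
have -> : root_iter k n.+1 = 2^-1 *: (k + root_iter k n ^+ 2) by [].
rewrite scalerBr scalerA divff ?pnatr_eq0 // scale1r scaler_nat.
by ring.
Qed.

Lemma root_approx k e : B k 1 -> 0 < e ->
  exists2 v, B v 1 & B ((1 - v) ^+ 2 - (1 - k)) e.
Proof.
move=> k1 e0; have [n Hn] := root_bound_small (divr_gt0 e0 (ltr0n R 2)).
exists (root_iter k n).
  by apply: root_iter_bnd => //; apply: pbnd_le k1 _; rewrite expr1n mulr1 -addrA subrr addr0.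
have [_ H] := root_iter_incr n k1; rewrite root_defect addrK.
have := pbndZ 2 H; rewrite ger0_norm ?ler0n // => /pbnd_le; apply.
by rewrite mulrC -ler_pdivlMr.
Qed.

(** The order is defined through the norm: [p >= 0] when [p] lies in a ball
    around a scalar [M] of radius [M]. *)
Definition ppos p := exists M, B (M%:P - p) M.

Lemma ppos_gt0 p : ppos p -> exists2 M, 0 < M & B (M%:P - p) M.
Proof.
case=> M pM; have M0 := pbnd_ge0 pM; exists (M + 1); first lin_arith.
have := pbndD pM pbnd1; rewrite polyCD (_ : M%:P - p + 1 = M%:P + 1 - p) //.
by ring.
Qed.

Lemma ppos_root p e : ppos p -> 0 < e -> exists y, B (y ^+ 2 - p) e.
Proof.
move=> /ppos_gt0[r r0 pr] e0; pose k := r^-1 *: (r%:P - p).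
have k1 : B k 1.
  by have := pbndZ r^-1 pr; rewrite gtr0_norm ?invr_gt0 // mulVf ?gt_eqF.
have [v _ H] := root_approx k1 (divr_gt0 e0 r0).
  exists (Num.sqrt r *: (1 - v)).
  have -> : (Num.sqrt r *: (1 - v)) ^+ 2 - p = r *: ((1 - v) ^+ 2 - (1 - k)).
    rewrite exprZn sqr_sqrtr ?ltW // scalerBr; congr (_ - _).
    rewrite scalerBr /k scalerA mulfV ?gt_eqF // scale1r alg_polyC.
    by rewrite opprB addrC subrK.
by have := pbndZ r H; rewrite gtr0_norm // mulrC divfK ?gt_eqF.
Qed.

(** With [z^2 = 1 - m^2], the polynomials [1 - 2 m^2] and [2 m z] are the
    cosine and the sine of one angle, so their squares add up to 1. *)
Lemma pbnd_cos m : B m 1 -> B (1 - m ^+ 2 *+ 2) 1.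
Proof.
move=> m1; apply: (@pbnd_lim _ _ 4) => // e e0 e1.
have m2 : B (m ^+ 2) 1 by rewrite -[1](expr1n _ 2); exact: pbndX.
have [v _] := root_approx m2 e0.
set z := 1 - v; set d := _ - _ => de.
have : B ((1 - m ^+ 2 *+ 2) ^+ 2 + (m * z *+ 2) ^+ 2) (1 + 4 * e).
  rewrite (_ : _ + _ = 1 + 4 *: (m ^+ 2 * d)); last first.
    by rewrite scaler_nat /d; ring.
  apply: pbndD pbnd1 _; have := pbndZ 4 (pbndM m2 de).
  by rewrite mul1r ger0_norm ?ler0n.
move=> /pbnd_two H; apply: pbnd_sqr; first lin_arith.
apply: pbnd_le H _; nra.
Qed.

(** Squares are positive: [M - y^2] is [(M/2) (1 + cos)] for the angle above. *)
Lemma pbnd_subsq y M : 0 < M -> B (y ^+ 2) M -> B (M%:P - y ^+ 2) M.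
Proof.
move=> M0 yM; pose m := (Num.sqrt M)^-1 *: y.
have s0 : 0 < Num.sqrt M by rewrite sqrtr_gt0.
have mE : m ^+ 2 = M^-1 *: y ^+ 2 by rewrite exprZn exprVn sqr_sqrtr ?ltW.
have m1 : B m 1.
  apply: pbnd_sqr => //; rewrite mE expr1n; have := pbndZ M^-1 yM.
  by rewrite gtr0_norm ?invr_gt0 // mulVf ?gt_eqF.
have := pbndZ (M / 2) (pbndD pbnd1 (pbnd_cos m1)).
rewrite mE ger0_norm ?divr_ge0 ?ltW // => /pbnd_le.
rewrite (_ : _ *: _ = M%:P - y ^+ 2); last first.
  by rewrite -[M%:P]mulr1 mul_polyC; vlin R; rewrite gt_eqF.
by apply; lin_arith.
Qed.

(** The radius in the definition of positivity can be any bound of [p]: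
    approximate [p] by a square. *)
Lemma ppos_bnd p M : ppos p -> B p M -> B (M%:P - p) M.
Proof.
move=> pp pM; apply: (@pbnd_lim _ _ 3) => // e e0 e1.
have [y ye] := ppos_root pp e0; have M0 := pbnd_ge0 pM.
have yM : B (y ^+ 2) (M + e) by have := pbndD pM ye; rewrite addrC subrK.
have := pbndD (pbndB (pbnd_subsq _ yM) (pbndC e)) ye.
rewrite polyCD (_ : _ - _ + _ = M%:P - p); last by ring.
move=> H; apply: pbnd_le (H _) _; first lin_arith.
by rewrite gtr0_norm //; lin_arith.
Qed.

Lemma ppos_lim p : (forall d, 0 < d -> ppos (p + d%:P)) -> ppos p.
Proof.
move=> H; have [M M0 pM] := pbnd_ex p; exists M.
apply: (@pbnd_lim _ _ 1) => // d d0 d1; rewrite mul1r.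
have dM : B (p + d%:P) (M + d) by have := pbndD pM (pbndC d); rewrite gtr0_norm.
have := ppos_bnd (H d d0) dM.
by rewrite polyCD (_ : _ - _ = M%:P - p) //; ring.
Qed.

Lemma ppos_sqr y : ppos (y ^+ 2).
Proof. by have [M M0 yM] := pbnd_ex (y ^+ 2); exists M; exact: pbnd_subsq. Qed.
Lemma pposD p q : ppos p -> ppos q -> ppos (p + q).
Proof.
case=> M pM [N qN]; exists (M + N); have := pbndD pM qN; rewrite polyCD.
by rewrite (_ : M%:P - p + (N%:P - q) = M%:P + N%:P - (p + q)) //; ring.
Qed.
Lemma pposZ k p : 0 <= k -> ppos p -> ppos (k *: p).
Proof.
move=> k0 [M pM]; exists (k * M); have := pbndZ k pM.
by rewrite ger0_norm // scalerBr -mul_polyC -polyCM.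
Qed.
Lemma pposC c : 0 <= c -> ppos c%:P.
Proof. by move=> c0; exists c; rewrite subrr; apply: pbnd_le (pbndC 0) _; rewrite normr0. Qed.
Lemma ppos_shift p d : B p d -> ppos (p + d%:P).
Proof. by move=> pd; exists d; rewrite opprD addrA addrAC subrr add0r; exact: pbndN. Qed.
Lemma ppos_subr p d : B p d -> ppos (d%:P - p).
Proof. by move=> /pbndN /ppos_shift; rewrite addrC. Qed.

(** Products of approximate squares are approximate squares. *)
Lemma pposM p q : ppos p -> ppos q -> ppos (p * q).
Proof.
move=> pp pq; apply: ppos_lim => d d0.
have [M M0 pM] := pbnd_ex p; have [N N0 qN] := pbnd_ex q.
pose e := Num.min 1 (d / (M + N + 1)).
have e0 : 0 < e by rewrite lt_min ltr01 divr_gt0 //; lin_arith.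
have e1 : e <= 1 by rewrite ge_min lexx.
have e2 : e * (M + N + 1) <= d by rewrite -ler_pdivlMr ?ge_min ?lexx ?orbT //; lin_arith.
have [y ye] := ppos_root pp e0; have [z ze] := ppos_root pq e0.
have zN : B (z ^+ 2) (N + e) by have := pbndD qN ze; rewrite addrC subrK.
have H : B (p * q - (y * z) ^+ 2) d.
  rewrite (_ : _ - _ = - ((y ^+ 2 - p) * z ^+ 2 + p * (z ^+ 2 - q))); last by ring.
  apply/pbndN/(pbnd_le (pbndD (pbndM ye zN) (pbndM pM ze))); nra.
have := pposD (ppos_sqr (y * z)) (ppos_shift H).
by rewrite addrA [_ ^+ 2 + _]addrC subrK.
Qed.

Lemma root_iter_pos k n : ppos k -> ppos (root_iter k n).
Proof.
move=> pk; elim: n => [|n IH] /=; first by have := @pposC 0 (lexx 0); rewrite polyC0.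
by apply: pposZ; rewrite ?invr_ge0 //; apply: pposD => //; exact: ppos_sqr.
Qed.

(** Square roots of the elements [p] of the unit interval, with the distance
    to 1 halved up to second order. *)
Lemma unit_root p t e : B p 1 -> B (1 - p) (2 * t - t ^+ 2) -> 0 <= t <= 1 -> 0 < e ->
  exists y, [/\ B y 1, B (1 - y) t & B (y ^+ 2 - p) e].
Proof.
move=> p1 pt /andP[t0 t1] e0.
have k1 : B (1 - p) 1 by apply: pbnd_le pt _; nra.
have pk : ppos (1 - p) by exact: (@ppos_subr p 1).
have [n Hn] := root_bound_small (divr_gt0 e0 (ltr0n R 2)).
have pv := root_iter_pos n pk.
have v1 : B (root_iter (1 - p) n) 1.
  by apply: root_iter_bnd => //; apply: pbnd_le k1 _; rewrite expr1n mulr1 -addrA subrr addr0.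
exists (1 - root_iter (1 - p) n); split; first exact: (ppos_bnd pv v1).
  by rewrite opprB addrC subrK; exact: root_iter_bnd.
have [_ H] := root_iter_incr n k1.
rewrite (root_defect _ n) subKr addrK.
have := pbndZ 2 H; rewrite ger0_norm ?ler0n // => /pbnd_le; apply.
by rewrite mulrC -ler_pdivlMr.
Qed.

Lemma pposX p n : ppos p -> ppos (p ^+ n).
Proof. by move=> pp; elim: n => [|n IH]; [exact: (@pposC 1)|rewrite exprS; exact: pposM]. Qed.

(** [(r - p)(r + p) = r^2 - p^2] is approximately a square [t^2], and
    [p^2 + t^2] bounds [p^2]. *)
Lemma pbnd_order p r : ppos (r%:P - p) -> ppos (r%:P + p) -> 0 <= r -> B p r.
Proof.
move=> p1 p2 r0; apply: pbnd_sqr => //; apply: (@pbnd_lim _ _ 1) => // e e0 e1.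
have [t te] := ppos_root (pposM p1 p2) e0.
apply: (@pbnd_two _ t); rewrite mul1r.
have := pbndD te (pbndC (r ^+ 2)); rewrite ger0_norm ?sqr_ge0 // [e + _]addrC polyC_exp.
by rewrite (_ : _ - _ + _ = p ^+ 2 + t ^+ 2) //; ring.
Qed.

Lemma pbnd_pos p r : ppos p -> ppos (r%:P - p) -> 0 <= r -> B p r.
Proof.
move=> pp pr r0; apply: pbnd_order => //.
rewrite (_ : _ + p = (r%:P - p) + 2 *: p); last by rewrite scaler_nat; ring.
by apply: pposD => //; exact: pposZ.
Qed.

Lemma ppos_horner p : ppos p -> 0 <= p.[0].
Proof. by case=> M [+ _]; rewrite !hornerE ler_norml; lin_arith. Qed.

(** [(n + 1) s (1 - s)^n] is at most the sum of [s (1 - s)^i] over [i <= n],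
    which telescopes to [1 - (1 - s)^(n+1)]. *)
Lemma pbnd_peak s n : ppos s -> B s 1 -> B (s * (1 - s) ^+ n) n.+1%:R^-1.
Proof.
move=> ps s1; have pc : ppos (1 - s) by exact: (@ppos_subr s 1).
have c1 : B (1 - s) 1 by exact: (ppos_bnd ps s1).
apply: pbnd_pos; rewrite ?invr_ge0 ?ler0n //.
  by apply: pposM => //; exact: pposX.
rewrite (_ : _ - _ = n.+1%:R^-1 *: (1 - (s * (1 - s) ^+ n) *+ n.+1)); last first.
  by rewrite scalerBr -mul_polyC mulr1 -(scaler_nat n.+1 (s * _)) scalerA mulVf ?pnatr_eq0 // scale1r.
apply: pposZ; first by rewrite invr_ge0 ler0n.
have mono m : (m <= n)%N -> ppos ((1 - (1 - s) ^+ m.+1) - (s * (1 - s) ^+ n) *+ m.+1).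
  elim: m => [_|m IH lt_mn].
    rewrite (_ : _ - _ = s * (1 - (1 - s) ^+ n)); last by ring.
    apply: pposM => //; apply: ppos_subr; rewrite -[X in B _ X](expr1n _ n).
    exact: pbndX.
  rewrite (_ : _ - _ = (1 - (1 - s) ^+ m.+1 - (s * (1 - s) ^+ n) *+ m.+1)
    + s * (1 - s) ^+ m.+1 * (1 - (1 - s) ^+ (n - m.+1))); last first.
    have cE : (1 - s) ^+ n = (1 - s) ^+ m.+1 * (1 - s) ^+ (n - m.+1).
      by rewrite -exprD subnKC.
    rewrite cE [(1 - s) ^+ m.+2]exprS.
    by move: (_ ^+ m.+1) (_ ^+ (n - _)) => u w; ring.
  apply: pposD; first exact: IH (ltnW lt_mn).
  apply: pposM; first by apply: pposM => //; exact: pposX.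
  by apply: ppos_subr; rewrite -[X in B _ X](expr1n _ (n - m.+1)); exact: pbndX.
have := pposD (mono n (leqnn n)) (pposX n.+1 pc).
by rewrite addrAC subrK.
Qed.

End OneElement.

(** * Dissipative multiplications *)

(** The unitization acts on [V], an ideal of it. *)
Definition uact (h : W) (x : V) : V := h.1 *: x + h.2 ** x.

Lemma up_act h x : up h ((0, x) : W) = (0, uact h x) :> W.
Proof. by rewrite /ujp /uact /= mulr0 scale0r addr0. Qed.
Lemma uactDr h x y : uact h (x + y) = uact h x + uact h y.
Proof. rewrite /uact; jlin (jb_jordan hV) R. Qed.
Lemma uactZr h k x : uact h (k *: x) = k *: uact h x.
Proof. rewrite /uact; jlin (jb_jordan hV) R. Qed.
Lemma uactDl g h x : uact (g + h) x = uact g x + uact h x.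
Proof. by rewrite /uact scalerDl (jpDl hj) addrACA. Qed.

Definition unorm (h : W) := `|h.1| + nu h.2.
Lemma unorm_ge0 h : 0 <= unorm h. Proof. by rewrite addr_ge0 ?nu_ge0. Qed.
Lemma uact_le h x : nu (uact h x) <= unorm h * nu x.
Proof. by rewrite mulrDl (le_trans (nuD _ _)) // nuZ lerD ?nuM. Qed.
Lemma unormD g h : unorm (g + h) <= unorm g + unorm h.
Proof. by rewrite /unorm addrACA lerD ?ler_normD ?nuD. Qed.
Lemma unormZ k h : unorm (k *: h) = `|k| * unorm h.
Proof. by rewrite /unorm /= normrM nuZ mulrDr. Qed.
Lemma unormN h : unorm (- h) = unorm h.
Proof. by rewrite -scaleN1r unormZ normrN1 mul1r. Qed.
Lemma unormM g h : unorm (up g h) <= unorm g * unorm h.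
Proof.
case: g h => [l x] [m y]; rewrite /unorm /ujp /= normrM.
have := nuD (l *: y + m *: x) (x ** y); have := nuD (l *: y) (m *: x).
by have := nuM x y; rewrite !nuZ; lin_arith.
Qed.

(** The quadratic operator of [c] restricted to the ideal [V]. *)
Definition uquad (c : W) (x : V) := uact c (uact c x) *+ 2 - uact (up c c) x.
Lemma quadU_act c x : quadU up c ((0, x) : W) = (0, uquad c x) :> W.
Proof.
rewrite /quadU /bilU !up_act /uquad mulr2n; congr (_, _).
by rewrite /= !addr0 subr0.
Qed.
Lemma uquadE (l : R) d x : uquad (l, d) x =
  l ^+ 2 *: x + (2 * l) *: (d ** x) + (d ** (d ** x)) *+ 2 - d ** d ** x.
Proof. rewrite /uquad /uact /ujp /=; jlin (jb_jordan hV) R. Qed.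
Lemma uquad_le (l : R) d x :
  nu (uquad (l, d) x) <= (l ^+ 2 + 2 * `|l| * nu d + 3 * nu d ^+ 2) * nu x.
Proof.
rewrite uquadE -(scaler_nat 2 (d ** (d ** x))).
have := nuB (l ^+ 2 *: x + (2 * l) *: (d ** x) + 2 *: (d ** (d ** x))) (d ** d ** x).
have := nuD (l ^+ 2 *: x + (2 * l) *: (d ** x)) (2 *: (d ** (d ** x))).
have := nuD (l ^+ 2 *: x) ((2 * l) *: (d ** x)).
rewrite !nuZ (normrM 2 l) normr_nat (ger0_norm (sqr_ge0 l)).
have h1 := nuM d x; have h2 := nuM d (d ** x); have h3 := nuM (d ** d) x.
have h4 : nu d * nu (d ** x) <= nu d * (nu d * nu x) by rewrite ler_wpM2l ?nu_ge0.
have h5 : nu (d ** d) * nu x <= nu d * nu d * nu x by rewrite ler_wpM2r ?nu_ge0 ?nuM.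
have h6 : `|l| * nu (d ** x) <= `|l| * (nu d * nu x) by rewrite ler_wpM2l.
by move=> k1 k2 k3; lin_arith.
Qed.

Lemma uquad_le_unorm c x : nu (uquad c x) <= 3 * unorm c ^+ 2 * nu x.
Proof.
case: c => l d; apply: le_trans (uquad_le l d x) _; rewrite ler_wpM2r ?nu_ge0 //.
rewrite /unorm /= -(real_normK (num_real l)).
have := normr_ge0 l; have := nu_ge0 d; nra.
Qed.

(** The flow generated by [- h] is contractive; this is expressed by its
    Euler steps. The time step is written [s^2], so that the error of order
    3/2 in time is a polynomial. *)
Definition dissipative (h : W) := exists C s0, [/\ 0 <= C, 0 < s0 &
  forall s, 0 < s -> s <= s0 -> forall x,
    nu (x - s ^+ 2 *: uact h x) <= (1 + C * s ^+ 3) * nu x].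

(** The increments of an almost convex sequence hardly decrease, so an initial
    increase would persist and contradict the bound. *)
Lemma almost_convex_incr (m : nat -> R) M e K : (0 < K)%N ->
  (forall k, 0 <= m k <= M) -> 0 <= e ->
  (forall k, 2 * m k.+1 - e <= m k.+2 + m k) ->
  m 1%N - m 0%N <= M / K%:R + K%:R * e.
Proof.
move=> K0 mM e0 conv.
have d k : m 1%N - m 0%N - k%:R * e <= m k.+1 - m k.
  elim: k => [|k IH]; first by rewrite mul0r subr0.
  by have := conv k; rewrite -natr1; lin_arith.
have S k : k%:R * (m 1%N - m 0%N) - k%:R ^+ 2 * e <= m k - m 0%N.
  elim: k => [|k IH]; first by rewrite expr0n !mul0r !subrr.
  have := d k; rewrite -natr1.
  have k0 : 0 <= (k%:R : R) by rewrite ler0n.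
  have : 0 <= k%:R * e by rewrite mulr_ge0.
  by move: (k%:R : R) k0 IH => kk ?; nra.
have K1 : 0 < (K%:R : R) by rewrite ltr0n.
have := S K; have /andP[_ ] := mM K; have /andP[m0 _] := mM 0%N.
move: (K%:R : R) K1 => k k0 ? ?.
rewrite -(ler_pM2l k0) [X in _ <= X]mulrDr [k * (M / k)]mulrC divfK ?gt_eqF //; nra.
Qed.

Section OneElementDissipative.
Variable a : V.
Local Notation ev := (pev up one ((0, a) : W)).
Local Notation v := (pval a).
Local Notation B := (pbnd a).

Lemma uact_ev p q : q.[0] = 0 -> uact (ev p) (v q) = v (p * q).
Proof. by move=> q0; rewrite pvalM q0 scale0r addr0 evE. Qed.

Lemma pval_le q M : B q M -> nu (v q) <= 2 * M.
Proof.
move=> qM; have M0 := pbnd_ge0 qM; pose r := q - q.[0]%:P.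
have r0 : r.[0] = 0 by rewrite !hornerE subrr.
have rv : v r = v q by rewrite pvalB pvalC subr0.
have [q0 _] := qM; have := pbndB qM (pbndC a q.[0]) => -[_ /(_ r r0)].
rewrite -expr2 nu_pval_sq // rv.
have := nu_ge0 (v q); nra.
Qed.

Lemma uquad_pbnd q x : B q 1 -> nu (uquad (ev q) x) <= 17 * nu x.
Proof.
move=> q1; have := pval_le q1; case: q1 => q0 _ vq; rewrite evE.
apply: le_trans (uquad_le _ _ _) _; rewrite ler_wpM2r ?nu_ge0 //.
rewrite -(real_normK (num_real q.[0])).
have := normr_ge0 q.[0]; have := nu_ge0 (v q); nra.
Qed.

Lemma jpow_ev q k : jpow up one (ev q) k = ev (q ^+ k).
Proof.
elim: k => [|k IH]; first by rewrite expr0 pev1.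
by rewrite jpowS IH exprS (pevM hW one_up).
Qed.

Lemma iter_uquad q k x : iter k (uquad (ev q)) x = uquad (ev (q ^+ k)) x.
Proof.
have H : iter k (quadU up (ev q)) ((0, x) : W) = (0, iter k (uquad (ev q)) x) :> W.
  by elim: k => //= k ->; rewrite quadU_act.
have := quadU_act (ev (q ^+ k)) x; rewrite -jpow_ev (quadU_jpow hW one_up) H.
by case.
Qed.

(** Positivity in the commutative algebra generated by [a] implies
    dissipativity on the whole of [V]: the orbit [u_k = U_(1 - t h / 2)^k x]
    stays bounded because [(1 - t h / 2)^k] does, its norm is almost convex
    in [k] because [h] is hermitian, so it cannot start by increasing. *)
Lemma ppos_dissipative p : ppos a p -> dissipative (ev p).
Proof.
move=> /ppos_gt0[M M0 pM]; set h := ev p.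
have [C C0 herm] := jb_hermitian hV h.1 h.2.
pose H := uact h; pose b : R := unorm h; pose ka : R := 3 * b ^+ 2.
have b0 : 0 <= b by exact: unorm_ge0.
have ka0 : 0 <= ka by rewrite mulr_ge0 ?sqr_ge0.
(* [17] bounds the orbit; the rest is the third order error of the recursion
   [u_(k+2) + u_k = 2 u_(k+1) + t^2 H^2 u_(k+1) + err]. *)
pose E : R := 17 * (2 * C + (2 * b * ka + ka ^+ 2 + b ^+ 2 * (b + ka))).
have E0 : 0 <= E.
  have := mulr_ge0 b0 ka0; have := sqr_ge0 ka.
  by have := mulr_ge0 (sqr_ge0 b) (addr_ge0 b0 ka0); rewrite /E; lin_arith.
exists (17 + 2 * E + ka), (Num.min 1 (Num.sqrt (2 / M))); split.
- by lin_arith.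
- by rewrite lt_min ltr01 sqrtr_gt0 divr_gt0.
move=> s s0; rewrite le_min => /andP[s1 sM] x.
pose t : R := s ^+ 2; have t0 : 0 < t by rewrite exprn_gt0.
have t1 : t <= 1 by rewrite expr_le1 // ltW.
have tM : t * M <= 2.
  have sq : Num.sqrt (2 / M) ^+ 2 = 2 / M by rewrite sqr_sqrtr ?divr_ge0 ?ltW.
  by rewrite -ler_pdivlMr // -sq /t ler_sqr ?nnegrE ?sqrtr_ge0 // ltW.
pose q := 1 - (t / 2) *: p.
have q1 : B q 1.
  have := pbndD (pbndC a (1 - t / 2 * M)) (pbndZ (t / 2) pM).
  rewrite scalerBr -mul_polyC -polyCM polyCB addrA subrK.
  move=> /pbnd_le; apply.
  have h1 : 0 <= 1 - t / 2 * M by lin_arith.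
  have h2 : 0 <= t / 2 by lin_arith.
  by rewrite (ger0_norm h1) (ger0_norm h2); lin_arith.
pose S := uquad (ev q).
have SE y : S y = y - t *: H y + (t ^+ 2 / 4) *: uquad h y.
  rewrite /S /q pevB pevZ pev1 -/h /H [h]surjective_pairing.
  move: h.1 h.2 => l d.
  have -> : one - (t / 2) *: ((l, d) : W) = (1 - t / 2 * l, - ((t / 2) *: d)).
    by congr (_, _); rewrite /= sub0r.
  rewrite !uquadE /uact /=; jlin (jb_jordan hV) R.
pose D y := - (t *: H y) + (t ^+ 2 / 4) *: uquad h y.
have SD y : S y = y + D y by rewrite SE addrA.
have Hb y : nu (H y) <= b * nu y by exact: uact_le.
have Kb y : nu (uquad h y) <= ka * nu y by exact: uquad_le_unorm.
pose u k := iter k S x.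
have ub k : nu (u k) <= 17 * nu x.
  by rewrite /u /S iter_uquad uquad_pbnd //; rewrite -[1](expr1n _ k); exact: pbndX.
have HB y z : H (y + z) = H y + H z by exact: uactDr.
have HZ k y : H (k *: y) = k *: H y by exact: uactZr.
have KB y z : uquad h (y + z) = uquad h y + uquad h z.
  by rewrite /uquad !uactDr; zlin.
have KZ k y : uquad h (k *: y) = k *: uquad h y.
  by rewrite /uquad !uactZr; vlin R.
have Db y : nu (D y) <= t * (b + ka) * nu y.
  apply: le_trans (nuD _ _) _; rewrite nuN !nuZ gtr0_norm // ger0_norm ?divr_ge0 ?sqr_ge0 //.
  have := ler_wpM2l (ltW t0) (Hb y); have := ler_wpM2l (sqr_ge0 t) (Kb y).
  have : t ^+ 2 * (ka * nu y) <= t * (ka * nu y).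
    by rewrite ler_wpM2r ?mulr_ge0 ?nu_ge0 // expr2 ger_pMr.
  have := mulr_ge0 (ltW t0) (mulr_ge0 ka0 (nu_ge0 y)); lin_arith.
pose err w := - (t ^+ 2 *: H (H (D w))) - (t ^+ 3 / 4) *: (H (uquad h w) + uquad h (H w))
   + (t ^+ 4 / 16) *: uquad h (uquad h w).
have errb w : nu (err w) <= t ^+ 3 * (2 * b * ka + ka ^+ 2 + b ^+ 2 * (b + ka)) * nu w.
  have n0 := nu_ge0 w; have t3 : 0 <= t ^+ 3 by rewrite exprn_ge0 // ltW.
  have e1 : nu (t ^+ 2 *: H (H (D w))) <= t ^+ 3 * (b ^+ 2 * (b + ka) * nu w).
    rewrite nuZ ger0_norm ?sqr_ge0 // [t ^+ 3]exprSr -mulrA ler_wpM2l ?sqr_ge0 //.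
    have := ler_wpM2l b0 (le_trans (Hb (D w)) (ler_wpM2l b0 (Db w))).
    by move=> /(le_trans (Hb _)); rewrite expr2; lin_arith.
  have e2 : nu (H (uquad h w) + uquad h (H w)) <= 2 * b * ka * nu w.
    have := nuD (H (uquad h w)) (uquad h (H w)).
    have := le_trans (Hb (uquad h w)) (ler_wpM2l b0 (Kb w)).
    have := le_trans (Kb (H w)) (ler_wpM2l ka0 (Hb w)); lin_arith.
  have e3 : nu (uquad h (uquad h w)) <= ka ^+ 2 * nu w.
    by have := le_trans (Kb (uquad h w)) (ler_wpM2l ka0 (Kb w)); rewrite expr2; lin_arith.
  have t4 : t ^+ 4 <= t ^+ 3 by rewrite exprS ger_pMl // exprn_gt0.
  have := nuD (- (t ^+ 2 *: H (H (D w))) - (t ^+ 3 / 4) *: (H (uquad h w) + uquad h (H w))) ((t ^+ 4 / 16) *: uquad h (uquad h w)).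
  have := nuB (- (t ^+ 2 *: H (H (D w)))) ((t ^+ 3 / 4) *: (H (uquad h w) + uquad h (H w))).
  have t3' : 0 <= t ^+ 3 / 4 by rewrite divr_ge0.
  have t4' : 0 <= t ^+ 4 / 16 by rewrite divr_ge0 // exprn_ge0 // ltW.
  rewrite nuN (nuZ (t ^+ 3 / 4)) (nuZ (t ^+ 4 / 16)) (ger0_norm t3') (ger0_norm t4').
  have e2' := ler_wpM2l t3 e2; have e3' := ler_wpM2l t3 e3.
  have e3'' : t ^+ 4 * nu (uquad h (uquad h w)) <= t ^+ 3 * nu (uquad h (uquad h w)).
    by rewrite ler_wpM2r ?nu_ge0.
  have p1 : 0 <= t ^+ 3 * (2 * b * ka * nu w) by rewrite mulr_ge0 // mulr_ge0 // mulr_ge0 // mulr_ge0.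
  have p2 : 0 <= t ^+ 3 * (ka ^+ 2 * nu w) by rewrite mulr_ge0 // mulr_ge0 // sqr_ge0.
  rewrite -/(err w); lin_arith.
have uE k : u k.+2 + u k = u k.+1 *+ 2 + t ^+ 2 *: H (H (u k.+1)) + err (u k).
  have DB y z : D (y + z) = D y + D z by rewrite /D HB KB; vlin R.
  have -> : u k.+2 = u k.+1 + D (u k.+1) by rewrite -SD.
  have -> : u k.+1 = u k + D (u k) by rewrite -SD.
  set w := u k; rewrite DB (HB w) (HB (H w)) /err [in D (D w)]/D.
  have -> : H (D w) = - (t *: H (H w)) + (t ^+ 2 / 4) *: H (uquad h w).
    by rewrite /D HB HZ -scaleN1r HZ HZ; vlin R.
  have -> : uquad h (D w) = - (t *: uquad h (H w)) + (t ^+ 2 / 4) *: uquad h (uquad h w).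
    by rewrite /D KB KZ -scaleN1r KZ KZ; vlin R.
  by vlin R.
pose m k := nu (u k).
have conv k : 2 * m k.+1 - t ^+ 3 * (E * nu x) <= m k.+2 + m k.
  have c1 := herm t (u k.+1); rewrite t0 t1 in c1.
  have {}c1 := c1 isT; rewrite /= -/(H _) -/(H (H _)) in c1.
  have e1 := nuD (u k.+2) (u k); rewrite uE in e1.
  have e2 := nuB (u k.+1 *+ 2 + t ^+ 2 *: H (H (u k.+1)) + err (u k)) (err (u k)).
  rewrite addrK in e2.
  have e3 := nuD (u k.+1 *+ 2 + t ^+ 2 *: H (H (u k.+1))) (2 *: (u k.+1 - (t ^+ 2 / 2) *: H (H (u k.+1)))).
  rewrite nuZ normr_nat (_ : _ + _ = 4 *: u k.+1) in e3; last by vlin R.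
  rewrite nuZ normr_nat in e3.
  have e4 := errb (u k).
  have t3 : 0 <= t ^+ 3 by rewrite exprn_ge0 // ltW.
  have c0 := mulr_ge0 C0 t3.
  have e5 := ler_wpM2l c0 (ub k.+1).
  have g0 : 0 <= 2 * b * ka + ka ^+ 2 + b ^+ 2 * (b + ka).
    have := mulr_ge0 b0 ka0; have := sqr_ge0 ka.
    by have := mulr_ge0 (sqr_ge0 b) (addr_ge0 b0 ka0); lin_arith.
  have e6 := ler_wpM2l (mulr_ge0 t3 g0) (ub k).
  rewrite /m /E; lin_arith.
(* [K] steps cost [17 / K + K t^3 E] per unit of norm; as [t^3 = s^6], both
   terms have order [s^3] for [K] about [s^-3]. *)
pose K := (Num.truncn (s ^- 3)).+1.
have s3 : 0 < s ^+ 3 by rewrite exprn_gt0.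
have K1 : s ^- 3 < K%:R by rewrite truncnS_gt.
have K2 : (K%:R : R) <= 2 * s ^- 3.
  have : 1 <= s ^- 3 by rewrite invf_ge1 // exprn_ile1 // ltW.
  have : (Num.truncn (s ^- 3))%:R <= s ^- 3 by rewrite truncn_le // invr_ge0 ltW.
  by rewrite /K -natr1; lin_arith.
have := @almost_convex_incr m (17 * nu x) (t ^+ 3 * (E * nu x)) K isT _ _ conv.
have nx := nu_ge0 x.
have Ex : 0 <= t ^+ 3 * (E * nu x) by rewrite mulr_ge0 ?(exprn_ge0 3 (ltW t0)) // mulr_ge0.
move=> /(_ (fun k => _) Ex) H1.
have {}H1 : m 1%N - m 0%N <= s ^+ 3 * (17 + 2 * E) * nu x.
  apply: le_trans (H1 _) _ => [k|]; first by rewrite nu_ge0 ub.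
  have f1 : 17 * nu x / K%:R <= 17 * nu x * s ^+ 3.
    by rewrite ler_wpM2l ?mulr_ge0 // -[leRHS]invrK lef_pV2 ?posrE ?invr_gt0 ?ltr0n // ltW.
  have f2 : K%:R * (t ^+ 3 * (E * nu x)) <= 2 * s ^+ 3 * (E * nu x).
    apply: le_trans (ler_wpM2r Ex K2) _.
    have -> : t ^+ 3 = s ^+ 3 * s ^+ 3 by rewrite /t -exprM (exprD s 3 3).
    rewrite le_eqVlt; apply/orP; left; apply/eqP; field.
    by rewrite gt_eqF.
  lin_arith.
have SxE : x - s ^+ 2 *: uact h x = S x - (t ^+ 2 / 4) *: uquad h x.
  by rewrite SE addrK.
rewrite SxE; apply: le_trans (nuB _ _) _.
rewrite nuZ ger0_norm ?divr_ge0 ?sqr_ge0 //.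
have k1 : t ^+ 2 <= s ^+ 3 by rewrite /t -exprM (exprS s 3) ger_pMl.
have k2 : t ^+ 2 * nu (uquad h x) <= s ^+ 3 * (ka * nu x).
  by rewrite ler_pM ?sqr_ge0 ?nu_ge0.
have k3 : 0 <= s ^+ 3 * (ka * nu x) by rewrite mulr_ge0 ?(ltW s3) // mulr_ge0.
have k4 : m 1%N = nu (S x) by []; have k5 : m 0%N = nu x by [].
rewrite k4 k5 in H1; have := sqr_ge0 t; lin_arith.
Qed.

(** A contraction [c] of this commutative algebra gives the positive element
    [1 - c]; this is applied to the Euler steps, divided by the time step. *)
Lemma dissipative_ppos p : 0 <= p.[0] -> dissipative (ev p) -> ppos a p.
Proof.
move=> p0 [C [s0 [C0 s00 H]]]; apply: ppos_lim => d d0.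
pose s := Num.min s0 (Num.min (d / (C + 1)) (1 / (p.[0] + 1))).
have C1 : 0 < C + 1 by lin_arith.
have p1 : 0 < p.[0] + 1 by lin_arith.
have s_gt0 : 0 < s by rewrite !lt_min s00 !divr_gt0.
have sC : s * (C + 1) <= d.
  by rewrite -ler_pdivlMr // ?ge_min lexx ?orbT.
have sp : s * (p.[0] + 1) <= 1.
  by rewrite -ler_pdivlMr // ?ge_min lexx ?orbT.
have s1 : s <= 1 by nra.
have s3 : 0 < s ^+ 3 by rewrite exprn_gt0.
have s2 : 0 < s ^+ 2 by rewrite exprn_gt0.
have c1 : B (1 - s ^+ 2 *: p) (1 + C * s ^+ 3).
  split=> [|q q0].
    rewrite hornerD hornerN hornerZ hornerC.
    have h1 : s ^+ 2 * p.[0] <= s * p.[0] by rewrite ler_wpM2r // expr2 ger_pMr.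
    have h2 : s * p.[0] <= 1 by rewrite mulrDr in sp; lin_arith.
    have h3 : 0 <= s ^+ 2 * p.[0] by rewrite mulr_ge0 // ltW.
    have h4 : 0 <= C * s ^+ 3 by rewrite mulr_ge0 // ltW.
    by rewrite ler_norml; apply/andP; split; lin_arith.
  rewrite mulrBl mul1r pvalB poly_mulZl pvalZ -uact_ev //; apply: H => //.
  by rewrite ge_min lexx.
have := pposZ (ltW (_ : 0 < s ^- 2)) (ppos_subr c1).
rewrite invr_gt0 => /(_ s2) H1.
have : ppos a (p + (C * s)%:P + (d - C * s)%:P).
  apply: pposD; last by apply: pposC; nra.
  rewrite (_ : p + _ = s ^- 2 *: ((1 + C * s ^+ 3)%:P - (1 - s ^+ 2 *: p))) //.
  rewrite polyCD polyC1 -[(C * _ ^+ 3)%:P]mulr1 -[(C * s)%:P]mulr1 !mul_polyC.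
  by vlin R; rewrite gt_eqF.
by rewrite -addrA -polyCD [C * s + _]addrC subrK.
Qed.
End OneElementDissipative.
End JB.

(** * The order of the unitization *)

Lemma expr_small (R : realType) (x e : R) : 0 <= x < 1 -> 0 < e ->
  exists n, x ^+ n <= e.
Proof.
move=> /andP[x0 x1] e0.
have bern n : x ^+ n * (1 + n%:R * (1 - x)) <= 1.
  elim: n => [|n IH]; first by rewrite mul0r addr0 expr0 mulr1.
  apply: le_trans IH; rewrite exprS -mulrA -natr1 mulrCA ler_wpM2l ?exprn_ge0 //.
  have := ler0n R n; move: (n%:R : R) => k k0.
  by have := mulr_ge0 (addr_ge0 k0 ler01) (sqr_ge0 (1 - x)); lin_arith.
pose n := (Num.truncn ((e * (1 - x))^-1)).+1; exists n.
have d0 : 0 < e * (1 - x) by rewrite mulr_gt0 // subr_gt0.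
have : (e * (1 - x))^-1 < n%:R by rewrite truncnS_gt.
rewrite -(ltr_pM2r d0) mulVf ?gt_eqF // => lt1.
have := bern n; have := exprn_ge0 n x0; move: (x ^+ n) (n%:R : R) lt1 => p k h p0 b.
rewrite leNgt; apply/negP => ep.
have : 0 < k * (1 - x) by rewrite -(pmulr_rgt0 _ e0); lin_arith.
move=> k0; have : e * (k * (1 - x)) < p * (k * (1 - x)) by rewrite ltr_pM2r.
by rewrite mulrCA; lin_arith.
Qed.

Section Order.
Variables (R : realType) (V : lmodType R) (jp : V -> V -> V) (nu : V -> R).
Hypothesis hV : jb_algebra jp nu.
Local Infix "**" := jp (at level 40, left associativity).
Local Notation hj := (jb_jordan hV).
Local Notation nuD := (jb_normD hV).
Local Notation nuZ := (jb_normZ hV).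
Local Notation nuM := (jb_normM hV).
Local Notation W := (unitization V).
Local Notation up := (ujp jp).
Local Notation one := (uone V : W).
Local Notation hW := (ujp_jordan hj).
Local Notation one_up := (uone_jp hj).
Local Notation ev a := (pev up one ((0, a) : W)).
Local Notation B := (pbnd jp nu).
Local Notation ppos := (ppos jp nu).
Local Notation uact := (uact jp).
Local Notation unorm := (unorm nu).
Local Notation Q := (quadU up).

(** Positivity defined by the action on the whole of [V]: unlike [ppos], it
    does not depend on a generator, so it can be added over elements that do
    not generate an associative algebra together. *)
Definition wpos (h : W) := 0 <= h.1 /\ dissipative jp nu h.

Lemma wpos_ev a p : ppos a p -> wpos (ev a p).
Proof.
move=> pp; split; last exact: ppos_dissipative.
by rewrite (ev1 hV); exact: (ppos_horner pp).
Qed.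
Lemma ppos_wpos a p : wpos (ev a p) -> ppos a p.
Proof. by case; rewrite (ev1 hV) => p0; exact: (dissipative_ppos hV). Qed.

(* [h] as a polynomial in its own second coordinate. *)
Definition upol (h : W) : {poly R} := h.1%:P + 'X.
Lemma ev_upol h : ev h.2 (upol h) = h.
Proof.
rewrite /upol pevD pevC (pevX hW one_up); case: h => l x.
by congr (_, _); rewrite /= ?scaler0 ?add0r // addr0 /GRing.scale /= mulr1.
Qed.
Lemma wposP h : wpos h <-> ppos h.2 (upol h).
Proof. by split => [wh|/wpos_ev]; [apply: ppos_wpos|]; rewrite ev_upol. Qed.

Lemma wposZ k h : 0 <= k -> wpos h -> wpos (k *: h).
Proof.
move=> k0 /wposP ph; rewrite -(ev_upol h) -pevZ; apply: wpos_ev.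
exact: (pposZ hV).
Qed.

Lemma wposD g h : wpos g -> wpos h -> wpos (g + h).
Proof.
move=> [g0 [C [s [C0 s0 Hg]]]] [h0 [D [t [D0 t0 Hh]]]]; split; first exact: addr_ge0.
pose r : R := Num.sqrt 2; have r2 : r ^+ 2 = 2 by rewrite sqr_sqrtr.
have r0 : 0 < r by rewrite sqrtr_gt0.
exists ((C + D) * r ^+ 3), (Num.min s t / r); split.
- by rewrite mulr_ge0 ?addr_ge0 ?exprn_ge0 // ltW.
- by rewrite divr_gt0 // lt_min s0.
move=> u u0; rewrite ler_pdivlMr // le_min => /andP[us ut] x.
have ur0 : 0 < u * r by rewrite mulr_gt0.
have := Hg _ ur0 us x; have := Hh _ ur0 ut x; rewrite exprMn r2 exprMn => e1 e2.
have -> : x - u ^+ 2 *: uact (g + h) x = 2^-1 *: ((x - (u ^+ 2 * 2) *: uact g x)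
   + (x - (u ^+ 2 * 2) *: uact h x)).
  by rewrite (uactDl hV); vlin R.
rewrite nuZ ger0_norm ?invr_ge0 //.
have := nuD (x - (u ^+ 2 * 2) *: uact g x) (x - (u ^+ 2 * 2) *: uact h x).
have := nu_ge0 hV x; have : 0 <= u ^+ 3 * r ^+ 3 by rewrite mulr_ge0 ?exprn_ge0 // ltW.
move: (u ^+ 3) (r ^+ 3) e1 e2 => u3 r3 e1 e2 ur nx.
have := mulr_ge0 (mulr_ge0 C0 ur) nx; have := mulr_ge0 (mulr_ge0 D0 ur) nx; lin_arith.
Qed.

Lemma wpos_square h : wpos (up h h).
Proof.
rewrite -(ev_upol h) -(pevM hW one_up) -expr2; apply: wpos_ev; exact: (ppos_sqr hV).
Qed.

Lemma pbnd_upol h : B h.2 (upol h) (unorm h).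
Proof.
apply: (pbndD hV) (pbndC hV _ _) _; split=> [|q q0].
  by rewrite hornerX normr0 (nu_ge0 hV).
by rewrite (pvalM0 hV) ?hornerX // (pvalX hV) nuM.
Qed.

Lemma wpos_shift h d : unorm h <= d -> wpos (h + d *: one).
Proof.
move=> hd; rewrite -{1}(ev_upol h) -(pevC up one (0, h.2)) -pevD; apply: wpos_ev.
by apply: (ppos_shift hV); apply: (pbnd_le hV) hd; exact: pbnd_upol.
Qed.
Lemma wpos_shiftr h d : unorm h <= d -> wpos (d *: one - h).
Proof. by rewrite addrC => hd; apply: wpos_shift; rewrite (unormN hV). Qed.
Lemma wpos_one c : 0 <= c -> wpos (c *: one).
Proof.
move=> c0; rewrite -[_ *: _]add0r; apply: wpos_shift.
by rewrite /unorm /= normr0 (nu0 hV) addr0.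
Qed.

(** The cone is closed, approached along the unit. *)
Lemma wpos_lim h c : 0 <= c -> (forall e, 0 < e -> e <= 1 -> wpos (h + (c * e) *: one)) -> wpos h.
Proof.
move=> c0 H; apply/wposP/(ppos_lim hV) => d d0; apply: ppos_wpos.
rewrite pevD pevC ev_upol; pose e := Num.min 1 (d / (c + 1)).
have c1 : 0 < c + 1 by lin_arith.
have e0 : 0 < e by rewrite lt_min ltr01 divr_gt0.
have e1 : e <= 1 by rewrite ge_min lexx.
have e2 : e * (c + 1) <= d by rewrite -ler_pdivlMr // ge_min lexx orbT.
have -> : h + d *: one = h + (c * e) *: one + (d - c * e) *: one by vlin R.
by apply: wposD (H e e0 e1) (wpos_one _); nra.
Qed.

Lemma wpos_approx h c : 0 <= c ->
  (forall e, 0 < e -> e <= 1 -> exists2 g, wpos g & unorm (h - g) <= c * e) -> wpos h.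
Proof.
move=> c0 H; apply: (wpos_lim c0) => e e0 e1; have [g pg hg] := H e e0 e1.
by rewrite -(subrK g h) addrAC; apply: wposD pg; exact: wpos_shift.
Qed.

Lemma norm_order y r : 0 <= r -> wpos (r *: one + (0, y)) ->
  wpos (r *: one - (0, y)) -> nu y <= r.
Proof.
move=> r0 p1 p2.
have yE : (0, y) = ev y 'X :> W by rewrite (pevX hW one_up).
have [_] : B y 'X r.
  by apply: (pbnd_order hV) => //; apply: ppos_wpos; rewrite ?(pevD, pevN) pevC -yE.
move=> /(_ 'X); rewrite hornerX -expr2 (nu_pval_sq hV) ?hornerX // (pvalX hV).
move=> /(_ (erefl _)); have := nu_ge0 hV y.
rewrite le_eqVlt => /orP[/eqP <- //|y0]; by rewrite expr2 ler_pM2r.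
Qed.

Lemma unit_split h : h = h.1 *: one + (0, h.2).
Proof.
case: h => l x; congr (_, _); last by rewrite /= scaler0 add0r.
by rewrite /= addr0 /GRing.scale /= mulr1.
Qed.

Lemma unorm_unit h : wpos h -> wpos (one - h) -> unorm h <= 2.
Proof.
move=> ph ph1; have [h0 _] := ph; have [h1 _] := ph1; rewrite /= subr_ge0 in h1.
have : nu h.2 <= 1.
  apply: norm_order => //.
    have -> : 1 *: one + (0, h.2) = h + (1 - h.1) *: one :> W.
      by rewrite {2}(unit_split h); vlin R.
    by apply: wposD ph (wpos_one _); rewrite subr_ge0.
  have -> : 1 *: one - (0, h.2) = (one - h) + h.1 *: one :> W.
    by rewrite {2}(unit_split h); vlin R.
  by apply: wposD ph1 (wpos_one _).
by rewrite /unorm ger0_norm //; lin_arith.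
Qed.

Lemma bilU_le c d x : unorm (bilU up c d x) <= 3 * unorm c * unorm d * unorm x.
Proof.
rewrite /bilU.
have h1 := le_trans (unormM hV c (up d x)) (ler_wpM2l (unorm_ge0 hV c) (unormM hV d x)).
have h2 := le_trans (unormM hV d (up c x)) (ler_wpM2l (unorm_ge0 hV d) (unormM hV c x)).
have h3 := le_trans (unormM hV (up c d) x) (ler_wpM2r (unorm_ge0 hV x) (unormM hV c d)).
have := unormD hV (up c (up d x)) (up d (up c x)).
have := unormD hV (up c (up d x) + up d (up c x)) (- up (up c d) x).
rewrite (unormN hV); lin_arith.
Qed.

Lemma quadU_add c d x : Q (c + d) x = Q c x + bilU up c d x *+ 2 + Q d x.
Proof. rewrite /quadU /bilU; jlin (ujp_jordan (jb_jordan hV)) R. Qed.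
Lemma quadUZ k c x : Q (k *: c) x = k ^+ 2 *: Q c x.
Proof. rewrite /quadU /bilU; jlin (ujp_jordan (jb_jordan hV)) R. Qed.
Lemma quadU_r1 c : Q c one = up c c.
Proof. by rewrite /quadU /bilU !(jordan_one_comm hW one_up) addrK. Qed.
Lemma quadUDr c x y : Q c (x + y) = Q c x + Q c y.
Proof. exact: (bilUDr hW). Qed.
Lemma quadUZr k c x : Q c (k *: x) = k *: Q c x.
Proof. exact: (bilUZr hW). Qed.
Lemma quadUBr c x y : Q c (x - y) = Q c x - Q c y.
Proof. by rewrite -scaleN1r quadUDr quadUZr scaleN1r. Qed.

(** The heart of the positivity of the quadratic representation: near the
    identity it fails to be positive only to second order. This is
    [(theta + x)^2 >= 0] together with [x >= x^2]. *)
Lemma quadU_near_one th x : wpos x -> wpos (one - x) ->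
  wpos (Q (one + th) x + (7 * unorm th ^+ 2) *: one).
Proof.
move=> px px1; have x2 := unorm_unit px px1.
have pxx : wpos (x - up x x).
  rewrite -{1 2 3}(ev_upol x) -(pevM hW one_up) -pevB; apply: wpos_ev.
  have -> : upol x - upol x * upol x = upol x * (1 - upol x) by ring.
  apply: (pposM hV); apply: ppos_wpos; first by rewrite ev_upol.
  by rewrite pevB pev1 ev_upol.
have -> : Q (one + th) x + (7 * unorm th ^+ 2) *: one =
  up (th + x) (th + x) + (x - up x x) + ((Q th x - up th th) + (7 * unorm th ^+ 2) *: one).
  rewrite /quadU /bilU !(jpDl hW) !(jpDr hW) !one_up !(jordan_one_comm hW one_up).
  by rewrite (jpC hW x th) !(jpDl hW) ?one_up; vlin R.
apply: wposD; first by apply: wposD pxx; exact: wpos_square.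
apply: wpos_shift; apply: le_trans (unormD hV _ _) _; rewrite (unormN hV).
have := bilU_le th th x; have := unormM hV th th; rewrite /quadU.
have := unorm_ge0 hV th; nra.
Qed.

(** The defect [eta] of positivity of [U_p], for contractions [p] at distance
    [ka] from the unit. It is shown to vanish by improving a first bound. *)
Definition almost_pos (ka eta : R) := forall a p x, B a p 1 -> B a (1 - p) ka ->
  wpos x -> wpos (one - x) -> wpos (Q (ev a p) x + eta *: one).

Lemma unorm_ev a p M : B a p M -> unorm (ev a p) <= 3 * M.
Proof.
move=> pM; have := pval_le hV pM; case: pM => p0 _; rewrite (evE hV) /unorm /=.
by lin_arith.
Qed.

Lemma almost_pos_near ka : almost_pos ka (63 * ka ^+ 2).
Proof.
move=> a p x p1 pk px px1.
have := quadU_near_one (ev a p - one) px px1; rewrite [one + _]addrC subrK => H.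
have thk : unorm (ev a p - one) <= 3 * ka.
  rewrite (_ : _ - one = ev a (p - 1)); last by rewrite pevB pev1.
  apply: unorm_ev.
  by rewrite -opprB; exact: (pbndN hV).
have -> : Q (ev a p) x + (63 * ka ^+ 2) *: one = Q (ev a p) x
  + (7 * unorm (ev a p - one) ^+ 2) *: one
  + (63 * ka ^+ 2 - 7 * unorm (ev a p - one) ^+ 2) *: one by vlin R.
apply: wposD H (wpos_one _); have := unorm_ge0 hV (ev a p - one); nra.
Qed.

(** [U_(y^2) = U_y U_y]: taking a square root halves the distance to 1, and
    positivity up to [eta] is only lost twice. *)
Lemma almost_pos_sqrt ka kb eta : 0 <= kb <= 1 -> ka <= 2 * kb - kb ^+ 2 ->
  0 <= eta -> almost_pos kb eta -> almost_pos ka (2 * eta + 2 * eta ^+ 2).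
Proof.
move=> kb01 kab eta0 H a p x p1 pk px px1.
apply: (@wpos_approx _ 162) => // e e0 e1.
have [y [y1 yk ye]] := unit_root hV p1 (pbnd_le hV pk kab) kb01 e0.
pose c := ev a y; pose x1 := Q c x.
have QQ z : Q (ev a (y ^+ 2)) z = Q c (Q c z).
  by rewrite -(jpow_ev hV) (quadU_jpow hW one_up).
have y2 : B a (y ^+ 2) 1 by rewrite -[1](expr1n _ 2); exact: (pbndX hV).
have cc : wpos (one - up c c).
  rewrite /c -(pevM hW one_up) -expr2.
  rewrite (_ : one - _ = ev a (1 - y ^+ 2)); last by rewrite pevB pev1.
  by apply: wpos_ev; exact: (@ppos_subr _ _ _ _ hV a _ 1).
have p1x : wpos (x1 + eta *: one) by exact: H.
have p2x : wpos ((1 + eta) *: one - x1).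
  have H2 : wpos (Q c (one - x) + eta *: one).
    by apply: H => //; rewrite opprB addrC subrK.
  have -> : (1 + eta) *: one - x1 = (one - up c c) + (Q c (one - x) + eta *: one).
    by rewrite quadUBr quadU_r1 /x1; vlin R.
  exact: wposD.
have d0 : 0 < 1 + 2 * eta by lin_arith.
pose x2 := (1 + 2 * eta)^-1 *: (x1 + eta *: one).
have H3 : wpos (Q c x2 + eta *: one).
  apply: H => //; first by apply: wposZ p1x; rewrite invr_ge0 ltW.
  have -> : one - x2 = (1 + 2 * eta)^-1 *: ((1 + eta) *: one - x1).
    by rewrite /x2; vlin R; rewrite gt_eqF.
  by apply: wposZ p2x; rewrite invr_ge0 ltW.
have dE : Q (ev a p) x = Q (ev a (y ^+ 2)) x
   + bilU up (ev a (y ^+ 2)) (ev a (p - y ^+ 2)) x *+ 2 + Q (ev a (p - y ^+ 2)) x.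
  by rewrite -quadU_add -pevD addrC subrK.
exists (Q (ev a (y ^+ 2)) x + (2 * eta + 2 * eta ^+ 2) *: one).
  have -> : Q (ev a (y ^+ 2)) x + (2 * eta + 2 * eta ^+ 2) *: one =
    (1 + 2 * eta) *: (Q c x2 + eta *: one) + eta *: (one - up c c).
    by rewrite QQ /x2 quadUZr quadUDr quadUZr quadU_r1 -/x1; vlin R; rewrite gt_eqF.
  by apply: wposD; apply: wposZ; rewrite // ltW.
rewrite dE; set D := bilU _ _ _ _; set G := Q (ev a (p - _)) x.
have -> : Q (ev a (y ^+ 2)) x + D *+ 2 + G + (2 * eta + 2 * eta ^+ 2) *: one -
  (Q (ev a (y ^+ 2)) x + (2 * eta + 2 * eta ^+ 2) *: one) = 2 *: D + G by vlin R.
apply: le_trans (unormD hV _ _) _; rewrite (unormZ hV) normr_nat.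
have x2' := unorm_unit px px1.
have de : unorm (ev a (p - y ^+ 2)) <= 3 * e.
  by apply: unorm_ev; rewrite -opprB; exact: (pbndN hV).
have ye3 := unorm_ev y2; rewrite mulr1 in ye3.
have d1 := unorm_ge0 hV (ev a (p - y ^+ 2)); have d2 := unorm_ge0 hV (ev a (y ^+ 2)).
have d3 := unorm_ge0 hV x.
have D1 : unorm D <= 54 * e.
  apply: le_trans (bilU_le _ _ _) _.
  have g1 := ler_pM d2 d1 ye3 de.
  by have := ler_pM (mulr_ge0 d2 d1) d3 g1 x2'; lin_arith.
have G1 : unorm G <= 54 * e.
  apply: le_trans (bilU_le _ _ _) _.
  have g1 := ler_pM d1 d1 de de.
  have g2 := ler_pM (mulr_ge0 d1 d1) d3 g1 x2'.
  have e2 : e * e <= e by rewrite ger_pMr.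
  by lin_arith.
lin_arith.
Qed.

Lemma almost_pos_le ka eta eta' : eta <= eta' -> almost_pos ka eta -> almost_pos ka eta'.
Proof.
move=> le H a p x p1 pk px px1.
have -> : Q (ev a p) x + eta' *: one = Q (ev a p) x + eta *: one
  + (eta' - eta) *: one by vlin R.
by apply: wposD (H _ _ _ p1 pk px px1) (wpos_one _); rewrite subr_ge0.
Qed.

(** Starting from the quadratic bound [63 ka^2], each square root replaces
    [ka] by [0.6 ka] and doubles the defect, a gain by the factor
    [2 * 0.36 < 0.9] up to the square of the defect; iterate. *)
Lemma almost_pos0_near ka : 0 <= ka <= 16^-1 -> almost_pos ka 0.
Proof.
move=> ka16.
have H n k : 0 <= k <= 16^-1 -> almost_pos k (63 * (9 / 10) ^+ n * k ^+ 2).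
  elim: n k => [|n IH] k /andP[k0 k1].
    by rewrite expr0 mulr1; exact: almost_pos_near.
  set r := (9 / 10) ^+ n in IH *.
  have /andP[r0 r1] : 0 <= r <= 1.
    by rewrite exprn_ge0 ?exprn_ile1 //; lin_arith.
  have k2 : k ^+ 2 <= 256^-1 by nra.
  have k20 := sqr_ge0 k.
  pose e := 63 * r * (6 / 10 * k) ^+ 2.
  have e0 : 0 <= e by rewrite mulr_ge0 ?sqr_ge0 // mulr_ge0.
  have e1 : e <= 4^-1.
    have : r * k ^+ 2 <= 256^-1 by nra.
    rewrite /e exprMn; lin_arith.
  have := @almost_pos_sqrt k (6 / 10 * k) e.
  have E : 63 * (9 / 10) ^+ n.+1 * k ^+ 2 = 5 / 2 * e.
    by rewrite /e exprSr -/r; field.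
  rewrite E => /(_ _ _ e0 (IH _ _)) G; apply: almost_pos_le (G _ _ _); last 3 first.
  - by apply/andP; split; lin_arith.
  - nra.
  - by apply/andP; split; lin_arith.
  nra.
move=> a p x p1 pk px px1; rewrite scale0r addr0.
apply: (@wpos_lim _ 1) => // e e0 e1; rewrite mul1r.
have [|n ne] := @expr_small _ (9 / 10 : R) e _ e0; first by apply/andP; split; lin_arith.
have := almost_pos_le _ (H n ka ka16) p1 pk px px1; apply.
have /andP[k0 k1] := ka16.
have r0 : 0 <= (9 / 10 : R) ^+ n by rewrite exprn_ge0 //; lin_arith.
have : ka ^+ 2 <= 256^-1 by nra.
have := sqr_ge0 ka; nra.
Qed.

(** Finitely many square roots reach the region near the unit. *)
Lemma almost_pos0 ka : 0 <= ka < 1 -> almost_pos ka 0.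
Proof.
move=> /andP[k0 k1].
have H n k : 0 <= k <= 1 -> (15 / 16) ^+ (2 ^ n) <= 1 - k -> almost_pos k 0.
  elim: n k => [|n IH] k /andP[kk0 kk1].
    rewrite expn0 expr1 => hk; apply: almost_pos0_near; apply/andP; split=> //; lin_arith.
  rewrite expnS mulnC exprM => hk.
  pose s := Num.sqrt (1 - k); have s2 : s ^+ 2 = 1 - k by rewrite sqr_sqrtr // subr_ge0.
  have s0 : 0 <= s by rewrite sqrtr_ge0.
  have s1 : s <= 1 by rewrite -(ler_sqr (x := s)) ?nnegrE // s2; lin_arith.
  have g : almost_pos (1 - s) 0.
    apply: IH; first by apply/andP; split; lin_arith.
    rewrite opprB addrC subrK -ler_sqr ?nnegrE ?exprn_ge0 ?s2 //; lin_arith.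
  have := @almost_pos_sqrt k (1 - s) 0; rewrite expr0n !mulr0 addr0; apply=> //.
    by apply/andP; split; lin_arith.
  lin_arith.
have h1 : 0 <= (15 / 16 : R) < 1 by apply/andP; split; lin_arith.
have h2 : 0 < 1 - ka by lin_arith.
have [n ne] := expr_small h1 h2.
apply: (H n); first by apply/andP; split=> //; exact: ltW.
apply: le_trans ne; apply: ler_wiXn2l; [lin_arith|lin_arith|].
exact: ltnW (ltn_expl n _).
Qed.

Lemma wpos_bounded x : exists2 d, 0 < d & wpos (d *: one - x).
Proof.
exists (unorm x + 1); first by have := unorm_ge0 hV x; lin_arith.
by apply: wpos_shiftr; lin_arith.
Qed.

Lemma quadU_pos_near a p ka x : B a p 1 -> B a (1 - p) ka -> ka < 1 -> wpos x ->
  wpos (Q (ev a p) x).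
Proof.
move=> p1 pk ka1 px; have [d d0 dx] := wpos_bounded x.
have k01 : 0 <= ka < 1 by rewrite (pbnd_ge0 pk).
have p1x : wpos (d^-1 *: x) by apply: wposZ px; rewrite invr_ge0 ltW.
have p2x : wpos (one - d^-1 *: x).
  have -> : one - d^-1 *: x = d^-1 *: (d *: one - x) by vlin R; rewrite gt_eqF.
  by apply: wposZ dx; rewrite invr_ge0 ltW.
have := almost_pos0 k01 p1 pk p1x p2x; rewrite scale0r addr0 quadUZr.
by move=> /(wposZ (ltW d0)); rewrite scalerA mulfV ?gt_eqF // scale1r.
Qed.

(** Adding a small multiple of the unit and normalizing brings a positive
    element within distance less than 1 of the unit. *)
Lemma quadU_pos a p x : ppos a p -> wpos x -> wpos (Q (ev a p) x).
Proof.
move=> pp px; have [M M0 pM] := pbnd_ex hV a p.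
have Mp := ppos_bnd hV pp pM.
apply: (@wpos_approx _ (6 * unorm (ev a p) * unorm x + 3 * unorm x)) => [|e e0 e1].
  have := mulr_ge0 (unorm_ge0 hV (ev a p)) (unorm_ge0 hV x).
  by have := unorm_ge0 hV x; lin_arith.
have Me : 0 < M + e by lin_arith.
pose q := (M + e)^-1 *: (p + e%:P).
have q1 : B a q 1.
  have := pbndZ hV (M + e)^-1 (pbndD hV pM (pbndC hV a e)).
  by rewrite !gtr0_norm ?invr_gt0 // mulVf ?gt_eqF.
have qk : B a (1 - q) (M / (M + e)).
  have -> : 1 - q = (M + e)^-1 *: (M%:P - p).
    rewrite /q -[M%:P]mulr1 -[e%:P]mulr1 !mul_polyC; vlin R; by rewrite gt_eqF.
  by have := pbndZ hV (M + e)^-1 Mp; rewrite gtr0_norm ?invr_gt0 // mulrC.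
have H : wpos (Q (ev a q) x).
  by apply: (quadU_pos_near q1 qk) => //; rewrite ltr_pdivrMr // mul1r; lin_arith.
exists (Q (ev a (p + e%:P)) x).
  have -> : p + e%:P = (M + e) *: q by rewrite scalerA mulfV ?gt_eqF // scale1r.
  by rewrite pevZ quadUZ; apply: wposZ H; rewrite sqr_ge0.
have ue : unorm (ev a e%:P) = e.
  by rewrite pevC /unorm /= scaler0 (nu0 hV) addr0 /GRing.scale /= mulr1 gtr0_norm.
rewrite pevD quadU_add; set D := bilU _ _ _ _; set G := Q (ev a e%:P) x.
have -> : Q (ev a p) x - (Q (ev a p) x + D *+ 2 + G) = - (2 *: D + G) by vlin R.
rewrite (unormN hV); apply: le_trans (unormD hV _ _) _; rewrite (unormZ hV) normr_nat.
have D1 : unorm D <= 3 * unorm (ev a p) * e * unorm x.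
  by have := bilU_le (ev a p) (ev a e%:P) x; rewrite ue.
have G1 : unorm G <= 3 * e * e * unorm x
  by have := bilU_le (ev a e%:P) (ev a e%:P) x; rewrite ue.
have e2 : e * e * unorm x <= e * unorm x.
  by rewrite -mulrA ler_piMl // mulr_ge0 ?(unorm_ge0 hV) // ltW.
lin_arith.
Qed.

End Order.

(** * Inverses and the unit *)

Section Unit.
Variables (R : realType) (V : lmodType R) (jp : V -> V -> V) (nu : V -> R).
Hypothesis hV : jb_algebra jp nu.
Local Infix "**" := jp (at level 40, left associativity).
Local Notation hj := (jb_jordan hV).
Local Notation nuD := (jb_normD hV).
Local Notation nuZ := (jb_normZ hV).
Local Notation nuM := (jb_normM hV).
Local Notation W := (unitization V).
Local Notation up := (ujp jp).
Local Notation one := (uone V : W).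
Local Notation hW := (ujp_jordan hj).
Local Notation one_up := (uone_jp hj).
Local Notation inW x := ((0, x) : W).
Local Notation ev a := (pev up one (inW a)).
Local Notation B := (pbnd jp nu).
Local Notation ppos := (ppos jp nu).
Local Notation unorm := (unorm nu).
Local Notation Q := (quadU up).
Local Notation wpos := (wpos jp nu).

Lemma inWD (u v : V) : inW (u + v) = inW u + inW v.
Proof. by congr (_, _); rewrite /= addr0. Qed.
Lemma inWN (u : V) : inW (- u) = - inW u.
Proof. by congr (_, _); rewrite /= oppr0. Qed.
Lemma inWZ c (u : V) : inW (c *: u) = c *: inW u.
Proof. by congr (_, _); rewrite /GRing.scale /= mulr0. Qed.
Lemma up_in u v : up (inW u) (inW v) = inW (u ** v).
Proof. by rewrite /ujp /= mulr0 !scale0r !add0r. Qed.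

(** Dissipativity of [k] makes [1 + k] bounded below by 1, hence injective
    with a contractive inverse. *)
Lemma positive_expands k z : wpos (inW k) -> nu z <= nu (z + k ** z).
Proof.
case=> _ [C [s0 [C0 s00 H]]]; set w := z + k ** z.
have nz := nu_ge0 hV z.
apply: (@ler_small _ _ _ (C * s0 * nu z)); first by rewrite !mulr_ge0 // ltW.
move=> e e0 e1; have s1 : 0 < e * s0 by rewrite mulr_gt0.
have s2 : e * s0 <= s0 by rewrite ger_pMl.
have := H _ s1 s2 z.
rewrite (_ : C * s0 * nu z * e = C * (e * s0) * nu z); last by ring.
move: (e * s0) s1 => s s1.
have -> : z - s ^+ 2 *: uact jp (inW k) z = (1 + s ^+ 2) *: z - s ^+ 2 *: w.
  by rewrite /uact /= scale0r add0r /w; vlin R.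
have := nuD ((1 + s ^+ 2) *: z - s ^+ 2 *: w) (s ^+ 2 *: w); rewrite subrK !nuZ.
have s20 : 0 < s ^+ 2 by rewrite exprn_gt0.
rewrite !ger0_norm; [|lin_arith|lin_arith] => h1 h2.
have h3 : s ^+ 2 * nu z <= s ^+ 2 * (nu w + C * s * nu z).
  have : (1 + s ^+ 2) * nu z <= (1 + C * s ^+ 3) * nu z + s ^+ 2 * nu w by lin_arith.
  by rewrite (exprS s 2); lin_arith.
by rewrite -(ler_pM2l s20).
Qed.

Lemma unorm_small h c : 0 <= c -> (forall e, 0 < e -> e <= 1 -> unorm h <= c * e) -> h = 0.
Proof.
move=> c0 H; have : unorm h <= 0.
  by apply: (ler_small c0) => e e0 e1; rewrite add0r; exact: H.
rewrite /unorm => h0; have n1 := normr_ge0 h.1; have n2 := nu_ge0 hV h.2.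
rewrite [h]surjective_pairing; congr (_, _).
  by apply/eqP; rewrite -normr_eq0; apply/eqP; lin_arith.
by apply: (jb_norm_eq0 hV); lin_arith.
Qed.

(** [y = (1 + k)^-1], together with the properties that are inherited from
    its polynomial approximations in [k]. *)
Definition inverse k y := [/\ y.1 = 1, up (one + inW k) y = one,
  wpos y /\ wpos (one - y), forall x, wpos x -> wpos (Q y x) &
  (forall D, up (one + inW k) (Q y D) = up y D) /\
  up (up (inW k) (inW k)) y = up (inW k) (up (inW k) y)].

Section Inverse.
Variable k : V.
Hypothesis pk : wpos (inW k).

(* Partial sums of the Neumann series, [1 + X = (M + 1) (1 - r)] with
   [r = (M - X) / (M + 1)] a strict contraction since [0 <= X <= M]. *)
Lemma inverse_approx : exists2 l, True & forall e, 0 < e -> exists q : {poly R},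
  [/\ unorm (ev k q - (1, l)) <= e, B k (1 - (1 + 'X) * q) e, ppos k q,
     ppos k (1 - q) & B k q 1].
Proof.
have kX : ev k 'X = inW k by rewrite (pevX hW one_up).
have pX : ppos k 'X by apply: (ppos_wpos hV); rewrite kX.
have [M M0 XM] := pbnd_ex hV k 'X.
have M1 : 0 < M + 1 by lin_arith.
have MX := ppos_bnd hV pX XM.
pose X : {poly R} := 'X; pose r := (M + 1)^-1 *: (M%:P - X); pose rho := M / (M + 1).
have rho01 : 0 <= rho < 1.
  by rewrite divr_ge0 ?ltW //= ltr_pdivrMr // mul1r; lin_arith.
have rB : B k r rho.
  by have := pbndZ hV (M + 1)^-1 MX; rewrite gtr0_norm ?invr_gt0 // mulrC.
have pr : ppos k r.
  by apply: (pposZ hV); [rewrite invr_ge0 ltW|exact: (ppos_subr hV)].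
pose yy n : {poly R} := (M + 1)^-1 *: \sum_(i < n) r ^+ i.
have key n : (1 + 'X) * yy n = 1 - r ^+ n.
  have -> : 1 + 'X = (M + 1) *: (1 - r); first rewrite -/X.
    by rewrite /r -[M%:P]mulr1 mul_polyC; vlin R; rewrite gt_eqF.
  rewrite poly_mulZr poly_mulZl scalerA mulVf ?gt_eqF // scale1r.
  by rewrite -[1 - r]opprB mulNr -subrX1 opprB.
have rX n : B k (r ^+ n) (rho ^+ n) by exact: (pbndX hV).
have yp n : ppos k (yy n).
  apply: (pposZ hV); first by rewrite invr_ge0 ltW.
  elim/big_ind: _ => [|p q pp pq|i _]; last exact: (pposX hV).
    by have := @pposC _ _ _ _ hV k 0 (lexx 0); rewrite polyC0.
  exact: (pposD hV).
have y1p n : ppos k (1 - yy n).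
  have -> : 1 - yy n = 'X * yy n + r ^+ n.
    by have := key n; rewrite mulrDl mul1r => E; rewrite -[r ^+ n](subKr 1) -E; ring.
  by apply: (pposD hV); [exact: (pposM hV)|exact: (pposX hV)].
have yB n : B k (yy n) 1 by apply: (pbnd_pos hV).
have small e : 0 < e -> exists N, forall n, (N <= n)%N -> rho ^+ n <= e.
  move=> e0; have [N NE] := expr_small rho01 e0; exists N => n Nn.
  apply: le_trans NE; have /andP[? ?] := rho01; apply: ler_wiXn2l => //; exact: ltW.
have cauchy m n : (n <= m)%N -> nu (pval jp k (yy m) - pval jp k (yy n)) <= 2 * rho ^+ n.
  move=> nm; rewrite -(pvalB jp k); apply: (pval_le hV).
  have -> : yy m - yy n = r ^+ n * yy (m - n)%N.
    rewrite /yy poly_mulZr -scalerBr; congr (_ *: _).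
    rewrite -(subnKC nm); set d := (m - n)%N; rewrite addKn big_split_ord /= addrAC subrr add0r mulr_sumr.
    by apply: eq_bigr => i _; rewrite -exprD.
  by have := pbndM (rX n) (yB (m - n)%N); rewrite mulr1.
have [e e0|l Hl] := jb_complete hV (u := fun n => pval jp k (yy n)).
  have [N HN] := small (e / 2) (divr_gt0 e0 (ltr0n R 2)); exists N => m n Nm Nn.
  case/orP: (leq_total m n) => mn; first rewrite (nuBC hV).
    by apply: le_trans (cauchy _ _ mn) _; have := HN m Nm; lin_arith.
  by apply: le_trans (cauchy _ _ mn) _; have := HN n Nn; lin_arith.
exists l => // e e0; have e2 : 0 < e / 2 by rewrite divr_gt0.
have [N1 H1] := small (e / 2) e2; have [N2 H2] := Hl (e / 2) e2.
pose n := maxn N1 N2; exists (yy n); split=> //.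
  rewrite (evE hV) /unorm /=.
  have h2 := H2 n (leq_maxr _ _); have h1 := H1 n (leq_maxl _ _).
  have [r0 _] := rX n; have := f_equal (fun p => p.[0]) (key n).
  rewrite hornerM !hornerD hornerX hornerN !hornerC addr0 mul1r => E.
  have -> : (yy n).[0] - 1 = - (r ^+ n).[0] by rewrite E; ring.
  by rewrite normrN; lin_arith.
rewrite key subKr; apply: (pbnd_le hV (rX n)).
by apply: le_trans (H1 n (leq_maxl _ _)) _; lin_arith.
Qed.

Lemma inverse_ex : exists y, inverse k y.
Proof.
have [l _ app] := inverse_approx; pose y : W := (1, l); exists y.
pose K := unorm (one + inW k).
have K0 : 0 <= K by exact: (unorm_ge0 hV).
have kX : ev k 'X = inW k by rewrite (pevX hW one_up).
have oX : ev k (1 + 'X) = one + inW k by rewrite pevD pev1 kX.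
have qle q : B k q 1 -> unorm (ev k q) <= 3.
  by move=> /(unorm_ev hV); rewrite mulr1.
(* Replacing [y] by a polynomial in a quadratic operator. *)
have Qd q x e : B k q 1 -> unorm (ev k q - y) <= e -> e <= 1 ->
    unorm (Q y x - Q (ev k q) x) <= 21 * e * unorm x.
  move=> q1 qe e1; have de : unorm (y - ev k q) <= e by rewrite -(unormN hV) opprB.
  have x0 := unorm_ge0 hV x; have d0 := unorm_ge0 hV (y - ev k q).
  have -> : Q y x = Q (ev k q) x + bilU up (ev k q) (y - ev k q) x *+ 2 + Q (y - ev k q) x.
    by rewrite -(quadU_add hV) addrC subrK.
  set D := bilU _ _ _ _; set G := Q (y - _) x.
  have -> : Q (ev k q) x + D *+ 2 + G - Q (ev k q) x = 2 *: D + G by vlin R.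
  apply: le_trans (unormD hV _ _) _; rewrite (unormZ hV) normr_nat.
  have D1 : unorm D <= 9 * e * unorm x.
    apply: le_trans (bilU_le hV _ _ _) _.
    have := ler_pM (unorm_ge0 hV (ev k q)) d0 (qle q q1) de.
    by move=> /(ler_wpM2r x0); lin_arith.
  have G1 : unorm G <= 3 * e * unorm x.
    apply: le_trans (bilU_le hV _ _ _) _.
    have := ler_pM d0 d0 de (le_trans de e1).
    by move=> /(ler_wpM2r x0); lin_arith.
  lin_arith.
split=> //.
- apply/eqP; rewrite -subr_eq0; apply/eqP; apply: (@unorm_small _ (K + 3)).
    by have := K0; lin_arith.
  move=> e e0 e1; have [q [qe sB _ _ _]] := app e e0.
  have -> : up (one + inW k) y - one = up (one + inW k) (y - ev k q) - ev k (1 - (1 + 'X) * q).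
    by rewrite (jpBr hW) pevB pev1 (pevM hW one_up) oX; zlin.
  apply: le_trans (unormD hV _ _) _; rewrite (unormN hV).
  have h1 := unorm_ev hV sB.
  have h2 := unormM hV (one + inW k) (y - ev k q).
  have h3 : K * unorm (y - ev k q) <= K * e.
    by rewrite ler_wpM2l // -(unormN hV) opprB.
  by rewrite -/K in h2; lin_arith.
- split; apply: (@wpos_approx _ _ _ _ hV _ 1) => // e e0 e1; rewrite mul1r.
    have [q [qe _ pq _ _]] := app e e0; exists (ev k q); first exact: (wpos_ev hV).
    by rewrite -(unormN hV) opprB.
  have [q [qe _ _ pq _]] := app e e0; exists (ev k (1 - q)); first exact: (wpos_ev hV).
  rewrite pevB pev1 (_ : _ - _ = ev k q - y) //; zlin.
- move=> x px; apply: (@wpos_approx _ _ _ _ hV _ (21 * unorm x)).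
    by rewrite mulr_ge0 // (unorm_ge0 hV).
  move=> e e0 e1; have [q [qe _ pq _ q1]] := app e e0; exists (Q (ev k q) x).
    exact: (quadU_pos hV).
  by have := Qd q x e q1 qe e1; lin_arith.
split=> [D|].
  have D0 := unorm_ge0 hV D.
  apply/eqP; rewrite -subr_eq0; apply/eqP.
  apply: (@unorm_small _ (21 * K * unorm D + 28 * unorm D)).
    by have := mulr_ge0 K0 D0; lin_arith.
  move=> e e0 e1; have [q [qe sB _ _ q1]] := app e e0.
  have E : up (one + inW k) (Q (ev k q) D) = up (ev k q) D
      - bilU up (ev k (1 - (1 + 'X) * q)) (ev k q) D.
    have oP : ev k ((1 + 'X) * q) = one + (-1) *: ev k (1 - (1 + 'X) * q).
      by rewrite scaleN1r pevB pev1 subKr.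
    rewrite -oX (pev_quadU hW one_up) oP (bilUDl hW) (bilUZl hW) scaleN1r.
    by congr (_ - _); rewrite /bilU !one_up (addrC (up _ _)) addrK.
  have -> : up (one + inW k) (Q y D) - up y D = up (one + inW k) (Q y D - Q (ev k q) D)
     - bilU up (ev k (1 - (1 + 'X) * q)) (ev k q) D + up (ev k q - y) D.
    by rewrite [X in _ = X - _ + _](jpBr hW) (jpBl hW (ev k q)) E; zlin.
  apply: le_trans (unormD hV _ _) _.
  have h0 := unormD hV (up (one + inW k) (Q y D - Q (ev k q) D))
     (- bilU up (ev k (1 - (1 + 'X) * q)) (ev k q) D); rewrite (unormN hV) in h0.
  have h1 := le_trans (unormM hV (one + inW k) (Q y D - Q (ev k q) D))
     (ler_wpM2l K0 (Qd q D e q1 qe e1)).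
  have h2 := le_trans (unormM hV (ev k q - y) D) (ler_wpM2r D0 qe).
  have h3 : unorm (bilU up (ev k (1 - (1 + 'X) * q)) (ev k q) D) <= 27 * e * unorm D.
    apply: le_trans (bilU_le hV _ _ _) _.
    have := ler_pM (unorm_ge0 hV _) (unorm_ge0 hV (ev k q)) (unorm_ev hV sB) (qle q q1).
    by move=> /(ler_wpM2r D0); lin_arith.
  lin_arith.
have k0 := unorm_ge0 hV (inW k).
apply/eqP; rewrite -subr_eq0; apply/eqP.
apply: (@unorm_small _ (2 * unorm (inW k) ^+ 2)); first by rewrite mulr_ge0 ?sqr_ge0.
move=> e e0 e1; have [q [qe _ _ _ _]] := app e e0.
have E : up (up (inW k) (inW k)) (ev k q) = up (inW k) (up (inW k) (ev k q)).
  suff H g : g = ev k 'X -> up (up g g) (ev k q) = up g (up g (ev k q)).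
    exact: H (esym kX).
  by move=> ->; rewrite -!(pevM hW one_up) mulrA.
have -> : up (up (inW k) (inW k)) y - up (inW k) (up (inW k) y) =
   up (inW k) (up (inW k) (ev k q - y)) - up (up (inW k) (inW k)) (ev k q - y).
  rewrite (jpBr hW (ev k q) y (inW k)) (jpBr hW (up _ _) (up _ _) (inW k)).
  by rewrite (jpBr hW (ev k q) y (up (inW k) (inW k))) E; zlin.
apply: le_trans (unormD hV _ _) _; rewrite (unormN hV).
have h1 := le_trans (unormM hV _ _) (ler_wpM2l k0 (unormM hV (inW k) (ev k q - y))).
have h2 := le_trans (unormM hV (up (inW k) (inW k)) (ev k q - y))
   (ler_wpM2r (unorm_ge0 hV _) (unormM hV (inW k) (inW k))).
have h3 : unorm (inW k) ^+ 2 * unorm (ev k q - y) <= unorm (inW k) ^+ 2 * e.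
  by rewrite ler_wpM2l ?sqr_ge0.
by rewrite expr2 in h3 *; lin_arith.
Qed.
End Inverse.

(** The derivative of [k |-> (1 + k)^-1] in direction [d] is [- Q_y d], with a
    quadratic error: multiplied by [1 + k + t d] the error is
    [- t^2 d (Q_y d)]. *)
Lemma inverse_step k d t y y' : 0 <= t -> wpos (inW (k + t *: d)) ->
  inverse k y -> inverse (k + t *: d) y' ->
  unorm (y - y' - t *: Q y (inW d)) <= 12 * t ^+ 2 * nu d ^+ 2.
Proof.
move=> t0 pk [y1 inv [py py1] _ [Qy _]] [y1' inv' _ _ _].
pose G := Q y (inW d); have G1 : G.1 = 0.
  by rewrite /G /quadU /bilU /ujp /= !(mulr0, mul0r, addr0, subr0).
set z := _ - _ *: _; have z1 : z.1 = 0.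
  by change (y.1 - y'.1 - t * G.1 = 0); rewrite y1 y1' G1 mulr0 !subrr.
have zE : z = inW z.2 by rewrite [z in LHS]surjective_pairing z1.
have E : up (one + inW (k + t *: d)) z = (- t ^+ 2) *: up (inW d) G.
  have kE : inW (k + t *: d) = inW k + t *: inW d by rewrite inWD inWZ.
  rewrite /z -/G (jpBr hW (y - y') (t *: G)) (jpBr hW y y') inv' kE.
  rewrite (jpZr hW _ G) addrA !(jpDl hW (one + inW k) (t *: inW d)) inv Qy !(jpZl hW).
  by rewrite (jpC hW y); vlin R.
have D2 : inW (z.2 + (k + t *: d) ** z.2) = (- t ^+ 2) *: up (inW d) G.
  rewrite -E; move: (z.2) zE => w ->; rewrite /ujp /=.
  congr (_, _); first by rewrite !(addr0, mulr0).
  by rewrite addr0 scale1r scale0r addr0 add0r.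
have := positive_expands z.2 pk; have -> : unorm z = nu z.2.
  by rewrite /unorm z1 normr0 add0r.
move=> /le_trans; apply; have -> u : nu u = unorm (inW u).
  by rewrite /unorm /= normr0 add0r.
rewrite D2 (unormZ hV) normrN ger0_norm ?sqr_ge0 //.
have h1 := unormM hV (inW d) G; have h2 := bilU_le hV y y (inW d).
have y2 := unorm_unit hV py py1; rewrite -/(Q y _) -/G in h2.
have E2 : unorm (inW d) = nu d by rewrite /unorm /= normr0 add0r.
rewrite E2 in h1 h2; have d0 := nu_ge0 hV d; have t2 := sqr_ge0 t.
have y0 := unorm_ge0 hV y.
have h3 : unorm y * unorm y <= 2 * 2 by exact: ler_pM.
have h4 : unorm G <= 12 * nu d by have := ler_wpM2r d0 h3; lin_arith.
have h5 := le_trans h1 (ler_wpM2l d0 h4); have := ler_wpM2l t2 h5; lin_arith.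
Qed.

(** The derivative is minus a positive element by positivity of [U_y]; sum
    [n] Euler steps of length [1/n], whose total error has order [1/n]. *)
Lemma inverse_antitone k d y y' : wpos (inW k) -> wpos (inW d) ->
  inverse k y -> inverse (k + d) y' -> wpos (y - y').
Proof.
move=> pk pd iy iy'; have d0 := nu_ge0 hV d.
have pkd s : 0 <= s -> wpos (inW (k + s *: d)).
  by move=> s0; rewrite inWD inWZ; exact: (wposD hV pk (wposZ hV s0 pd)).
pose c := 12 * nu d ^+ 2; have c0 : 0 <= c by rewrite mulr_ge0 ?sqr_ge0.
have step s t g h : 0 <= s -> 0 <= t -> inverse (k + s *: d) g ->
    inverse (k + (s + t) *: d) h -> wpos (g - h + (c * t ^+ 2) *: one).
  move=> s0 t0 ig ih; have E : k + (s + t) *: d = (k + s *: d) + t *: d by vlin R.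
  have := pkd _ (addr_ge0 s0 t0); rewrite E in ih * => p.
  have /(wpos_shift hV) := inverse_step t0 p ig ih.
  have [_ _ _ pQ _] := ig => H.
  have -> : g - h + (c * t ^+ 2) *: one = g - h - t *: Q g (inW d)
    + (12 * t ^+ 2 * nu d ^+ 2) *: one + t *: Q g (inW d).
    by rewrite /c; vlin R.
  by apply: (wposD hV H); apply: (wposZ hV t0); exact: pQ.
have euler t n h : 0 <= t -> inverse (k + (n%:R * t) *: d) h ->
    wpos (y - h + (c * (n%:R * t ^+ 2)) *: one).
  move=> t0; elim: n h => [|n IH] h ih.
    have := @step 0 0 y h (lexx 0) (lexx 0); rewrite expr0n mulr0 mul0r mulr0.
    by rewrite addr0 scale0r addr0; apply=> //; move: ih; rewrite mul0r scale0r addr0.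
  have nt : 0 <= n%:R * t by rewrite mulr_ge0.
  have [g ig] := inverse_ex (pkd _ nt).
  have E : n.+1%:R * t = n%:R * t + t by rewrite -natr1; ring.
  rewrite E in ih; have := wposD hV (IH g ig) (step _ _ _ _ nt t0 ig ih).
  by congr wpos; rewrite -natr1; vlin R.
apply: (wpos_lim hV c0) => e e0 e1.
pose n := (Num.truncn e^-1).+1; pose N : R := n%:R.
have N0 : 0 < N by rewrite ltr0n.
have ne : N^-1 <= e.
  by rewrite -[e]invrK lef_pV2 ?posrE ?invr_gt0 //; apply: ltW; exact: truncnS_gt.
have := @euler N^-1 n y'; rewrite -/N mulfV ?gt_eqF // scale1r invr_ge0 ltW // => H.
have := wposD hV (H isT iy') (wpos_one hV (c := c * (e - N^-1)) _).
rewrite mulr_ge0 ?subr_ge0 // => /(_ isT); congr wpos.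
by vlin R; rewrite gt_eqF.
Qed.

(** The balls of radius 1 around [2 (1 - (1 + k)^-1)] have a common point: for
    finitely many [k], with sum [K], it is [1 - (1 + K)^-1], by monotonicity.
    A common point [x] of all of them satisfies
    [0 <= 1 - x <= 2 (1 + k)^-1] for every positive [k], in particular for
    all multiples of a given one. *)
Lemma approximate_unit_limit : exists x : V, wpos (one - inW x) /\
  forall k y, wpos (inW k) -> inverse k y -> wpos (2 *: y - (one - inW x)).
Proof.
pose P (k : V) := wpos (inW k).
have /choice[Y iY] : forall k, exists y : W, P k -> inverse k y.
  move=> k; case: (pselect (P k)) => [/inverse_ex[y iy]|nP]; first by exists y.
  by exists 0.
have uE k : P k -> one - Y k = inW (- (Y k).2).
  by move=> /iY[y1 _ _ _ _]; rewrite [Y k]surjective_pairing y1; congr (_, _);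
     rewrite /= ?subrr ?sub0r.
have P0 : P 0 by have := wpos_one hV (lexx 0); rewrite scale0r.
have [s sP|x xP] := @jb_balls _ _ _ _ hV P (fun k => 2 *: - (Y k).2).
  pose K := \sum_(k <- s) k.
  have PK (r : seq V) : {subset r <= s} -> P (\sum_(k <- r) k).
    elim: r => [|k r IH] sub; first by rewrite big_nil.
    rewrite big_cons /P inWD; apply: (wposD hV).
      by apply: sP; apply: sub; rewrite mem_head.
    by apply: IH => z zr; apply: sub; rewrite in_cons zr orbT.
  exists (- (Y K).2) => k ks; have Pk := sP k ks; have PKK : P K by exact: PK.
  pose d := \sum_(j <- rem k s) j.
  have KE : K = k + d by rewrite /K (perm_big _ (perm_to_rem ks)) big_cons.
  have Pd : P d by apply: PK => z; exact: mem_rem.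
  have iK := iY K PKK; have ik := iY k Pk; rewrite {1}KE in iK.
  have anti := inverse_antitone Pk Pd ik iK.
  have [_ _ [yk ok] _ _] := ik; have [_ _ [yK oK] _ _] := iK.
  have E : inW (- (Y K).2 - 2 *: - (Y k).2) = (one - Y K) - 2 *: (one - Y k).
    by rewrite -scaleNr inWD inWZ !uE // scaleNr.
  apply: (norm_order hV) => //; rewrite E.
    have -> : 1 *: one + (one - Y K - 2 *: (one - Y k)) = (Y k - Y K) + Y k by vlin R.
    exact: (wposD hV).
  have -> : 1 *: one - (one - Y K - 2 *: (one - Y k)) = 2 *: (one - Y k) + Y K by vlin R.
  by apply: (wposD hV) => //; apply: (wposZ hV).
exists x; split.
  have : nu x <= 1.
    have [y1 inv _ _ _] := iY 0 P0; rewrite addr0 one_up in inv.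
    by have := xP 0 P0; rewrite inv /= oppr0 scaler0 subr0.
  move=> x1; have := wpos_shiftr hV (h := inW x) (d := 1); rewrite scale1r; apply.
  by rewrite /unorm /= normr0 add0r.
move=> k y Pk iy; have ik := iY k Pk.
have yE : y = Y k.
  have [y1 inv [_ _] _ _] := iy; have [y1' inv' [_ _] _ _] := ik.
  have z0 : y.2 - (Y k).2 = 0.
    apply: (jb_norm_eq0 hV); apply/le_anti; rewrite (nu_ge0 hV) andbT.
    have := positive_expands (y.2 - (Y k).2) Pk.
    have : (up (one + inW k) y).2 = (up (one + inW k) (Y k)).2 by rewrite inv inv'.
    rewrite /ujp /= !add0r !addr0 y1 y1' !scale1r => E.
    rewrite (jpBr hj) [X in _ <= nu X](_ : _ = 0); last by apply: (eq_modulo E); vlin R.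
    by rewrite (nu0 hV).
  rewrite [y]surjective_pairing [Y k]surjective_pairing y1 y1'; congr (_, _).
  by apply/eqP; rewrite -subr_eq0 z0.
rewrite yE; have := wpos_shift hV (h := inW (x - 2 *: - (Y k).2)) (d := 1).
rewrite /unorm /= normr0 add0r => /(_ (xP k Pk)); congr wpos.
by rewrite -scaleNr inWD inWZ -uE //; vlin R.
Qed.

End Unit.

Section UnitEx.
Variables (R : realType) (V : lmodType R) (jp : V -> V -> V) (nu : V -> R).
Hypothesis hV : jb_algebra jp nu.
Local Infix "**" := jp (at level 40, left associativity).
Local Notation hj := (jb_jordan hV).
Local Notation nuD := (jb_normD hV).
Local Notation nuZ := (jb_normZ hV).
Local Notation nuM := (jb_normM hV).
Local Notation W := (unitization V).
Local Notation up := (ujp jp).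
Local Notation one := (uone V : W).
Local Notation hW := (ujp_jordan hj).
Local Notation one_up := (uone_jp hj).
Local Notation inW x := ((0, x) : W).
Local Notation ev a := (pev up one (inW a)).
Local Notation B := (pbnd jp nu).
Local Notation ppos := (ppos jp nu).
Local Notation unorm := (unorm nu).
Local Notation Q := (quadU up).
Local Notation wpos := (wpos jp nu).
Local Notation inverse := (inverse jp nu).

Lemma quadU_wpos k g : wpos (inW k) -> wpos g -> wpos (Q (inW k) g).
Proof.
move=> pk pg; have kX : ev k 'X = inW k by rewrite (pevX hW one_up).
by rewrite -kX; apply: (quadU_pos hV) => //; apply: (ppos_wpos hV); rewrite kX.
Qed.

(** [U_k (1 + t k)^-1] tends to 0 as [t] grows: it is
    [k / t - (1 - (1 + t k)^-1) / t^2]. *)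
Lemma quadU_limit x k : wpos (one - inW x) ->
  (forall k y, wpos (inW k) -> inverse k y -> wpos (2 *: y - (one - inW x))) ->
  wpos (inW k) -> quadU jp k x = k ** k.
Proof.
move=> px Hx pk; set q := one - inW x in px Hx.
have pQ := quadU_wpos pk px; have n0 := nu_ge0 hV k.
have E1 : Q (inW k) q = inW (k ** k - quadU jp k x).
  rewrite inWD inWN /q (quadUBr hV) (quadU_r1 hV) up_in; congr (_ - _).
  by rewrite /quadU /bilU !up_in inWD inWN inWD.
suff n1 : nu (k ** k - quadU jp k x) <= 0.
  have /(jb_norm_eq0 hV) : nu (k ** k - quadU jp k x) = 0.
    by apply/le_anti; rewrite n1 (nu_ge0 hV).
  by move=> /eqP; rewrite subr_eq0 => /eqP.
apply: (@ler_small _ _ _ (2 * nu k)); first by rewrite mulr_ge0.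
move=> e e0 e1; rewrite add0r.
have ptk : wpos (inW (e^-1 *: k)).
  by rewrite inWZ; apply: (wposZ hV) => //; rewrite invr_ge0 ltW.
have [y iy] := inverse_ex hV ptk.
have pqy := Hx _ _ ptk iy; have [_ inv [_ py1] _ [_ kky]] := iy.
have Qy : Q (inW k) y = e *: inW k - e ^+ 2 *: (one - y).
  move: inv kky; rewrite inWZ (jpDl hW) one_up !(jpZl hW) !(jpZr hW) => inv kky.
  have kky' : up (up (inW k) (inW k)) y = up (inW k) (up (inW k) y).
    have e2 : e^-1 * e^-1 != 0 by rewrite mulf_neq0 // invr_eq0 gt_eqF.
    by apply: (scalerI e2); move: kky; rewrite !(jpZl hW, jpZr hW) !scalerA.
  have ky : up (inW k) y = e *: (one - y).
    move: inv; move: (up _ y) => z inv.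
    by apply: (eq_modulo (f_equal (fun z => e *: z) inv)); vlin R; rewrite gt_eqF.
  rewrite /quadU /bilU kky' addrK ky (jpZr hW) (jpBr hW _ y) ky.
  by rewrite (jordan_one_comm hW one_up); vlin R.
have H2 : wpos ((2 * nu k * e) *: one - Q (inW k) q).
  have H := quadU_wpos pk pqy; rewrite (quadUBr hV) (quadUZr hV) Qy in H.
  have e2 : 0 <= 2 * e ^+ 2 by rewrite mulr_ge0 ?sqr_ge0.
  have H3 := wposD hV H (wposZ hV e2 py1).
  have un : unorm (inW k) <= nu k by rewrite /unorm /= normr0 add0r.
  have e3 : 0 <= 2 * e by lin_arith.
  have := wposD hV H3 (wposZ hV e3 (wpos_shiftr hV un)).
  by congr wpos; vlin R.
apply: (norm_order hV); first by rewrite !mulr_ge0 // ltW.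
  rewrite -E1; apply: (wposD hV) => //; apply: (wpos_one hV).
  by rewrite !mulr_ge0 // ltW.
by rewrite -E1.
Qed.

Section ProductIdentity.
Variable x : V.
Hypothesis xQ : forall k, wpos (inW k) -> quadU jp k x = k ** k.
Local Notation defect b c := (bilU jp b c x - b ** c).

(** Linearize the identity [U_k x = k^2] over sums of two squares. *)
Lemma defect_square b c : defect (b ** b) (c ** c) = 0.
Proof.
have p z : wpos (inW (z ** z)) by rewrite -up_in; exact: (wpos_square hV).
have pD : wpos (inW (b ** b + c ** c)) by rewrite inWD; apply: (wposD hV).
have := xQ pD; have := xQ (p b); have := xQ (p c).
move: (b ** b) (c ** c) => k l; rewrite /quadU => El Ek E.
have E2 := f_equal2 (fun u v => u - v) E (f_equal2 (fun u v => u + v) Ek El).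
have E3 := f_equal (fun u => 2^-1 *: u) E2.
by apply: (eq_modulo E3); rewrite /bilU; jlin (jb_jordan hV) R.
Qed.

Lemma defect_product b c d f : defect (b ** c) (d ** f) = 0.
Proof.
have sqE u v : u ** v = 4^-1 *: ((u + v) ** (u + v) - (u - v) ** (u - v)).
  by jlin (jb_jordan hV) R.
have E := (defect_square (d + f) (b + c), defect_square (d + f) (b - c),
  defect_square (d - f) (b + c), defect_square (d - f) (b - c)).
have DD k k' l : defect (4^-1 *: (k - k')) l = 4^-1 *: (defect k l - defect k' l).
  by rewrite /bilU; jlin (jb_jordan hV) R.
have DS k l : defect k l = defect l k by rewrite (bilUC hj) (jpC hj).
by rewrite (sqE b) (sqE d) DD !(DS (_ ** _)) !DD !E !(subrr, scaler0, subr0).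
Qed.

(** Products are dense: [b (1 - b^2/M^2)^n] tends to 0, and [b] differs from
    it by a multiple of [b]. *)
Lemma approximate_factor b e : 0 < e -> exists c, nu (b - b ** c) <= e.
Proof.
move=> e0; have [M M0 XM] := pbnd_ex hV b 'X.
pose s : {poly R} := M^-2 *: ('X * 'X).
have sE : s = (M^-1 *: 'X) ^+ 2.
  by rewrite expr2 -scalerAl -scalerAr scalerA /s -exprVn expr2.
have s1 : B b s 1.
  rewrite sE -[1](expr1n _ 2); apply: (pbndX hV).
  by have := pbndZ hV M^-1 XM; rewrite gtr0_norm ?invr_gt0 // mulVf ?gt_eqF.
have ps : ppos b s by rewrite sE; exact: (ppos_sqr hV).
pose n := (Num.truncn (2 * M ^+ 2 / e ^+ 2)).+1.
have e2 : 0 < e ^+ 2 by rewrite exprn_gt0.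
have n1 : 2 * M ^+ 2 < n%:R * e ^+ 2 by rewrite -ltr_pdivrMr // truncnS_gt.
pose w := 'X * (1 - s) ^+ n; pose g := 1 - (1 - s) ^+ n.
have s0 : s.[0] = 0 by rewrite /s hornerZ hornerM hornerX !mulr0.
have g0 : g.[0] = 0 by rewrite /g hornerD hornerN horner_exp hornerD hornerN !hornerC s0 subr0 expr1n subrr.
have w0 : w.[0] = 0 by rewrite hornerM hornerX mul0r.
exists (pval jp b g).
have -> : b - b ** pval jp b g = pval jp b w.
  rewrite -{1 2}(pvalX hV b) -(pvalM0 hV) ?hornerX // -(pvalB jp b).
  by congr (pval jp b _); rewrite /w /g; ring.
rewrite -(ler_pXn2r (n := 2)) ?nnegrE ?(nu_ge0 hV) ?(ltW e0) // -(nu_pval_sq hV) //.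
have -> : w ^+ 2 = M ^+ 2 *: (s * (1 - s) ^+ (2 * n)).
  rewrite /w exprMn mulnC exprM scalerAl {1}/s scalerA divff ?expf_neq0 ?gt_eqF //.
  by rewrite scale1r expr2.
rewrite (pvalZ jp b) nuZ ger0_norm ?sqr_ge0 //.
have := pval_le hV (pbnd_peak hV (2 * n) ps s1).
set v := nu _ => vE; have M2 : 0 < M ^+ 2 by rewrite exprn_gt0.
have n0 : 0 < (2 * n).+1%:R :> R by rewrite ltr0n.
have : v * (2 * n).+1%:R <= 2 by rewrite -ler_pdivlMr.
rewrite -natr1 natrM => h; have v0 : 0 <= v by exact: (nu_ge0 hV).
have nn : 0 < n%:R :> R by rewrite ltr0n.
have vn : M ^+ 2 * (v * n%:R) <= M ^+ 2 * 1 by rewrite ler_pM2l //; lin_arith.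
by rewrite -(ler_pM2r nn); lin_arith.
Qed.

Lemma defect0 b c : defect b c = 0.
Proof.
have DN b1 c1 : nu (defect b1 c1) <= (3 * nu x + 1) * nu b1 * nu c1.
  rewrite /bilU; have h1 := le_trans (nuM b1 (c1 ** x)) (ler_wpM2l (nu_ge0 hV _) (nuM c1 x)).
  have h2 := le_trans (nuM c1 (b1 ** x)) (ler_wpM2l (nu_ge0 hV _) (nuM b1 x)).
  have h3 := le_trans (nuM (b1 ** c1) x) (ler_wpM2r (nu_ge0 hV _) (nuM b1 c1)).
  have := nuD (b1 ** (c1 ** x) + c1 ** (b1 ** x) - b1 ** c1 ** x) (- (b1 ** c1)).
  have := nuD (b1 ** (c1 ** x) + c1 ** (b1 ** x)) (- (b1 ** c1 ** x)).
  have := nuD (b1 ** (c1 ** x)) (c1 ** (b1 ** x)).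
  by rewrite !(nuN hV); have := nuM b1 c1; lin_arith.
have DB k k' l : defect (k - k') l = defect k l - defect k' l.
  by rewrite /bilU; jlin (jb_jordan hV) R.
have DS k l : defect k l = defect l k by rewrite (bilUC hj) (jpC hj).
have x0 := nu_ge0 hV x.
have small u l : (forall e, 0 < e -> exists c, defect (u ** c) l = 0 /\ nu (u - u ** c) <= e)
    -> defect u l = 0.
  move=> H; apply: (jb_norm_eq0 hV); apply/le_anti; rewrite (nu_ge0 hV) andbT.
  have l0 := nu_ge0 hV l.
  apply: (@ler_small _ _ _ ((3 * nu x + 1) * nu l)).
    by rewrite mulr_ge0 //; lin_arith.
  move=> e e0 _; have [c1 [c10 c1e]] := H e e0; rewrite add0r.
  rewrite -[X in nu X]subr0 -c10 -DB; apply: le_trans (DN _ _) _.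
  rewrite mulrAC; apply: ler_wpM2l => //; apply: mulr_ge0 => //; lin_arith.
apply: (small) => e e0; have [b1 b1e] := approximate_factor b e0; exists b1; split=> //.
rewrite DS; apply: (small) => d d0; have [c1 c1d] := approximate_factor c d0; exists c1.
by split=> //; exact: defect_product.
Qed.

(** [b (c x) + c (b x) - (b c) x = b c] makes [x] idempotent and kills its
    Peirce spaces for 0 and 1/2. *)
Lemma defect0_unit b : x ** b = b.
Proof.
have E c d : c ** (d ** x) + d ** (c ** x) - c ** d ** x = c ** d.
  by apply/eqP; rewrite -subr_eq0; apply/eqP; exact: defect0.
have sq0 z : z ** z = 0 -> z = 0.
  move=> z0; apply: (jb_norm_eq0 hV); apply/eqP; rewrite -sqrf_eq0.
  by rewrite -(jb_norm_sq hV) z0 (nu0 hV) eqxx.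
have xx : x ** x = x.
  apply/eqP; rewrite -subr_eq0; apply/eqP; apply: sq0; rewrite (jpBr hj).
  have := E (x ** x - x) x; rewrite (jpC hj (_ ** x) x) addrK => ->.
  by rewrite subrr.
have peirce0 z : x ** z = 0 -> z = 0.
  move=> xz; apply: (sq0); apply: (sq0).
  have := E z z; rewrite (jpC hj z x) xz (jp0r hj) !add0r (jpC hj _ x).
  by rewrite (Peirce0_square hj xx xz) oppr0 => <-; rewrite (jp0l hj).
have peirce_half z : x ** z = 2^-1 *: z -> z = 0.
  move=> xz; apply: sq0; apply: peirce0.
  have := E z z; rewrite (jpC hj z x) xz (jpZr hj) (jpC hj _ x) => E'.
  have := f_equal (fun t => - t + z ** z) E'; rewrite addNr => E2.
  by apply: (eq_modulo E2); vlin R.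
have PE := Peirce_equation hj b xx.
have E1 : (x ** (x ** b)) *+ 2 - (x ** b) *+ 3 + b = 0.
  by apply: peirce0; apply: (eq_modulo PE); jlin (jb_jordan hV) R.
have : x ** b - b = 0.
  apply: peirce_half; have E2 := f_equal (fun t => 2^-1 *: t) E1.
  by apply: (eq_modulo E2); jlin (jb_jordan hV) R.
by move=> /eqP; rewrite subr_eq0 => /eqP.
Qed.
End ProductIdentity.

Theorem jb_algebra_unit : exists e, forall b, e ** b = b.
Proof.
have [x [px Hx]] := approximate_unit_limit hV; exists x => b.
by apply: defect0_unit => k pk; exact: quadU_limit.
Qed.
End UnitEx.

(** * Complex Jordan algebras with involution *)

(** The sum of three instances of the polarized identity. It says that
    multiplications act on the triple product as hermitian operators do, with
    a change of sign in the middle variable. *)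
Lemma jp_bilU (K : realFieldType) (A : lmodType K) (jp : A -> A -> A)
    (hA : jordan_algebra jp) a x z w :
  jp a (bilU jp x z w) =
  bilU jp (jp a x) z w + bilU jp x (jp a z) w - bilU jp x z (jp a w).
Proof.
have E := f_equal2 (fun u v => u - v)
  (f_equal2 (fun u v => u + v) (jordan_polarized hA a w z x) (jordan_polarized hA a w x z))
  (jordan_polarized hA a z x w).
rewrite /bilU; apply: (eq_modulo (esym E)); jlin hA K.
Qed.

Section Linear.
Variables (R : pzRingType) (U U' : lmodType R) (f : U -> U').
Hypothesis f_linear : forall k x y, f (k *: x + y) = k *: f x + f y.
Lemma lin0 : f 0 = 0.
Proof. by have := f_linear (-1) 0 0; rewrite scaler0 addr0 scaleN1r addNr. Qed.
Lemma linD x y : f (x + y) = f x + f y.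
Proof. by have := f_linear 1 x y; rewrite !scale1r. Qed.
Lemma linZ k x : f (k *: x) = k *: f x.
Proof. by have := f_linear k x 0; rewrite !addr0 lin0 addr0. Qed.
Lemma linN x : f (- x) = - f x. Proof. by rewrite -scaleN1r linZ scaleN1r. Qed.
End Linear.

(** Scalars are restricted to the reals and [im] is the multiplication by the
    imaginary unit: the estimates below are real-linear, and the derivations
    and the triple product become real multilinear maps. *)
Record star_algebra (R : realType) (A : lmodType R) (jp : A -> A -> A)
    (star im : A -> A) (nu : A -> R) : Prop := {
  sa_jordan : jordan_algebra jp;
  sa_im_linear : forall k x y, im (k *: x + y) = k *: im x + im y;
  sa_imK : forall x, im (im x) = - x;
  sa_im_jp : forall x y, jp (im x) y = im (jp x y);
  sa_star_linear : forall k x y, star (k *: x + y) = k *: star x + star y;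
  sa_starK : forall x, star (star x) = x;
  sa_star_jp : forall x y, star (jp x y) = jp (star x) (star y);
  sa_star_im : forall x, star (im x) = - im (star x);
  sa_norm_eq0 : forall x, nu x = 0 -> x = 0;
  sa_normD : forall x y, nu (x + y) <= nu x + nu y;
  sa_normZ : forall k x, nu (k *: x) = `|k| * nu x;
  sa_norm_im : forall x, nu (im x) = nu x;
  sa_normM : forall x y, nu (jp x y) <= nu x * nu y;
  sa_norm_cube : forall x, nu (bilU jp x x (star x)) = nu x ^+ 3;
  sa_complete : forall u : nat -> A,
    (forall e, 0 < e -> exists N, forall m n, (N <= m)%N -> (N <= n)%N ->
       nu (u m - u n) <= e) ->
    exists l, forall e, 0 < e -> exists N, forall n, (N <= n)%N -> nu (u n - l) <= e;
  sa_balls : forall S : A -> Prop,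
    (forall s : seq A, (forall c, c \in s -> S c) ->
       exists x, forall c, c \in s -> nu (x - c) <= 1) ->
    exists x, forall c, S c -> nu (x - c) <= 1
}.

Section Star.
Variables (R : realType) (A : lmodType R) (jp : A -> A -> A).
Variables (star im : A -> A) (nu : A -> R).
Hypothesis hA : star_algebra jp star im nu.
Local Infix "**" := jp (at level 40, left associativity).
Local Notation hj := (sa_jordan hA).
Local Notation nuD := (sa_normD hA).
Local Notation nuZ := (sa_normZ hA).
Local Notation nuM := (sa_normM hA).
Local Notation bilU := (bilU jp).

Lemma sa_imD x y : im (x + y) = im x + im y.
Proof. exact: linD (sa_im_linear hA) x y. Qed.
Lemma sa_imZ k x : im (k *: x) = k *: im x.
Proof. exact: linZ (sa_im_linear hA) k x. Qed.
Lemma sa_imN x : im (- x) = - im x. Proof. exact: linN (sa_im_linear hA) x. Qed.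
Lemma sa_star0 : star 0 = 0. Proof. exact: lin0 (sa_star_linear hA). Qed.
Lemma sa_starD x y : star (x + y) = star x + star y.
Proof. exact: linD (sa_star_linear hA) x y. Qed.
Lemma sa_starZ k x : star (k *: x) = k *: star x.
Proof. exact: linZ (sa_star_linear hA) k x. Qed.
Lemma sa_starN x : star (- x) = - star x.
Proof. exact: linN (sa_star_linear hA) x. Qed.
Lemma sa_jp_im x y : x ** im y = im (x ** y).
Proof. by rewrite (jpC hj) (sa_im_jp hA) (jpC hj). Qed.

Definition re x := 2^-1 *: (x + star x).
Definition imag x := 2^-1 *: im (star x - x).
Lemma star_re x : star (re x) = re x.
Proof. by rewrite /re sa_starZ sa_starD (sa_starK hA) (addrC (star x)). Qed.
Lemma star_imag x : star (imag x) = imag x.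
Proof.
rewrite /imag sa_starZ (sa_star_im hA) sa_starD sa_starN (sa_starK hA).
by rewrite -sa_imN opprB.
Qed.
Lemma re_imag x : x = re x + im (imag x).
Proof. by rewrite /re /imag sa_imZ (sa_imK hA); vlin R. Qed.

Lemma bilU_iml x y z : bilU (im x) y z = im (bilU x y z).
Proof. by rewrite !bilUE !(sa_im_jp hA) !sa_jp_im -sa_imN -!sa_imD. Qed.
Lemma bilU_imm x y z : bilU x (im y) z = im (bilU x y z).
Proof. by rewrite (bilUC hj) bilU_iml (bilUC hj). Qed.
Lemma bilU_imr x y z : bilU x y (im z) = im (bilU x y z).
Proof. by rewrite !bilUE !sa_jp_im -sa_imN -!sa_imD. Qed.
Lemma bilU_Nr x y z : bilU x y (- z) = - bilU x y z.
Proof. by rewrite -scaleN1r (bilUZr hj) scaleN1r. Qed.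

Lemma sa_norm0 : nu 0 = 0. Proof. by have := nuZ 0 0; rewrite scale0r normr0 mul0r. Qed.
Lemma sa_normN x : nu (- x) = nu x.
Proof. by rewrite -scaleN1r nuZ normrN normr1 mul1r. Qed.
Lemma sa_norm_ge0 x : 0 <= nu x.
Proof. by have := nuD x (- x); rewrite subrr sa_norm0 sa_normN; lin_arith. Qed.
Local Notation nu_ge0 := sa_norm_ge0.

Lemma bilU_norm x y z : nu (bilU x y z) <= 3 * nu x * nu y * nu z.
Proof.
rewrite !bilUE.
have h1 := le_trans (nuM x (y ** z)) (ler_wpM2l (nu_ge0 x) (nuM y z)).
have h2 := le_trans (nuM y (x ** z)) (ler_wpM2l (nu_ge0 y) (nuM x z)).
have h3 := le_trans (nuM (x ** y) z) (ler_wpM2r (nu_ge0 z) (nuM x y)).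
have := nuD (x ** (y ** z)) (y ** (x ** z)).
have := nuD (x ** (y ** z) + y ** (x ** z)) (- (x ** y ** z)).
rewrite sa_normN; lin_arith.
Qed.

Local Notation cube x := (bilU x x (star x)).

Lemma star_bilU x y z : star (bilU x y z) = bilU (star x) (star y) (star z).
Proof. by rewrite !bilUE !(sa_starD, sa_starN) !(sa_star_jp hA). Qed.

(** The involution is isometric: it is bounded and commutes with the cubing
    map, which cubes norms. *)
Lemma sa_norm_star x : nu (star x) = nu x.
Proof.
suff le y : nu (star y) <= nu y.
  by apply/le_anti; rewrite le /= -{1}(sa_starK hA x) le.
have le3 z : nu (star z) <= 3 * nu z.
  have z0 := nu_ge0 z; have := nu_ge0 (star z); rewrite le_eqVlt => /orP[/eqP <-|s0].
    by rewrite mulr_ge0.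
  have s2 : 0 < nu (star z) ^+ 2 by rewrite exprn_gt0.
  rewrite -(ler_pM2l s2); have := sa_norm_cube hA (star z); rewrite (sa_starK hA) exprSr => <-.
  by have := bilU_norm (star z) (star z) z; lin_arith.
pose c z := cube z.
have cS n : star (iter n c y) = iter n c (star y).
  by elim: n => //= n IH; rewrite -IH /c star_bilU.
have cN n z : nu (iter n c z) = nu z ^+ (3 ^ n).
  by elim: n => [|n IH] //=; rewrite /c (sa_norm_cube hA) IH -exprM expnSr.
have H n : nu (star y) ^+ (3 ^ n) <= 3 * nu y ^+ (3 ^ n).
  by rewrite -!cN -cS.
rewrite leNgt; apply/negP => lt; have y0 := nu_ge0 y.
have s0 : 0 < nu (star y) by exact: le_lt_trans lt.
have r01 : 0 <= nu y / nu (star y) < 1.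
  by rewrite divr_ge0 //= ?ltr_pdivrMr ?mul1r // ltW.
have r4 : 0 < 4^-1 :> R by rewrite invr_gt0.
have [n rn] := expr_small r01 r4.
have n3 : (nu y / nu (star y)) ^+ (3 ^ n) <= 4^-1.
  apply: le_trans rn; have /andP[r0 r1] := r01.
  by apply: ler_wiXn2l => //; [exact: ltW|exact: ltnW (ltn_expl _ _)].
have p0 : 0 < nu (star y) ^+ (3 ^ n) by rewrite exprn_gt0.
have := H n; rewrite leNgt => /negP; apply.
move: n3; rewrite expr_div_n ler_pdivrMr //.
by move: (nu y ^+ _) (nu (star y) ^+ _) p0 => u v v0; lin_arith.
Qed.

(** If [|f x| <= (1 + s) |x|] for all [x] then
    [|f x|^3 = |f x cubed| <= (1 + s + K) |x|^3], and taking the cube root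
    improves [s] to [(s + K) / 3]. The fixed point of this is below [K]. *)
Lemma almost_isometry (f : A -> A) K M : 0 <= K -> 0 <= M ->
  (forall x, nu (f x) <= (1 + M) * nu x) ->
  (forall x, nu (cube (f x) - f (cube x)) <= K * nu x ^+ 3) ->
  forall x, nu (f x) <= (1 + K) * nu x.
Proof.
move=> K0 M0 fM fK.
have H n x : nu (f x) <= (1 + K + M * (3^-1) ^+ n) * nu x.
  elim: n x => [|n IH] x.
    by apply: le_trans (fM x) _; rewrite expr0 mulr1 ler_wpM2r ?nu_ge0 //; lin_arith.
  set s := M * _ ^+ n in IH; have s0 : 0 <= s by rewrite mulr_ge0 ?exprn_ge0 ?invr_ge0.
  have x0 := nu_ge0 x; have -> : M * 3^-1 ^+ n.+1 = s / 3 by rewrite exprSr mulrA.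
  have s1 : 0 <= 1 + K + s / 3 by lin_arith.
  rewrite -(ler_pXn2r (n := 3)) ?nnegrE ?mulr_ge0 ?nu_ge0 // exprMn.
  rewrite -(sa_norm_cube hA).
  have x3 : 0 <= nu x ^+ 3 by rewrite exprn_ge0.
  have h1 := IH (cube x); rewrite (sa_norm_cube hA) in h1.
  have h2 := nuD (f (cube x)) (cube (f x) - f (cube x)); rewrite addrC subrK in h2.
  have h3 := fK x.
  have : (1 + K + s + K) * nu x ^+ 3 <= (1 + K + s / 3) ^+ 3 * nu x ^+ 3.
    apply: ler_wpM2r => //; have k0 : 0 <= K + s / 3 by lin_arith.
    by have := exprn_ge0 3 k0; have := sqr_ge0 (K + s / 3); lin_arith.
  lin_arith.
move=> x; apply: (@ler_small _ _ _ (M * nu x)); first by rewrite mulr_ge0 ?nu_ge0.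
move=> e e0 _; have r01 : 0 <= (3^-1 : R) < 1 by apply/andP; split; lin_arith.
have [n ne] := expr_small r01 e0; apply: le_trans (H n x) _.
have := ler_wpM2l (mulr_ge0 M0 (nu_ge0 x)) ne; lin_arith.
Qed.

Section Hermitian.
Variables (l : R) (a : A).
Hypothesis star_a : star a = a.
Local Notation H x := (l *: x + a ** x).
Definition der x := im (H x).
Local Notation D := der.
Local Notation tr x y z := (bilU x z (star y)).

(** [D] is the derivation [i (l + L_a)]; the conjugation in the middle variable
    turns the minus sign of [jp_bilU] into a plus sign. *)
Lemma triple_derivation x y z :
  D (tr x y z) = tr (D x) y z + tr x (D y) z + tr x y (D z).
Proof.
rewrite /der (sa_star_im hA) sa_starD sa_starZ (sa_star_jp hA) star_a.
rewrite (jp_bilU hj); move: (star y) => w.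
rewrite bilU_Nr bilU_iml bilU_imm bilU_imr -sa_imN -!sa_imD; congr im.
rewrite (bilUDl hj) (bilUDm hj) (bilUDr hj) (bilUZl hj) (bilUZm hj) (bilUZr hj).
by vlin R.
Qed.

Lemma derD x y : D (x + y) = D x + D y.
Proof. by rewrite /der scalerDr (jpDr hj) addrACA sa_imD. Qed.

(* The Taylor polynomial of order 2 of [exp (t D)]. *)
Definition exp2 t x := x + t *: D x + (t ^+ 2 / 2) *: D (D x).

(** [exp (t D)] is an automorphism, so its Taylor polynomial of order 2
    commutes with the cubing map up to order 3. *)
Lemma exp2_cube : exists2 K, 0 <= K & forall t x, 0 < `|t| -> `|t| <= 1 ->
  nu (cube (exp2 t x) - exp2 t (cube x)) <= K * `|t| ^+ 3 * nu x ^+ 3.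
Proof.
pose M := 1 + `|l| + nu a; have M1 : 1 <= M.
  by have := normr_ge0 l; have := nu_ge0 a; rewrite /M; lin_arith.
have DM x : nu (D x) <= M * nu x.
  rewrite /der (sa_norm_im hA); apply: le_trans (nuD _ _) _; rewrite nuZ.
  by have := nuM a x; have := nu_ge0 x; rewrite /M; lin_arith.
exists (51 * M ^+ 6) => [|t x t0 t1].
  by rewrite mulr_ge0 // exprn_ge0 //; lin_arith.
pose x1 := D x; pose x2 := 2^-1 *: D x1.
have x0 := nu_ge0 x.
have M2 : M <= M ^+ 2 by rewrite expr2 ler_peMr //; lin_arith.
have n0 : nu x <= M ^+ 2 * nu x by rewrite ler_peMl //; lin_arith.
have n1 : nu x1 <= M ^+ 2 * nu x by apply: le_trans (DM x) _; rewrite ler_wpM2r.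
have n2 : nu x2 <= M ^+ 2 * nu x.
  rewrite nuZ ger0_norm ?invr_ge0 //; have := DM x1; have := DM x.
  have : 0 <= M by lin_arith.
  move=> M0 h1 h2; have := ler_wpM2l M0 h1; rewrite mulrA -expr2.
  by have := nu_ge0 (D x1); lin_arith.
have D1 : D x = x1 by [].
have D2 : D x1 = 2 *: x2 by rewrite /x2; vlin R.
clearbody x2 x1.
(* The terms of degree at least 3 in [t] of the cube. *)
pose s := [:: t ^+ 3 *: tr x x1 x2; t ^+ 3 *: tr x x2 x1; t ^+ 3 *: tr x1 x x2;
  t ^+ 3 *: tr x2 x1 x; t ^+ 3 *: tr x1 x2 x; t ^+ 3 *: tr x2 x x1; t ^+ 3 *: tr x1 x1 x1;
  t ^+ 4 *: tr x x2 x2; t ^+ 4 *: tr x2 x2 x; t ^+ 4 *: tr x2 x x2;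
  t ^+ 4 *: tr x1 x1 x2; t ^+ 4 *: tr x2 x1 x1; t ^+ 4 *: tr x1 x2 x1;
  t ^+ 5 *: tr x1 x2 x2; t ^+ 5 *: tr x2 x2 x1; t ^+ 5 *: tr x2 x1 x2;
  t ^+ 6 *: tr x2 x2 x2].
have -> : cube (exp2 t x) - exp2 t (cube x) = \sum_(u <- s) u.
  have Ex : exp2 t x = x + t *: x1 + t ^+ 2 *: x2.
    by rewrite /exp2 D1 D2; vlin R.
  have Ec : exp2 t (cube x) = cube x + t *: (tr x1 x x + tr x x1 x + tr x x x1)
    + t ^+ 2 *: (tr x2 x x + tr x x2 x + tr x x x2 + tr x1 x1 x + tr x1 x x1 + tr x x1 x1).
    rewrite /exp2 triple_derivation 2!derD !triple_derivation D1 D2.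
    by rewrite sa_starZ (bilUZl hj) (bilUZm hj) (bilUZr hj); vlin R.
  rewrite Ec Ex !(sa_starD, sa_starZ).
  rewrite !(bilUDl hj, bilUZl hj, bilUDm hj, bilUZm hj, bilUDr hj, bilUZr hj).
  by rewrite /s !big_cons big_nil; vlin R.
have sB u : u \in s -> nu u <= 3 * M ^+ 6 * `|t| ^+ 3 * nu x ^+ 3.
  have T k : (3 <= k)%N -> `|t ^+ k| <= `|t| ^+ 3.
    by move=> k3; rewrite normrX; apply: ler_wiXn2l.
  have TR k p q r : (3 <= k)%N -> nu p <= M ^+ 2 * nu x -> nu q <= M ^+ 2 * nu x ->
      nu r <= M ^+ 2 * nu x -> nu (t ^+ k *: tr p q r) <= 3 * M ^+ 6 * `|t| ^+ 3 * nu x ^+ 3.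
    move=> k3 hp hq hr; rewrite nuZ.
    have h1 := bilU_norm p r (star q); rewrite sa_norm_star in h1.
    have h2 := ler_pM (mulr_ge0 (nu_ge0 p) (nu_ge0 r)) (nu_ge0 q)
      (ler_pM (nu_ge0 p) (nu_ge0 r) hp hr) hq.
    have h3 : nu (tr p q r) <= 3 * M ^+ 6 * nu x ^+ 3 by apply: le_trans h1 _; lin_arith.
    by have := ler_pM (normr_ge0 _) (nu_ge0 _) (T k k3) h3; lin_arith.
  by rewrite /s !inE; repeat (case/orP => [/eqP -> | ]; first by exact: TR); move=> /eqP ->; exact: TR.
have n3 : 0 <= 3 * M ^+ 6 * `|t| ^+ 3 * nu x ^+ 3.
  by rewrite !mulr_ge0 ?exprn_ge0 //; lin_arith.
have sum_le (r : seq A) c : 0 <= c -> (forall u, u \in r -> nu u <= c) ->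
    nu (\sum_(u <- r) u) <= (size r)%:R * c.
  move=> c0; elim: r => [|u r IH] rc; first by rewrite big_nil sa_norm0 mul0r.
  rewrite big_cons; apply: le_trans (nuD _ _) _.
  have h1 := rc u (mem_head _ _).
  have h2 : nu (\sum_(j <- r) j) <= (size r)%:R * c.
    by apply: IH => v vr; apply: rc; rewrite in_cons vr orbT.
  by rewrite -natr1 mulrDl mul1r addrC lerD.
by have := sum_le s _ n3 sB; rewrite /= ; lin_arith.
Qed.

Lemma exp2_le : exists2 C, 0 <= C & forall t x, 0 < `|t| -> `|t| <= 1 ->
  nu (exp2 t x) <= (1 + C * `|t| ^+ 3) * nu x.
Proof.
have [K K0 HK] := exp2_cube; exists K => // t x t0 t1.
pose M := `|l| + nu a; have M0 : 0 <= M by rewrite addr_ge0 ?nu_ge0.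
have DM y : nu (D y) <= M * nu y.
  rewrite /der (sa_norm_im hA); apply: le_trans (nuD _ _) _; rewrite nuZ.
  by have := nuM a y; rewrite /M; lin_arith.
apply: (@almost_isometry _ _ (M + M * M)).
- by rewrite mulr_ge0 ?exprn_ge0 //.
- by rewrite addr_ge0 ?mulr_ge0.
- move=> y; rewrite /exp2; have y0 := nu_ge0 y.
  have h1 := nuD (y + t *: D y) ((t ^+ 2 / 2) *: D (D y)); have h2 := nuD y (t *: D y).
  rewrite !nuZ in h1 h2; have h3 := DM y; have h4 := le_trans (DM (D y)) (ler_wpM2l M0 h3).
  have t2 : 0 <= t ^+ 2 <= 1.
    by rewrite sqr_ge0 -[t ^+ 2]ger0_norm ?sqr_ge0 // normrX exprn_ile1.
  have t22 : `|t ^+ 2 / 2| <= 1 by rewrite ger0_norm; lin_arith.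
  have h5 := ler_pM (normr_ge0 t) (nu_ge0 _) t1 h3.
  have h6 := ler_pM (normr_ge0 _) (nu_ge0 _) t22 h4.
  lin_arith.
by move=> y; exact: HK.
Qed.
End Hermitian.

(** The average of [exp (i t H)] and [exp (- i t H)] is [cos (t H)]. *)
Lemma hermitian_cos l a : star a = a -> exists2 C, 0 <= C & forall t x, 0 < t <= 1 ->
  let H y := l *: y + a ** y in
  nu (x - (t ^+ 2 / 2) *: H (H x)) <= (1 + C * t ^+ 3) * nu x.
Proof.
move=> sa; have [C C0 HC] := exp2_le l sa; exists C => // t x /andP[t0 t1].
pose H y := l *: y + a ** y.
change (nu (x - (t ^+ 2 / 2) *: H (H x)) <= (1 + C * t ^+ 3) * nu x).
have nt : `|t| = t by rewrite gtr0_norm.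
have := HC t x; have := HC (- t) x; rewrite normrN nt => /(_ t0 t1) h1 /(_ t0 t1) h2.
have -> : x - (t ^+ 2 / 2) *: H (H x) = 2^-1 *: (exp2 l a t x + exp2 l a (- t) x).
  rewrite /exp2 sqrrN; have -> : der l a (der l a x) = - H (H x).
    by rewrite /der -/(H x) (sa_jp_im) -sa_imZ -sa_imD (sa_imK hA).
  by vlin R.
rewrite nuZ ger0_norm ?invr_ge0 //.
by have := nuD (exp2 l a t x) (exp2 l a (- t) x); lin_arith.
Qed.

Lemma sa_norm_square a : star a = a -> nu (a ** a) = nu a ^+ 2.
Proof.
move=> sa; apply/le_anti; rewrite expr2 nuM /=.
have E := sa_norm_cube hA a; rewrite sa !bilUE (jpC hj (a ** a)) addrK in E.
have : nu a = 0 \/ 0 < nu a.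
  by have := nu_ge0 a; rewrite le_eqVlt eq_sym => /orP[/eqP|]; [left|right].
case=> [->|a0]; first by rewrite mulr0 nu_ge0.
rewrite -(ler_pM2l a0); have := nuM a (a ** a); rewrite E exprS expr2; lin_arith.
Qed.

(** If [u] and [v] commute strongly enough, then [y = u + i v] satisfies
    [{y,y,y} = (u^2 + v^2) y]. *)
Lemma sa_two_squares u v : star u = u -> star v = v ->
  u ** v ** v = v ** v ** u -> u ** v ** u = u ** u ** v ->
  nu (u ** u) <= nu (u ** u + v ** v).
Proof.
move=> su sv E1 E2; pose y := u + im v.
have sy : star y = u - im v by rewrite /y sa_starD (sa_star_im hA) su sv.
have cy : cube y = (u ** u + v ** v) ** y.
  have q : y ** star y = u ** u + v ** v.
    rewrite sy /y (jpBr hj) !(jpDl hj) (sa_im_jp hA) sa_jp_im (sa_im_jp hA) sa_jp_im.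
    by rewrite (sa_imK hA) (jpC hj v u); vlin R.
  have p : y ** y = u ** u - v ** v + 2 *: im (u ** v).
    rewrite /y !(jpDr hj) !(jpDl hj) !(sa_im_jp hA) !sa_jp_im (sa_imK hA) (jpC hj v u).
    by vlin R.
  rewrite !bilUE q p sy /y.
  have K2 := sa_imK hA.
  have e1 : (2 *: im (u ** v)) ** (u - im v) = 2 *: im (u ** u ** v) + 2 *: (v ** v ** u).
    by rewrite (jpZl hj) (jpBr hj) !(sa_im_jp hA) sa_jp_im K2 E1 E2; vlin R.
  rewrite (jpDl hj _ (2 *: _)) e1 (jpC hj _ (u ** u + v ** v)).
  by rewrite !(jpE hj) !sa_jp_im; vlin R.
have y0 := nu_ge0 y; have s0 := nu_ge0 (u ** u + v ** v).
have y2 : nu y ^+ 2 <= nu (u ** u + v ** v).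
  have : nu y = 0 \/ 0 < nu y.
    by move: y0; rewrite le_eqVlt eq_sym => /orP[/eqP|]; [left|right].
  case=> [->|yp]; first by rewrite expr0n.
  rewrite -(ler_pM2l yp) -exprS -(sa_norm_cube hA) cy mulrC; exact: nuM.
apply: le_trans y2; rewrite sa_norm_square // ler_pXn2r ?nnegrE ?nu_ge0 //.
have -> : u = 2^-1 *: (y + star y) by rewrite sy /y; vlin R.
rewrite nuZ ger0_norm ?invr_ge0 //.
by have := nuD y (star y); rewrite sa_norm_star; lin_arith.
Qed.
End Star.

(** The type mentions the proof [hA] because its module structure needs it. *)
Definition selfadjoint (R : realType) (A : lmodType R) (jp : A -> A -> A)
  (star im : A -> A) (nu : A -> R) (hA : star_algebra jp star im nu) :=
  {x : A | star x = x}.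

Section SelfAdjoint.
Variables (R : realType) (A : lmodType R) (jp : A -> A -> A).
Variables (star im : A -> A) (nu : A -> R).
Hypothesis hA : star_algebra jp star im nu.
Local Notation V := (selfadjoint hA).
Implicit Types x y : V.

HB.instance Definition _ := gen_eqMixin V.
HB.instance Definition _ := gen_choiceMixin V.

Lemma selfadjoint_inj x y : sval x = sval y -> x = y.
Proof. by case: x y => x px [y py] /= E; exact: eq_exist. Qed.

Definition selfadjoint_zero : V := exist _ 0 (sa_star0 hA).
Lemma selfadjoint_opp_subproof x : star (- sval x) = - sval x.
Proof. by rewrite (sa_starN hA) (svalP x). Qed.
Definition selfadjoint_opp x : V := exist _ _ (selfadjoint_opp_subproof x).
Lemma selfadjoint_add_subproof x y : star (sval x + sval y) = sval x + sval y.
Proof. by rewrite (sa_starD hA) (svalP x) (svalP y). Qed.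
Definition selfadjoint_add x y : V := exist _ _ (selfadjoint_add_subproof x y).
Lemma selfadjoint_scale_subproof k x : star (k *: sval x) = k *: sval x.
Proof. by rewrite (sa_starZ hA) (svalP x). Qed.
Definition selfadjoint_scale k x : V := exist _ _ (selfadjoint_scale_subproof k x).
Lemma selfadjoint_jp_subproof x y : star (jp (sval x) (sval y)) = jp (sval x) (sval y).
Proof. by rewrite (sa_star_jp hA) (svalP x) (svalP y). Qed.
Definition selfadjoint_jp x y : V := exist _ _ (selfadjoint_jp_subproof x y).

Lemma selfadjoint_addA : associative selfadjoint_add.
Proof. by move=> x y z; apply: selfadjoint_inj; exact: addrA. Qed.
Lemma selfadjoint_addC : commutative selfadjoint_add.
Proof. by move=> x y; apply: selfadjoint_inj; exact: addrC. Qed.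
Lemma selfadjoint_add0 : left_id selfadjoint_zero selfadjoint_add.
Proof. by move=> x; apply: selfadjoint_inj; exact: add0r. Qed.
Lemma selfadjoint_addN : left_inverse selfadjoint_zero selfadjoint_opp selfadjoint_add.
Proof. by move=> x; apply: selfadjoint_inj; exact: addNr. Qed.
HB.instance Definition _ := GRing.isZmodule.Build V
  selfadjoint_addA selfadjoint_addC selfadjoint_add0 selfadjoint_addN.

Lemma selfadjoint_scaleA k l x :
  selfadjoint_scale k (selfadjoint_scale l x) = selfadjoint_scale (k * l) x.
Proof. by apply: selfadjoint_inj; exact: scalerA. Qed.
Lemma selfadjoint_scale1 : left_id 1 selfadjoint_scale.
Proof. by move=> x; apply: selfadjoint_inj; exact: scale1r. Qed.
Lemma selfadjoint_scaleDr : right_distributive selfadjoint_scale +%R.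
Proof. by move=> k x y; apply: selfadjoint_inj; exact: scalerDr. Qed.
Lemma selfadjoint_scaleDl x : {morph selfadjoint_scale^~ x : k l / k + l}.
Proof. by move=> k l; apply: selfadjoint_inj; exact: scalerDl. Qed.
HB.instance Definition _ := GRing.Zmodule_isLmodule.Build R V
  selfadjoint_scaleA selfadjoint_scale1 selfadjoint_scaleDr selfadjoint_scaleDl.

Local Notation hj := (sa_jordan hA).

(** Being isometric and fixing [c], the involution keeps the distance to [c];
    balls with self-adjoint centres are convex. *)
Lemma norm_symmetrize (x c : A) : star c = c ->
  nu (re star x - c) <= nu (x - c).
Proof.
move=> sc; have -> : re star x - c = 2^-1 *: ((x - c) + star (x - c)).
  by rewrite /re (sa_starD hA) (sa_starN hA) sc; vlin R.
rewrite (sa_normZ hA) ger0_norm ?invr_ge0 //.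
by have := sa_normD hA (x - c) (star (x - c)); rewrite (sa_norm_star hA); lin_arith.
Qed.

(** Limits and common points of balls are found in [A] and then symmetrized. *)
Lemma selfadjoint_jb : jb_algebra selfadjoint_jp (fun x => nu (sval x)).
Proof.
split.
- split=> [x y|x k y z|x y]; apply: selfadjoint_inj.
  + exact: jordan_comm hj _ _.
  + exact: jordan_linear hj _ _ _ _.
  + exact: jordan_identity hj _ _.
- by move=> x /(sa_norm_eq0 hA) x0; apply: selfadjoint_inj.
- by move=> x y; exact: (sa_normD hA).
- by move=> k x; exact: (sa_normZ hA).
- by move=> x y; exact: (sa_normM hA).
- by move=> x; exact: (sa_norm_square hA (svalP x)).
- move=> u v /(f_equal sval) E1 /(f_equal sval) E2.
  exact: (sa_two_squares hA (svalP u) (svalP v)).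
- move=> l a; have [C C0 H] := hermitian_cos hA l (svalP a).
  by exists C => // t x t1; exact: H.
- move=> u cu; have [l Hl] := sa_complete hA (u := fun n => sval (u n)) cu.
  exists (exist _ (re star l) (star_re hA l) : V) => e /Hl[N HN]; exists N => n /HN.
  apply: le_trans; rewrite -(sa_normN hA) -(sa_normN hA (_ - l)) !opprB.
  exact: norm_symmetrize (svalP (u n)).
move=> P c H; pose S z := exists2 k, P k & z = sval (c k).
have [s sS|x Hx] := sa_balls hA (S := S).
  have /choice[f Hf] : forall z, exists k, S z -> P k /\ z = sval (c k).
    by move=> z; case: (pselect (S z)) => [[k Pk ->]|nS]; [exists k|exists 0].
  have [k|x Hx] := H (map f s).
    by move=> /mapP[z zs ->]; have [] := Hf z (sS z zs).
  exists (sval x) => z zs; have [_ ->] := Hf z (sS z zs).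
  by apply: Hx; exact: map_f.
exists (exist _ (re star x) (star_re hA x) : V) => k Pk.
apply: le_trans (norm_symmetrize _ (svalP (c k))) _.
by apply: Hx; exists k.
Qed.

Theorem star_algebra_unit : exists2 e, star e = e & forall b, jp e b = b.
Proof.
have [e He] := jb_algebra_unit selfadjoint_jb.
have H b : star b = b -> jp (sval e) b = b.
  by move=> sb; have := f_equal sval (He (exist _ b sb)).
exists (sval e); first exact: (svalP (e : V)).
move=> b; rewrite {1}(re_imag hA b) (jpDr hj) (sa_jp_im hA).
by rewrite !H -?(re_imag hA) ?(star_re hA) ?(star_imag hA).
Qed.
End SelfAdjoint.

(** * Dual JB*-algebras over the reals *)

(** An alias, so that the restriction of scalars does not compete with the
    complex structure. *)
Definition real_module (R : realType) (J : lmodType R[i]) : Type := J.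

Section RealModule.
Variables (R : realType) (J : lmodType R[i]).
HB.instance Definition _ := GRing.Zmodule.copy (real_module J) J.
Definition real_scale (k : R) (x : real_module J) : real_module J := (k%:C)%C *: (x : J).
Lemma real_scaleA k l x : real_scale k (real_scale l x) = real_scale (k * l) x.
Proof. by rewrite /real_scale scalerA rmorphM. Qed.
Lemma real_scale1 : left_id 1 real_scale.
Proof. by move=> x; rewrite /real_scale rmorph1 scale1r. Qed.
Lemma real_scaleDr : right_distributive real_scale +%R.
Proof. by move=> k x y; rewrite /real_scale scalerDr. Qed.
Lemma real_scaleDl x : {morph real_scale^~ x : k l / k + l}.
Proof. by move=> k l; rewrite /real_scale rmorphD scalerDl. Qed.
HB.instance Definition _ := GRing.Zmodule_isLmodule.Build R (real_module J)
  real_scaleA real_scale1 real_scaleDr real_scaleDl.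
End RealModule.

Section RealNorm.
Variables (R : realType) (E : normedModType R[i]).
Implicit Types x y : E.
Local Notation i := (0 +i* 1 : R[i])%C.

Definition real_norm x : R := complex.Re `|x|.
Local Notation nu := real_norm.

Lemma real_normE x : `|x| = ((nu x)%:C)%C.
Proof.
have := normr_ge0 x; rewrite lecE /nu => /andP[/eqP /= + _].
by case: `|x| => a b /= ->.
Qed.
Lemma real_norm_ge0 x : 0 <= nu x.
Proof. by have := normr_ge0 x; rewrite real_normE lecR. Qed.
Lemma normr_real (k : R) : `|(k%:C)%C| = ((`|k|)%:C)%C.
Proof. by rewrite normc_def /= expr0n /= addr0 sqrtr_sqr. Qed.
Lemma normr_i : `|i| = 1.
Proof. by rewrite normc_def /= expr0n /= add0r expr1n sqrtr1. Qed.
Lemma i_mul_i : i * i = -1.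
Proof. by apply/eqP; rewrite eq_complex /=; apply/andP; split; apply/eqP; ring. Qed.

Lemma real_normD x y : nu (x + y) <= nu x + nu y.
Proof.
have := ler_normD x y; rewrite !real_normE -rmorphD lecE /=.
by case/andP.
Qed.
Lemma real_normZ (k : R) x : nu ((k%:C)%C *: x) = `|k| * nu x.
Proof. by apply: complexI; rewrite rmorphM -real_normE normrZ normr_real real_normE. Qed.
Lemma real_norm_i x : nu (i *: x) = nu x.
Proof. by rewrite /nu normrZ normr_i mul1r. Qed.
Lemma real_norm_eq0 x : nu x = 0 -> x = 0.
Proof. by move=> x0; apply: normr0_eq0; rewrite real_normE x0. Qed.
End RealNorm.

Lemma gt0_complex (R : realType) (z : R[i]) : 0 < z ->
  z = (((complex.Re z)%:C)%C) /\ 0 < complex.Re z.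
Proof. by case: z => a b; rewrite ltcE /= => /andP[/eqP -> ->]. Qed.

Lemma real_complete (R : realType) (E : completeNormedModType R[i]) (u : nat -> E) :
  (forall e : R, 0 < e -> exists N, forall m n, (N <= m)%N -> (N <= n)%N ->
     real_norm (u m - u n) <= e) ->
  exists l, forall e : R, 0 < e -> exists N, forall n, (N <= n)%N -> real_norm (u n - l) <= e.
Proof.
move=> cu.
have : cvg (u @ \oo)%classic.
  apply/cauchy_cvgP/cauchy_exP => e /gt0_complex[-> e0].
  have [N HN] := cu _ (divr_gt0 e0 (ltr0n R 2)); exists (u N).
  exists N => // n /= Nn; rewrite -ball_normE /= real_normE ltcR.
  by apply: le_lt_trans (HN N n (leqnn N) Nn) _; lin_arith.
move=> /cvg_ex[l ul]; exists l => e e0.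
have eC : 0 < ((e%:C)%C : R[i]) by rewrite ltcR.
have [N _ HN] := (cvgrPdist_lt _ _).1 ul _ eC; exists N => n Nn.
have := HN n Nn; rewrite /= distrC real_normE ltcR; exact: ltW.
Qed.

(** * Weak* compactness of balls *)

Section UltraLimit.
Variables (R : realType) (T : Type) (F : set_system T).
Hypothesis UF : UltraFilter F.
Local Open Scope classical_set_scope.

Lemma ultra_bounded_cvg (f : T -> R) M :
  (\forall s \near F, `|f s| <= M) -> exists l : R, f @ F --> l.
Proof.
move=> fM; have UfF : UltraFilter (f @ F).
  split=> [|G GF sub]; first exact: fmap_proper_filter.
  rewrite predeqE => B; split; last exact: sub.
  move=> GB; have [//|nB] := in_ultra_setVsetC (f @^-1` B) UF.
  have : G (B `&` ~` B) by apply: filterI => //; exact: sub.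
  by rewrite setICr => /filter_not_empty.
have := @segment_compact R (- M) M; rewrite compact_ultra => /(_ _ UfF) [|l [_ fl]].
  by apply: filterS fM => s; rewrite /= in_itv /= ler_norml.
by exists l.
Qed.

Definition complex_lim (g : T -> R[i]) (z : R[i]) :=
  (fun s => complex.Re (g s)) @ F --> complex.Re z /\
  (fun s => complex.Im (g s)) @ F --> complex.Im z.

Lemma complex_norm_le (z : R[i]) (M : R) : 0 <= M ->
  (`|z| <= (M%:C)%C) = ((complex.Re z) ^+ 2 + (complex.Im z) ^+ 2 <= M ^+ 2).
Proof.
move=> M0; rewrite normc_def lecR -{1}[M]ger0_norm // -sqrtr_sqr ler_sqrt //.
by rewrite sqr_ge0.
Qed.

Lemma complex_lim_ex (g : T -> R[i]) (M : R) : 0 <= M ->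
  (\forall s \near F, `|g s| <= (M%:C)%C) -> exists z, complex_lim g z.
Proof.
move=> M0 gM.
have [|a ga] := @ultra_bounded_cvg (fun s => complex.Re (g s)) M.
  apply: filterS gM => s; rewrite complex_norm_le // => gs.
  rewrite -(ler_pXn2r (n := 2)) ?nnegrE // real_normK ?num_real //.
  by have := sqr_ge0 (complex.Im (g s)); lin_arith.
have [|b gb] := @ultra_bounded_cvg (fun s => complex.Im (g s)) M.
  apply: filterS gM => s; rewrite complex_norm_le // => gs.
  rewrite -(ler_pXn2r (n := 2)) ?nnegrE // real_normK ?num_real //.
  by have := sqr_ge0 (complex.Re (g s)); lin_arith.
by exists (a +i* b)%C.
Qed.

Lemma complex_lim_unique g z w : complex_lim g z -> complex_lim g w -> z = w.
Proof.
case: z w => [a b] [c d] [/= ga gb] [/= gc gd]; congr (_ +i* _)%C.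
  exact: cvg_unique ga gc.
exact: cvg_unique gb gd.
Qed.

Lemma complex_lim_linear g h z w (k : R[i]) : complex_lim g z -> complex_lim h w ->
  complex_lim (fun s => k * g s + h s) (k * z + w).
Proof.
move=> [g1 g2] [h1 h2]; case: k z w g1 g2 h1 h2 => [a b] [c d] [p q] /= g1 g2 h1 h2.
have E1 : (fun s => complex.Re ((a +i* b)%C * g s + h s)) =
   (fun s => a * complex.Re (g s) - b * complex.Im (g s) + complex.Re (h s)).
  by apply/funext => s; case: (g s) (h s) => [? ?] [? ?].
have E2 : (fun s => complex.Im ((a +i* b)%C * g s + h s)) =
   (fun s => a * complex.Im (g s) + b * complex.Re (g s) + complex.Im (h s)).
  by apply/funext => s; case: (g s) (h s) => [? ?] [? ?].
split; rewrite ?E1 ?E2.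
  by apply: cvgD => //; apply: cvgB; apply: cvgMr.
by apply: cvgD => //; apply: cvgD; apply: cvgMr.
Qed.

Lemma complex_lim_le g z c (M : R) : 0 <= M -> complex_lim g z ->
  (\forall s \near F, `|g s - c| <= (M%:C)%C) -> `|z - c| <= (M%:C)%C.
Proof.
move=> M0 [g1 g2] gM; rewrite complex_norm_le //.
have : (fun s => (complex.Re (g s) - complex.Re c) ^+ 2 + (complex.Im (g s) - complex.Im c) ^+ 2) @ F
   --> (complex.Re z - complex.Re c) ^+ 2 + (complex.Im z - complex.Im c) ^+ 2.
  by rewrite !expr2; apply: cvgD; apply: cvgM; apply: cvgB => //; exact: cvg_cst.
move=> /cvgr_to_le H; rewrite !raddfB; apply: H.
by apply: filterS gM => s; rewrite complex_norm_le // !raddfB.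
Qed.
End UltraLimit.

Section DualBalls.
Variables (R : realType) (E V : completeNormedModType R[i]).
Variable pairing : E -> V -> R[i]^o.
Hypothesis pairing_bounded : forall x, bounded_linear (pairing x).
Hypothesis pairing_linear : forall v, linear (fun x => pairing x v).
Hypothesis pairing_onto : forall f : V -> R[i]^o, bounded_linear f ->
  exists x, pairing x = f.
Hypothesis pairing_norm : forall x, `|x| = (dual_norm (pairing x))%:C%C.

(** The supremum that defines the dual norm is finite because functionals are
    bounded. *)
Lemma pairing_le x v : `|pairing x v| <= ((real_norm x * real_norm v)%:C)%C.
Proof.
have [lin cont] := pairing_bounded x.
pose f : {linear V -> R[i]^o} := HB.pack (pairing x) (GRing.isLinear.Build _ _ _ _ _ lin).
have [r /andP[r0 Hr]] : exists r : R, (0 <= r) && `[< forall w, `|f w| <= (r%:C)%C * `|w| >].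
  have /linear_boundedP/pinfty_ex_gt0[r r0 Hr] : bounded_near f (nbhs (0 : V)).
    by apply/linear_bounded_continuous.
  move: r0 Hr; case: r => a b; rewrite ltcE /= => /andP[/eqP -> a0] Hr.
  by exists a; rewrite ltW //=; apply/asboolP.
move/asboolP: Hr => Hr.
have le1 w : `|w| <= 1 -> real_norm (pairing x w) <= real_norm x.
  move=> w1; rewrite [real_norm x]/(complex.Re _) pairing_norm /=.
  rewrite /dual_norm; apply: ub_le_sup; last by exists w.
  exists r => _ [u /= u1 <-]; change (real_norm (pairing x u) <= r); rewrite -lecR -real_normE.
  by apply: le_trans (Hr u) _; rewrite ler_piMr // lecR.
rewrite real_normE lecR.
have p0 : pairing x 0 = 0 by exact: (linear0 f).
have [->|v0] := eqVneq v 0.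
  rewrite p0; by rewrite /real_norm !normr0 /= mulr0.
have nv0 : 0 < real_norm v.
  by rewrite -ltcR -real_normE normr_gt0.
have := le1 ((((real_norm v)^-1)%:C)%C *: v).
have -> : pairing x ((((real_norm v)^-1)%:C)%C *: v) =
   (((real_norm v)^-1)%:C)%C *: pairing x v.
  by have := lin (((real_norm v)^-1)%:C)%C v 0; rewrite p0 !addr0.
rewrite [in X in X -> _]real_normE !real_normZ ger0_norm ?invr_ge0 ?(ltW nv0) //.
by rewrite mulVf ?gt_eqF // lexx => /(_ isT); rewrite mulrC ler_pdivrMr.
Qed.

Lemma real_norm_dual x (M : R) : 0 <= M ->
  (forall v, `|v| <= 1 -> `|pairing x v| <= (M%:C)%C) -> real_norm x <= M.
Proof.
move=> M0 H; rewrite [real_norm x]/(complex.Re _) pairing_norm /=.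
apply: ge_sup; first by exists (complex.Re `|pairing x 0|); exists 0; rewrite //= normr0.
by move=> _ [v /= v1 <-]; have := H v v1; rewrite real_normE lecR.
Qed.

(** Balls of a dual space have the finite intersection property: choose a
    point for each finite subfamily and take the weak* limit along an
    ultrafilter of finite subfamilies. *)
Lemma dual_balls (S : E -> Prop) :
  (forall s : seq E, (forall c, c \in s -> S c) ->
     exists x, forall c, c \in s -> real_norm (x - c) <= 1) ->
  exists x, forall c, S c -> real_norm (x - c) <= 1.
Proof.
move=> H; have [[c0 Sc0]|nS] := pselect (exists c0, S c0); last first.
  by exists 0 => c Sc; case: nS; exists c.
have /choice[f Hf] : forall s : seq E, exists x, (forall c, c \in s -> S c) ->
    forall c, c \in s -> real_norm (x - c) <= 1.
  move=> s; have [/H[x Hx]|nH] := pselect (forall c, c \in s -> S c); first by exists x.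
  by exists 0.
pose inS (s : seq E) := forall c, c \in s -> S c.
pose G : set_system (seq E) := fun A => exists2 s, inS s &
  forall s', inS s' -> {subset s <= s'} -> A s'.
have GF : ProperFilter G.
  split; first by move=> [s sS /(_ s sS)]; apply.
  split; first by exists [::].
    move=> A B [s sS sA] [t tS tB]; exists (s ++ t).
      by move=> c; rewrite mem_cat => /orP[]; [exact: sS|exact: tS].
    move=> s' s'S sub; split; [apply: sA|apply: tB] => // c cs; apply: sub;
      by rewrite mem_cat cs ?orbT.
  by move=> A B AB [s sS sA]; exists s => // s' s'S sub; apply: AB; exact: sA.
have [U [UU GU]] := ultraFilterLemma GF.
have near1 c : S c -> U [set s | real_norm (f s - c) <= 1]%classic.
  move=> Sc; apply: GU; exists [:: c] => [d|s sS sub /=]; first by rewrite inE => /eqP ->.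
  by apply: Hf => //; apply: sub; rewrite mem_head.
have pB x y v : pairing x v - pairing y v = pairing (x - y) v.
  by have := pairing_linear v (-1) y x; rewrite !scaleN1r addrC => <-; rewrite addrC.
have near_le c v : S c -> U [set s | `|pairing (f s) v - pairing c v|
    <= ((real_norm v)%:C)%C]%classic.
  move=> Sc; apply: filterS (near1 c Sc) => s /= s1; rewrite pB.
  apply: le_trans (pairing_le _ _) _; by rewrite lecR ler_piMl ?real_norm_ge0.
have /choice[L HL] : forall v : V, exists z : R[i]^o, complex_lim U (fun s => pairing (f s) v) z.
  move=> v.
  apply: (@complex_lim_ex _ _ _ UU _ ((1 + real_norm c0) * real_norm v)).
    by rewrite mulr_ge0 ?addr_ge0 ?real_norm_ge0.
  apply: filterS (near_le c0 v Sc0) => s /= s1.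
  rewrite -[pairing (f s) v](subrK (pairing c0 v)); apply: le_trans (ler_normD _ _) _.
  rewrite mulrDl mul1r rmorphD /=; apply: lerD => //; exact: pairing_le.
have L_le c v : S c -> `|L v - pairing c v| <= ((real_norm v)%:C)%C.
  by move=> Sc; apply: (@complex_lim_le _ _ _ UU (fun s => pairing (f s) v)); [exact: real_norm_ge0|exact: HL|exact: near_le].
have linL : linear L.
  move=> k v w; apply: (@complex_lim_unique _ _ _ UU _ _ _ (HL (k *: v + w))).
  have := @complex_lim_linear _ _ _ UU _ _ _ _ k (HL v) (HL w).
  congr complex_lim; apply/funext => s.
  by have [lin _] := pairing_bounded (f s); rewrite lin.
have [x Lx] : exists x, pairing x = L.
  apply: pairing_onto; split=> //.
  pose Lf : {linear V -> R[i]^o} := HB.pack L (GRing.isLinear.Build _ _ _ _ _ linL).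
  apply: (@bounded_linear_continuous _ _ _ Lf); apply/bounded_funP => r.
  exists (((1 + real_norm c0)%:C)%C * `|r|) => v vr.
  rewrite -[Lf v](subrK (pairing c0 v)); apply: le_trans (ler_normD _ _) _.
  apply: (@le_trans _ _ ((((1 + real_norm c0) * real_norm v)%:C)%C)).
    rewrite mulrDl mul1r rmorphD /=; apply: lerD; first exact: L_le.
    exact: pairing_le.
  rewrite rmorphM /= -real_normE; apply: ler_wpM2l; first by rewrite lecR addr_ge0 ?real_norm_ge0.
  by rewrite ger0_norm //; exact: le_trans (normr_ge0 v) vr.
exists x => c Sc; apply: real_norm_dual => // v v1; rewrite -pB Lx.
apply: le_trans (L_le c v Sc) _; rewrite -real_normE //.
Qed.
End DualBalls.

Section JBWUnit.
Variables (R : realType) (J : completeNormedModType R[i]).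
Variables (jp : J -> J -> J) (star : J -> J).
Hypothesis hJ : JBWstar_algebra jp star.
Local Notation i := (0 +i* 1 : R[i])%C.
Local Notation A := (real_module J).
Let im (x : A) : A := i *: (x : J).

Lemma JBW_star_algebra : @star_algebra R A jp star im (@real_norm R J).
Proof.
have [hA [V [pairing [pb pl po pn]]]] := hJ.
have scE (k : R) (x : A) : k *: x = ((k%:C)%C *: (x : J) : J) by [].
have jlin b k x y : jp (k *: x + y) b = k *: jp x b + jp y b := JBa_linear hA b k x y.
have jpZ k x y : jp (k *: x) y = k *: jp x y.
  have jp0 : jp 0 y = 0.
    by have := jlin y (-1) 0 0; rewrite scaler0 addr0 scaleN1r addNr.
  by have := jlin y k x 0; rewrite !addr0 jp0 addr0.
have st0 : star 0 = 0.
  have := JBa_star_conjugate_linear hA (-1) 0 0; rewrite scaler0 addr0.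
  by rewrite (_ : conjc (-1) = -1) ?scaleN1r ?addNr // rmorphN1.
split.
- split=> [x y|y k x x'|x y].
  + exact: JBa_commutative hA x y.
  + exact: jlin.
  + exact: JBa_Jordan hA x y.
- move=> k x y; rewrite /im !scE scalerDr !scalerA; congr (_ + _).
  by rewrite mulrC.
- by move=> x; rewrite /im scalerA i_mul_i scaleN1r.
- by move=> x y; exact: jpZ.
- move=> k x y; have := JBa_star_conjugate_linear hA (k%:C)%C x y.
  by rewrite (_ : conjc _ = (k%:C)%C) //; apply/eqP; rewrite eq_complex /= oppr0 !eqxx.
- exact: JBa_star_involutive hA.
- by move=> x y; rewrite (JBa_star_mul hA) (JBa_commutative hA).
- move=> x; have := JBa_star_conjugate_linear hA i x 0.
  by rewrite addr0 st0 addr0 /im => ->; rewrite -[RHS](scaleNr i (star x : J)); apply: (congr1 (fun k : R[i] => k *: (star x : J)));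
    apply/eqP; rewrite eq_complex /= oppr0 !eqxx.
- by move=> x; exact: real_norm_eq0.
- by move=> x y; exact: real_normD.
- by move=> k x; exact: real_normZ.
- by move=> x; exact: real_norm_i.
- move=> x y; have := JBa_norm_le hA x y.
  by rewrite !real_normE -rmorphM lecR.
- move=> x; apply: complexI; rewrite rmorphXn /= -!real_normE -(JBa_norm hA).
  rewrite /bilU /algebra_triple; congr `|_ + _ - _|; exact: (JBa_commutative hA).
- exact: real_complete.
- exact: (dual_balls pb pl po pn).
Qed.

Theorem JBW_unit : exists2 e, star e = e & forall b, jp e b = b.
Proof. exact: star_algebra_unit JBW_star_algebra. Qed.
End JBWUnit.

(** * Two-local triple homomorphisms of unital algebras *)

Section TwoLocal.
Variables (R : realType) (A : lmodType R) (jp : A -> A -> A).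
Variables (star im : A -> A) (nu : A -> R).
Hypothesis hA : star_algebra jp star im nu.
Variable e : A.
Hypothesis star_e : star e = e.
Hypothesis e_jp : forall b, jp e b = b.
Variables (B : lmodType R) (imB : B -> B) (tp : B -> B -> B -> B).
Hypothesis imB_linear : forall k x y, imB (k *: x + y) = k *: imB x + imB y.
Hypothesis imBK : forall x, imB (imB x) = - x.
Hypothesis tp_linear : forall b c k x y, tp (k *: x + y) b c = k *: tp x b c + tp y b c.
Hypothesis tp_linear_mid : forall a c k x y, tp a (k *: x + y) c = k *: tp a x c + tp a y c.
Hypothesis tp_sym : forall a b c, tp a b c = tp c b a.
Hypothesis tp_im : forall a b c, tp (imB a) b c = imB (tp a b c).
Hypothesis tp_im_mid : forall a b c, tp a (imB b) c = - imB (tp a b c).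
Local Infix "**" := jp (at level 40, left associativity).
Local Notation hj := (sa_jordan hA).
Local Notation tr x y z := (bilU jp x z (star y)).
Local Notation re := (re star).
Local Notation imag := (imag star im).
Local Notation re_imag := (re_imag hA).
Local Notation star_re := (star_re hA).
Local Notation star_imag := (star_imag hA).
Local Notation jpe := (jordan_one_comm hj e_jp).

Variable hom : (A -> B) -> Prop.
Hypothesis hom_linear : forall f, hom f -> forall k x y, f (k *: x + y) = k *: f x + f y.
Hypothesis hom_im : forall f, hom f -> forall x, f (im x) = imB (f x).
Hypothesis hom_tp : forall f, hom f -> forall a b c, f (tr a b c) = tp (f a) (f b) (f c).
(* The form in which continuity enters. *)
Hypothesis hom_lim : forall f g, hom f -> hom g -> forall u l,
  (forall n : nat, f (u n) = g (u n)) ->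
  (forall d : R, 0 < d -> exists N, forall n, (N <= n)%N -> nu (u n - l) <= d) ->
  f l = g l.
Variable T : A -> B.
Hypothesis T_local : forall a b, exists2 f, hom f & f a = T a /\ f b = T b.

(** Iterating [s |-> (3 s - {s,s,s}) / 2] from [1 + y] converges to 1
    quadratically, and commutes with every triple homomorphism: the value at
    [1 + y] determines the value at 1. *)
Definition newton (y : A) : A := - 2^-1 *: (3 *: (y ** y) + y ** y ** y).

Lemma newtonE y : star y = y ->
  e + newton y = 2^-1 *: (3 *: (e + y) - tr (e + y) (e + y) (e + y)).
Proof.
move=> sy; rewrite (sa_starD hA) star_e sy /newton /bilU.
have sE z : (e + y) ** z = z + y ** z by rewrite (jpDl hj) e_jp.
rewrite (jpC hj (_ ** _) (e + y)) addrK !sE !(jpDr hj) !jpe (jpC hj y (y ** y)).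
by vlin R.
Qed.

Lemma newton_norm y : nu y <= 4^-1 -> nu (newton y) <= 2^-1 * nu y.
Proof.
move=> y4; have y0 := sa_norm_ge0 hA y; rewrite /newton (sa_normZ hA) normrN ger0_norm ?invr_ge0 //.
have := sa_normD hA (3 *: (y ** y)) (y ** y ** y); rewrite (sa_normZ hA) normr_nat.
have h2 := sa_normM hA y y.
have h3 := le_trans (sa_normM hA (y ** y) y) (ler_wpM2r y0 h2).
have y2 := ler_wpM2r y0 y4.
have y3 := ler_wpM2r y0 y2; lin_arith.
Qed.

Lemma newton_star y : star y = y -> star (newton y) = newton y.
Proof. by move=> sy; rewrite /newton !(sa_starZ hA, sa_starD hA, sa_star_jp hA) sy. Qed.

Lemma hom_unit f g y : hom f -> hom g -> star y = y -> nu y <= 4^-1 ->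
  f (e + y) = g (e + y) -> f e = g e.
Proof.
move=> hf hg sy y4 fg; pose u n := iter n newton y.
have su n : star (u n) = u n by elim: n => //= n IH; exact: newton_star.
have nuu n : nu (u n) <= 4^-1 /\ nu (u n) <= nu y * 2^-1 ^+ n.
  elim: n => [|n [IH1 IH2]]; first by rewrite expr0 mulr1.
  have := newton_norm IH1; have := sa_norm_ge0 hA (u n) => h0 h1.
  split; first by apply: le_trans h1 _; lin_arith.
  by apply: le_trans h1 _; rewrite exprS; lin_arith.
apply: (@hom_lim f g hf hg (fun n => e + u n)).
  elim=> [|n IH]; first exact: fg.
  rewrite [u n.+1]/(newton (u n)) newtonE //.
  have E h : hom h -> h (2^-1 *: (3 *: (e + u n) - tr (e + u n) (e + u n) (e + u n))) =
      2^-1 *: (3 *: h (e + u n) - tp (h (e + u n)) (h (e + u n)) (h (e + u n))).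
    move=> hh; have hl := hom_linear hh.
    move: (e + u n) => s; by rewrite (linZ hl) (linD hl) (linN hl) (linZ hl) (hom_tp hh).
  by rewrite !E // IH.
move=> d d0; have y0 := sa_norm_ge0 hA y.
have d1 : 0 < d / (nu y + 1) by rewrite divr_gt0 //; lin_arith.
have r01 : 0 <= (2^-1 : R) < 1 by apply/andP; split; lin_arith.
have [N HN] := expr_small r01 d1; exists N => n Nn; rewrite addrC addKr.
have [_ h1] := nuu n; apply: le_trans h1 _.
have h2 : 2^-1 ^+ n <= d / (nu y + 1).
  by apply: le_trans HN; apply: ler_wiXn2l => //; lin_arith.
apply: le_trans (ler_wpM2l y0 h2) _; rewrite mulrCA ger_pMr //.
by rewrite ler_pdivrMr; lin_arith.
Qed.

(** The point is [e + k a] for a small [k]: a homomorphism that takes the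
    value of [T] there agrees there with those given by locality for the pairs
    with [e] and with [a]. *)
Lemma unit_test a : star a = a -> exists p, forall f, hom f -> f p = T p ->
  f e = T e /\ f a = T a.
Proof.
move=> sa; pose k := (4 * (nu a + 1))^-1; have a0 := sa_norm_ge0 hA a.
have k0 : 0 < k by rewrite invr_gt0; lin_arith.
have ka : nu (k *: a) <= 4^-1.
  rewrite (sa_normZ hA) gtr0_norm // /k mulrC ler_pdivrMr; lin_arith.
have ska : star (k *: a) = k *: a by rewrite (sa_starZ hA) sa.
exists (e + k *: a) => f hf fp.
have fe : f e = T e.
  have [g hg [gp ge]] := T_local (e + k *: a) e.
  by rewrite -ge; apply: (hom_unit hf hg ska ka); rewrite fp gp.
split=> //; have [g hg [gp ga]] := T_local (e + k *: a) a.
have ge : f e = g e by apply: (hom_unit hf hg ska ka); rewrite fp gp.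
have : f (e + k *: a) = g (e + k *: a) by rewrite fp gp.
have fl := hom_linear hf; have gl := hom_linear hg.
rewrite (linD fl) (linD gl) (linZ fl) (linZ gl) ge => /addrI.
by rewrite ga => /(scalerI (lt0r_neq0 k0)).
Qed.

Lemma tr_unit y : tr e y e = star y.
Proof. by rewrite /bilU !e_jp addrK. Qed.

(** Together with the unit, [c + i d] carries the values at [c] and [d]:
    its adjoint is [{e, c + i d, e}]. *)
Lemma split_test c d f : star c = c -> star d = d -> hom f ->
  f e = T e -> f (c + im d) = T (c + im d) -> f c = T c /\ f d = T d.
Proof.
move=> sc sd hf fe fy; set y := c + im d in fy.
have sy : star y = c - im d by rewrite /y (sa_starD hA) (sa_star_im hA) sc sd.
have G g : hom g -> g e = T e -> g y = T y ->
    g c = 2^-1 *: (T y + tp (T e) (T y) (T e)) /\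
    imB (g d) = 2^-1 *: (T y - tp (T e) (T y) (T e)).
  move=> hg ge gy; have gl := hom_linear hg.
  rewrite -ge -gy -(hom_tp hg) tr_unit sy -(hom_im hg) /y.
  by rewrite !(linD gl) (linN gl); split; vlin R.
have [fc fd] := G f hf fe fy.
have imBI u v : imB u = imB v -> u = v.
  by move=> /(f_equal imB); rewrite !imBK => /oppr_inj.
split.
  have [p Hp] := unit_test sc; have [g hg [gp gy]] := T_local p y.
  have [ge gc] := Hp g hg gp; have [gc' _] := G g hg ge gy.
  by rewrite -gc gc' fc.
have [p Hp] := unit_test sd; have [g hg [gp gy]] := T_local p y.
have [ge gd] := Hp g hg gp; have [_ gd'] := G g hg ge gy.
by apply: imBI; rewrite -gd gd' fd.
Qed.

(** Test the pair of the point of [unit_test] for [a] and of [c + i d]: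
    two complex points control three self-adjoint ones. *)
Lemma three_local a c d : star a = a -> star c = c -> star d = d ->
  exists2 f, hom f & [/\ f a = T a, f c = T c, f d = T d & f (c + im d) = T (c + im d)].
Proof.
move=> sa sc sd; have [p Hp] := unit_test sa.
have [f hf [fp fy]] := T_local p (c + im d); exists f => //.
have [fe fa] := Hp f hf fp; have [fc fd] := split_test sc sd hf fe fy.
by split.
Qed.

Lemma T_split c d : star c = c -> star d = d -> T (c + im d) = T c + imB (T d).
Proof.
move=> sc sd; have [f hf [_ fc fd fy]] := three_local sc sc sd.
by rewrite -fy (linD (hom_linear hf)) (hom_im hf) fc fd.
Qed.
Lemma T_addsa a b : star a = a -> star b = b -> T (a + b) = T a + T b.
Proof.
move=> sa sb; have sab : star (a + b) = a + b by rewrite (sa_starD hA) sa sb.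
have [f hf [fa fb fab _]] := three_local sa sb sab.
by rewrite -fab (linD (hom_linear hf)) fa fb.
Qed.

Lemma T_scale k x : T (k *: x) = k *: T x.
Proof. by have [f hf [fk fx]] := T_local (k *: x) x; rewrite -fk -fx (linZ (hom_linear hf)). Qed.
Lemma T_im x : T (im x) = imB (T x).
Proof. by have [f hf [fk fx]] := T_local (im x) x; rewrite -fk -fx (hom_im hf). Qed.
Lemma imBD x y : imB (x + y) = imB x + imB y. Proof. exact: (linD imB_linear). Qed.

Lemma T_add x y : T (x + y) = T x + T y.
Proof.
have Tx z : T z = T (re z) + imB (T (imag z)).
  by rewrite {1}[z]re_imag T_split ?star_re ?star_imag.
have -> : x + y = (re x + re y) + im (imag x + imag y).
  by rewrite (sa_imD hA) addrACA -!re_imag.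
rewrite T_split ?(sa_starD hA) ?star_re ?star_imag // !T_addsa ?star_re ?star_imag //.
by rewrite imBD (Tx x) (Tx y) addrACA.
Qed.

Theorem two_local_linear k x y : T (k *: x + y) = k *: T x + T y.
Proof. by rewrite T_add T_scale. Qed.

Lemma tpDl a a' b c : tp (a + a') b c = tp a b c + tp a' b c.
Proof. exact: (linD (tp_linear b c)). Qed.
Lemma tpDm a b b' c : tp a (b + b') c = tp a b c + tp a b' c.
Proof. exact: (linD (tp_linear_mid a c)). Qed.
Lemma tpDr a b c c' : tp a b (c + c') = tp a b c + tp a b c'.
Proof. by rewrite tp_sym tpDl !(tp_sym a). Qed.
Lemma tp_imr a b c : tp a b (imB c) = imB (tp a b c).
Proof. by rewrite tp_sym tp_im tp_sym. Qed.

Lemma T_quad a b : star a = a -> star b = b -> T (tr a b a) = tp (T a) (T b) (T a).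
Proof.
move=> sa sb; have st : star (tr a b a) = tr a b a by rewrite (star_bilU hA) sa !sb.
have [f hf [fa fb ft _]] := three_local sa sb st.
by rewrite -ft (hom_tp hf) fa fb.
Qed.

Lemma T_triple_sa a b c : star a = a -> star b = b -> star c = c ->
  T (tr a b c) = tp (T a) (T b) (T c).
Proof.
move=> sa sb sc; have sac : star (a + c) = a + c by rewrite (sa_starD hA) sa sc.
have T4 u1 u2 u3 u4 : T (u1 + u2 + (u3 + u4)) = T u1 + T u2 + (T u3 + T u4).
  by rewrite !T_add.
have := T_quad sac sb; rewrite (bilUDl hj) !(bilUDm hj) T4 !T_quad // T_addsa //.
rewrite tpDl !tpDr (tp_sym (T c) _ (T a)) (bilUC hj c a) => E.
have E2 := f_equal (fun z => 2^-1 *: z) E.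
by apply: (eq_modulo E2); vlin R.
Qed.

(** Both sides are linear in [a] and [c] and conjugate linear in [b], so the
    self-adjoint case suffices. *)
Theorem two_local_triple a b c : T (tr a b c) = tp (T a) (T b) (T c).
Proof.
have TN x : T (- x) = - T x by rewrite -scaleN1r T_scale scaleN1r.
have ext (Q : A -> Prop) : (forall x y, Q x -> Q y -> Q (x + y)) ->
    (forall x, Q x -> Q (im x)) -> (forall x, star x = x -> Q x) -> forall x, Q x.
  move=> QD Qi Qs x; rewrite [x]re_imag; apply: QD; first exact: Qs (star_re x).
  by apply: Qi; exact: Qs (star_imag x).
move: c; apply: (ext) => [x y Hx Hy|x Hx|c sc].
- by rewrite (T_add x) (bilUDm hj) T_add Hx Hy tpDr.
- by rewrite (bilU_imm hA) !T_im Hx tp_imr.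
move: b; apply: (ext) => [x y Hx Hy|x Hx|b sb].
- by rewrite (T_add x) (sa_starD hA) (bilUDr hj) T_add Hx Hy tpDm.
- by rewrite (sa_star_im hA) (bilU_Nr hA) (bilU_imr hA) TN !T_im Hx tp_im_mid.
move: a; apply: (ext) => [x y Hx Hy|x Hx|a sa].
- by rewrite (T_add x) (bilUDl hj) T_add Hx Hy tpDl.
- by rewrite (bilU_iml hA) !T_im Hx tp_im.
exact: T_triple_sa.
Qed.
End TwoLocal.

(** * The theorem *)

Section Limits.
Variables (R : realType) (E F : completeNormedModType R[i]).
Lemma real_norm_cvg (u : nat -> E) l :
  (forall d : R, 0 < d -> exists N, forall n, (N <= n)%N -> real_norm (u n - l) <= d) ->
  (u n @[n --> \oo] --> l)%classic.
Proof.
move=> ul; apply/cvgrPdist_le => d d0.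
have [dE d1] := gt0_complex d0.
have [N HN] := ul _ d1; exists N => // n /= Nn.
by rewrite dE distrC real_normE lecR; exact: HN.
Qed.

Lemma continuous_agree (f g : E -> F) (u : nat -> E) l : continuous f -> continuous g ->
  (forall n, f (u n) = g (u n)) ->
  (forall d : R, 0 < d -> exists N, forall n, (N <= n)%N -> real_norm (u n - l) <= d) ->
  f l = g l.
Proof.
move=> cf cg fg /real_norm_cvg ul.
have h1 : (f (u n) @[n --> \oo] --> f l)%classic by apply: (cvg_comp _ _ ul); exact: cf.
have h2 : (g (u n) @[n --> \oo] --> g l)%classic by apply: (cvg_comp _ _ ul); exact: cg.
have E1 : (fun n => g (u n)) = (fun n => f (u n)) by apply/funext => n.
rewrite E1 in h2; exact: (cvg_unique (@norm_hausdorff _ _) h1 h2).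
Qed.
End Limits.

Theorem theorem3p5 (R : realType) (J : completeNormedModType R[i])
    (jp : J -> J -> J) (star : J -> J) (hJ : JBWstar_algebra jp star)
    (F : completeNormedModType R[i]) (tp : F -> F -> F -> F)
    (hF : JBstar_triple tp) (T : J -> F)
    (hT : two_local_triple_homomorphism (algebra_triple jp star) tp T) :
  linear T /\ triple_homomorphism (algebra_triple jp star) tp T.
Proof.
have [e se ej] := JBW_unit hJ; have hA := JBW_star_algebra hJ.
pose i : R[i] := (0 +i* 1)%C.
have trE a b c : algebra_triple jp star a b c = @bilU R (real_module J) jp a c (star b).
  have jpc := jordan_comm (sa_jordan hA).
  rewrite /algebra_triple /bilU (jpc (jp a _) c) (jpc (jp c _) a).
  by congr (_ - _); exact: addrC.
pose imB (x : real_module F) : real_module F := i *: (x : F).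
pose hom (f : real_module J -> real_module F) := bounded_linear (f : J -> F) /\
  triple_homomorphism (algebra_triple jp star) tp f.
have tpl b c k x y := JBt_linear hF b c k x y.
have tpm a c k x y := JBt_conjugate_linear hF a c k x y.
have conjR (k : R) : conjc ((k%:C)%C) = (k%:C)%C.
  by apply/eqP; rewrite eq_complex /= oppr0 !eqxx.
have conji : conjc i = - i by apply/eqP; rewrite eq_complex /= oppr0 !eqxx.
have tp0 b c : tp 0 b c = 0.
  by have := tpl b c (-1) 0 0; rewrite scaler0 addr0 scaleN1r addNr.
have tpm0 a c : tp a 0 c = 0.
  by have := tpm a c 1 0 0; rewrite scaler0 addr0 conjc1 scale1r => /esym/eqP;
     rewrite -subr_eq0 addrK => /eqP.
have f0 (f : J -> F) : linear f -> f 0 = 0.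
  by move=> lf; have := lf (-1) 0 0; rewrite scaler0 addr0 scaleN1r addNr.
have imBl (k : R) (x y : real_module F) : imB (k *: x + y) = k *: imB x + imB y.
  have scE (z : real_module F) : k *: z = ((k%:C)%C *: (z : F) : F) by [].
  by rewrite /imB !scE scalerDr !scalerA; congr (_ + _); rewrite mulrC.
have imBK (x : real_module F) : imB (imB x) = - x by rewrite /imB scalerA i_mul_i scaleN1r.
have homl f : hom f -> forall (k : R) x y, f (k *: x + y) = k *: f x + f y.
  by move=> [[lf _] _] k x y; exact: lf.
have homi f : hom f -> forall x, f (i *: (x : J)) = imB (f x).
  by move=> [[lf _] _] x; have := lf i x 0; rewrite (f0 f lf) !addr0.
have homt f : hom f -> forall a b c, f (@bilU R (real_module J) jp a c (star b)) = tp (f a) (f b) (f c).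
  by move=> [_ [_ ht]] a b c; rewrite -trE ht.
have homlim f g : hom f -> hom g -> forall (u : nat -> real_module J) l,
    (forall n, f (u n) = g (u n)) ->
    (forall d : R, 0 < d -> exists N, forall n, (N <= n)%N -> real_norm (u n - l : J) <= d) ->
    f l = g l.
  by move=> [[_ cf] _] [[_ cg] _] u l; exact: (@continuous_agree _ _ _ f g).
have Tloc a b : exists2 f, hom f & f a = T a /\ f b = T b.
  by have [f [bf tf fa fb]] := hT a b; exists f.
have lin := two_local_linear hA se ej imBl imBK homl homi homt homlim Tloc.
have tri : forall a b c, T (@bilU R (real_module J) jp a c (star b)) = tp (T a) (T b) (T c).
  apply: (two_local_triple hA se ej imBl imBK _ _ _ _ _ homl homi homt homlim Tloc).
  - by move=> b c k x y; exact: tpl.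
  - by move=> a c k x y; have := tpm a c (k%:C)%C x y; rewrite conjR.
  - exact: (JBt_symmetric hF).
  - by move=> a b c; have := tpl b c i a 0; rewrite tp0 !addr0.
  - move=> a b c; have := tpm a c i b 0; rewrite tpm0 !addr0 conji => ->.
    exact: (scaleNr i (tp a b c)).
have linT : linear T.
  move=> k x y; have [f [[lf _] _ fk fx]] := hT (k *: x) x.
  have Tk : T (k *: x) = k *: T x.
    by rewrite -fk -fx; have := lf k x 0; rewrite (f0 f lf) !addr0.
  by have := lin 1 (k *: x) y; rewrite !scale1r Tk.
by split=> //; split=> // a b c; rewrite trE tri.
Qed.
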